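(* Let $\alpha>0$, $\lambda>0$, $N$ a positive integer, and $\gamma_{jh}\ge0$ for all $1\le h\le j\le m$. Assume there exists a power spectral density $\bar\Phi$ (an integrable function on $\mathbb T$ with values in the $m\times m$ Hermitian positive semidefinite matrices) which is positive definite on some open interval of $\mathbb T$ and satisfies $\int_{\mathbb T}\bar\Phi e^{i\theta k}=R_k$ for $k=0,\dots,n$. Then the problem $$\min\ J(\mathbf p,\mathbf Q)+\frac{2\alpha}{N}\big[g_\lambda(\mathbf p)+h_W(\mathbf Q)\big]\quad\text{s.t. }\mathbf p\in\overline{\mathfrak B_+^o},\ \mathbf Q\in\overline{\mathfrak B_+^m}$$ admits a unique solution $(\hat{\mathbf p},\hat{\mathbf Q})$, and it belongs to $\mathfrak B_+^o\times\mathfrak B_+^m$.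
   Context: Let $m,n$ be positive integers and $V=\{1,\dots,m\}$. Let $\mathbb T=[0,2\pi)$ and write $\int_{\mathbb T}f$ for $\int_0^{2\pi}f(\theta)\,\frac{d\theta}{2\pi}$. $\mathfrak B_+^m$ is the set of matrix trigonometric polynomials $\mathbf Q(e^{i\theta})=Q_0+\frac12\sum_{k=1}^n\big(Q_ke^{-i\theta k}+Q_k^Te^{i\theta k}\big)$ with $Q_0\in\mathbb R^{m\times m}$ symmetric, $Q_1,\dots,Q_n\in\mathbb R^{m\times m}$ arbitrary, and $\mathbf Q(e^{i\theta})$ positive definite for every $\theta\in\mathbb T$. $\overline{\mathfrak B_+^m}$ denotes the closure of $\mathfrak B_+^m$ (in the finite-dimensional coefficient space) from which the points $\mathbf Q$ with $\det\mathbf Q(e^{i\theta})=0$ for all $\theta\in\mathbb T$ are removed. $\mathfrak B_+^o$ is the set of scalar trigonometric polynomials $\mathbf p(e^{i\theta})=1+\frac12\sum_{k=1}^n p_k(e^{-i\theta k}+e^{i\theta k})$, $p_k\in\mathbb R$, with $\mathbf p(e^{i\theta})>0$ for all $\theta$; $\overline{\mathfrak B_+^o}$ is its closure. Set $p_0=1$. Data: real $m\times m$ matrices $R_0,\dots,R_n$ ($R_0$ symmetric) and real numbers $c_0,\dots,c_n$. Define (values in $\mathbb R\cup\{+\infty\}$) $$J(\mathbf p,\mathbf Q)=\int_{\mathbb T}\Big(\mathbf p\log\det(\mathbf p\mathbf Q^{-1})-m\mathbf p\Big)+\sum_{k=0}^n\mathrm{tr}(Q_k^TR_k)-\sum_{k=0}^np_kc_k,$$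 $g_\lambda(\mathbf p)=\lambda\int_{\mathbb T}\mathbf p^{-1}$. For $1\le h\le j\le m$ let $q_{jh}(\mathbf Q)=\max\{|[Q_0]_{jh}|,\max_{k=1,\dots,n}|[Q_k]_{jh}|,\max_{k=1,\dots,n}|[Q_k]_{hj}|\}$ and $h_W(\mathbf Q)=\sum_{j\ge h}\gamma_{jh}q_{jh}(\mathbf Q)$. *)

(* Defs.v *)
From HB Require Import structures.
From mathcomp Require Import all_boot all_order all_algebra.
From mathcomp Require Import all_classical all_reals.
From mathcomp Require Import ereal topology normedtype sequences exp trigo
  measure lebesgue_measure lebesgue_integral.
From mathcomp Require Import complex.

Set Implicit Arguments.
Unset Strict Implicit.
Unset Printing Implicit Defensive.

Import Order.TTheory GRing.Theory Num.Theory.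
Local Open Scope ring_scope.
Local Open Scope classical_set_scope.

Section Defs.
Variable R : realType.
Local Notation C := (R[i]).

Definition rC (x : R) : C := Complex x 0.
Definition expi (x : R) : C := Complex (cos x) (sin x).

Definition ctr p q (A : 'M[C]_(p, q)) : 'M[C]_(q, p) := map_mx (@conjc R) A^T.

Definition hermitian m (A : 'M[C]_m) : Prop := ctr A = A.

(* Hermitian positive semidefinite / positive definite complex matrices
   (the order on C is the numDomain order: 0 <= z iff z is real and >= 0) *)
Definition herm_psd m (A : 'M[C]_m) : Prop :=
  hermitian A /\ forall v : 'cV[C]_m, 0 <= (ctr v *m A *m v) 0 0.
Definition herm_pd m (A : 'M[C]_m) : Prop :=
  hermitian A /\ forall v : 'cV[C]_m, v != 0 -> 0 < (ctr v *m A *m v) 0 0.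

Definition Tset : set R := `[0, 2 * pi[%classic.

Definition Tint (f : R -> R) : \bar R :=
  (((2 * pi)^-1)%:E * \int[@lebesgue_measure R]_(x in Tset) (f x)%:E)%E.

Definition TRint (f : R -> R) : R :=
  (2 * pi)^-1 * Rintegral (@lebesgue_measure R) Tset f.

(* scalar: p : 'I_n -> R, with p i = p_{i+1}; p_0 = 1.
   p(e^{i theta}) = 1 + 1/2 sum_{k=1}^n p_k (e^{-i theta k} + e^{i theta k}),
   written via Re(e^{-ix} + e^{ix}) = cos(-x) + cos x (the value is real). *)
Definition ptrig n (p : 'I_n -> R) (theta : R) : R :=
  1 + 2^-1 * \sum_(i < n) p i *
        (cos (- ((i.+1)%:R * theta)) + cos ((i.+1)%:R * theta)).

Definition Qtrig m n (Q : 'I_n.+1 -> 'M[R]_m) (theta : R) : 'M[C]_m :=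
  map_mx rC (Q ord0) +
  (rC 2^-1) *: \sum_(k < n.+1 | k != ord0)
      (expi (- (k%:R * theta)) *: map_mx rC (Q k)
       + expi (k%:R * theta) *: map_mx rC (Q k)^T).

Definition Bo n (p : 'I_n -> R) : Prop :=
  forall theta, Tset theta -> 0 < ptrig p theta.
Definition Bo_bar n (p : 'I_n -> R) : Prop :=
  forall e : R, 0 < e -> exists p' : 'I_n -> R,
    Bo p' /\ forall i, `|p i - p' i| < e.

Definition Bm m n (Q : 'I_n.+1 -> 'M[R]_m) : Prop :=
  (Q ord0)^T = Q ord0 /\ forall theta, Tset theta -> herm_pd (Qtrig Q theta).
Definition Bm_clos m n (Q : 'I_n.+1 -> 'M[R]_m) : Prop :=
  forall e : R, 0 < e -> exists Q' : 'I_n.+1 -> 'M[R]_m,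
    Bm Q' /\ forall k i j, `|Q k i j - Q' k i j| < e.
Definition Bm_bar m n (Q : 'I_n.+1 -> 'M[R]_m) : Prop :=
  Bm_clos Q /\ ~ (forall theta, Tset theta -> \det (Qtrig Q theta) = 0).

(* J(p,Q) = \int (p log det(p Q^{-1}) - m p) + sum_k tr(Q_k^T R_k) - sum_k p_k c_k,
   with p_0 = 1. det(p Q^{-1}) is real (Hermitian matrix); we take its real part. *)
Definition Jfun m n (Rk : 'I_n.+1 -> 'M[R]_m) (c : 'I_n.+1 -> R)
    (p : 'I_n -> R) (Q : 'I_n.+1 -> 'M[R]_m) : \bar R :=
  (Tint (fun theta =>
      ptrig p theta *
        ln (complex.Re (\det (rC (ptrig p theta) *: invmx (Qtrig Q theta))))
      - m%:R * ptrig p theta)%R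
   + (\sum_(k < n.+1) \tr ((Q k)^T *m Rk k)
      - (c ord0 + \sum_(i < n) p i * c (lift ord0 i)))%:E)%E.

Definition glam n (lam : R) (p : 'I_n -> R) : \bar R :=
  (lam%:E * Tint (fun theta => (ptrig p theta)^-1)%R)%E.

Definition qjh m n (Q : 'I_n.+1 -> 'M[R]_m) (j h : 'I_m) : R :=
  Num.max `|Q ord0 j h|
    (\big[Num.max/0]_(k < n.+1 | k != ord0) Num.max `|Q k j h| `|Q k h j|).

Definition hW m n (gamma : 'I_m -> 'I_m -> R) (Q : 'I_n.+1 -> 'M[R]_m) : R :=
  \sum_(j < m) \sum_(h < m | (h <= j)%N) gamma j h * qjh Q j h.

Definition objective m n (N : nat) (alpha lam : R) (gamma : 'I_m -> 'I_m -> R)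
    (Rk : 'I_n.+1 -> 'M[R]_m) (c : 'I_n.+1 -> R)
    (p : 'I_n -> R) (Q : 'I_n.+1 -> 'M[R]_m) : \bar R :=
  (Jfun Rk c p Q + (2 * alpha / N%:R)%:E * (glam lam p + (hW gamma Q)%:E))%E.

Definition psd_density m (Phi : R -> 'M[C]_m) : Prop :=
  (forall i j, (@lebesgue_measure R).-integrable Tset
                 (fun theta => (complex.Re (Phi theta i j))%:E)
            /\ (@lebesgue_measure R).-integrable Tset
                 (fun theta => (complex.Im (Phi theta i j))%:E)) /\
  (forall theta, Tset theta -> herm_psd (Phi theta)).

Definition pd_on_open_interval m (Phi : R -> 'M[C]_m) : Prop :=
  exists a b : R, 0 <= a /\ a < b /\ b <= 2 * pi /\
    forall theta, a < theta < b -> herm_pd (Phi theta).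

Definition moments m n (Phi : R -> 'M[C]_m) (Rk : 'I_n.+1 -> 'M[R]_m) : Prop :=
  forall (k : 'I_n.+1) (i j : 'I_m),
    TRint (fun theta => complex.Re (Phi theta i j * expi (k%:R * theta))) = Rk k i j
 /\ TRint (fun theta => complex.Im (Phi theta i j * expi (k%:R * theta))) = 0.

End Defs.

(* Main.v *)
(** The integrand [p log det (p Q^-1) - m p] is jointly convex: applied to [Q1 / p1] and
    [Q2 / p2], the tangent inequality of [log det] bounds it below by a function linear in
    [(p1, Q1)], with equality only when [Q1 / p1 = Q2 / p2]; together with the strictly convex
    [1 / p] this yields uniqueness.  For existence, [sum_k tr (Q_k^T R_k)] is the integral of
    [tr (Q Phi)], hence coercive on the cone of positive semidefinite [Q], while the
    coefficients of [p >= 0] are bounded because [p_0 = 1].  A nonnegative trigonometric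
    polynomial which takes a value below [r^2] is [O(r^2)] on an interval of length [r].
    For [p] this makes the integral of [1 / p] at least of order [1 / r].  For [Q] it makes the
    gain in the integral of [p log det Q] when passing from [Q] to [Q + r^2 I] at least of order
    [r], whereas the other terms increase by only [O(r^2)].  So every competitive point lies in
    a compact set of uniformly interior points, or is strictly improved by such a point. *)

From HB Require Import structures.
From mathcomp Require Import all_boot all_order all_algebra.
From mathcomp Require Import all_classical all_reals.
From mathcomp Require Import ereal topology normedtype derive sequences exp trigo
  measure measurable_realfun numfun lebesgue_measure lebesgue_integral.
From mathcomp Require Import complex spectral.
From mathcomp Require Import zify ring lra.
Require Import Defs.

Import Order.TTheory GRing.Theory Num.Theory numFieldNormedType.Exports.
Local Open Scope ring_scope.

Set Implicit Arguments.
Unset Strict Implicit.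
Unset Printing Implicit Defensive.

(** * Hermitian matrices *)

(** The obstacle is the boundary: there [Q] may be singular at some angles, [p] may vanish, the
    objective may be [+oo], and its continuity is not at hand. The proof takes no limit towards such
    points. It works on the set [inK d s B], where [p >= d], [Q - s I] is positive semidefinite, [Q]
    is bounded and the objective is Lipschitz, and it disposes of every other point by comparing
    values. The value at [p = 1], [Q = I] fixes the bound [B] on [Q] and a bound on the integral of
    [1 / p]; the latter fixes [d]; then [d] and [B] fix [s = r^2]. The improved point [Q + s I]
    stays below the reference value, hence obeys the same bound [B], so that the compact set need
    not be enlarged. Singular angles are harmless because the zeros of a trigonometric polynomial in
    one period are finite in number unless it vanishes identically; the same dichotomy turns
    equality in the integrated inequality into equality of coefficients. *)

Section Hermitian.
Variable R : realType.
Local Notation C := R[i].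

(** Real parts keep all inequalities in [R]; for Hermitian [A] nothing is lost, by [qfE] for the
    form and [herm_det] for the determinant. *)
Definition qf m (A : 'M[C]_m) (v : 'cV[C]_m) : R :=
  complex.Re ((ctr v *m A *m v) 0 0).
Definition rtr m (A : 'M[C]_m) : R := complex.Re (\tr A).
Definition rdet m (A : 'M[C]_m) : R := complex.Re (\det A).

Lemma ReD (x y : C) : complex.Re (x + y) = complex.Re x + complex.Re y.
Proof. by case: x; case: y. Qed.

Lemma ReN (x : C) : complex.Re (- x) = - complex.Re x.
Proof. by case: x. Qed.

Lemma Re_sum I (s : seq I) (P : pred I) (F : I -> C) :
  complex.Re (\sum_(i <- s | P i) F i) = \sum_(i <- s | P i) complex.Re (F i).
Proof. exact: (big_morph _ ReD). Qed.

Lemma ReM_rC (r : R) (x : C) : complex.Re (rC r * x) = r * complex.Re x.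
Proof. by case: x => a b /=; rewrite mul0r subr0. Qed.

Lemma rC_sum I (s : seq I) (P : pred I) (F : I -> R) :
  rC (\sum_(i <- s | P i) F i) = \sum_(i <- s | P i) rC (F i).
Proof. exact: (rmorph_sum (real_complex R)). Qed.

Lemma rC_prod I (s : seq I) (P : pred I) (F : I -> R) :
  rC (\prod_(i <- s | P i) F i) = \prod_(i <- s | P i) rC (F i).
Proof. exact: (rmorph_prod (real_complex R)). Qed.

Lemma rCM (x y : R) : rC (x * y) = rC x * rC y.
Proof. exact: (rmorphM (real_complex R)). Qed.

Lemma rCD (x y : R) : rC (x + y) = rC x + rC y.
Proof. exact: (rmorphD (real_complex R)). Qed.

Lemma conjc_rC (x : R) : conjc (rC x) = rC x.
Proof. by rewrite /rC /= oppr0. Qed.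

Lemma conjc_fixE (z : C) : conjc z = z -> z = rC (complex.Re z).
Proof.
case: z => a b [] /eqP; rewrite eq_sym -subr_eq0 opprK -mulr2n mulrn_eq0 /=.
by move=> /eqP ->.
Qed.

Lemma ctrK p q (A : 'M[C]_(p, q)) : ctr (ctr A) = A.
Proof. by apply/matrixP => i j; rewrite !mxE conjcK. Qed.

Lemma ctrM p q r (A : 'M[C]_(p, q)) (B : 'M[C]_(q, r)) :
  ctr (A *m B) = ctr B *m ctr A.
Proof. by rewrite /ctr trmx_mul map_mxM. Qed.

Lemma ctrD p q (A B : 'M[C]_(p, q)) : ctr (A + B) = ctr A + ctr B.
Proof. by rewrite /ctr linearD map_mxD. Qed.

Lemma ctrN p q (A : 'M[C]_(p, q)) : ctr (- A) = - ctr A.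
Proof. by rewrite /ctr linearN map_mxN. Qed.

Lemma ctrZ p q (a : C) (A : 'M[C]_(p, q)) : ctr (a *: A) = conjc a *: ctr A.
Proof. by rewrite /ctr linearZ map_mxZ. Qed.

Lemma ctr_scalar m (a : R) : ctr ((rC a)%:M : 'M[C]_m) = (rC a)%:M.
Proof. by rewrite /ctr tr_scalar_mx map_scalar_mx; congr (_%:M); exact: conjc_rC. Qed.

Lemma ctr1 m : ctr (1%:M : 'M[C]_m) = 1%:M.
Proof. exact: ctr_scalar. Qed.

Lemma det_ctr m (A : 'M[C]_m) : \det (ctr A) = conjc (\det A).
Proof. by rewrite /ctr det_map_mx det_tr. Qed.

Lemma herm_det m (A : 'M[C]_m) : hermitian A -> \det A = rC (rdet A).
Proof. by move=> hA; apply: conjc_fixE; rewrite -det_ctr hA. Qed.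

Lemma qfE m (A : 'M[C]_m) (v : 'cV[C]_m) :
  hermitian A -> (ctr v *m A *m v) 0 0 = rC (qf A v).
Proof.
move=> hA; apply: conjc_fixE.
have: ctr (ctr v *m A *m v) = ctr v *m A *m v by rewrite !ctrM ctrK hA mulmxA.
by move=> {2}<-; rewrite !mxE.
Qed.

Lemma rC_ge0 (x : R) : (0 <= rC x) = (0 <= x).
Proof. exact: (ler0c x). Qed.

Lemma rC_gt0 (x : R) : (0 < rC x) = (0 < x).
Proof. exact: (ltcR 0 x). Qed.

Lemma psdP m (A : 'M[C]_m) :
  herm_psd A <-> hermitian A /\ forall v, 0 <= qf A v.
Proof.
by split=> -[hA h]; split=> // v; move: (h v); rewrite qfE // rC_ge0.
Qed.

Lemma pdP m (A : 'M[C]_m) :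
  herm_pd A <-> hermitian A /\ forall v, v != 0 -> 0 < qf A v.
Proof.
by split=> -[hA h]; split=> // v v0; move: (h v v0); rewrite qfE // rC_gt0.
Qed.

Lemma pd_psd m (A : 'M[C]_m) : herm_pd A -> herm_psd A.
Proof.
move=> [hA h]; split=> // v; have [->|/h/ltW//] := eqVneq v 0.
by rewrite mulmx0 mxE.
Qed.

Lemma qfD m (A B : 'M[C]_m) v : qf (A + B) v = qf A v + qf B v.
Proof. by rewrite /qf mulmxDr mulmxDl mxE ReD. Qed.

Lemma qfN m (A : 'M[C]_m) v : qf (- A) v = - qf A v.
Proof. by rewrite /qf mulmxN mulNmx mxE ReN. Qed.

Lemma qfZ m (r : R) (A : 'M[C]_m) v : qf (rC r *: A) v = r * qf A v.
Proof. by rewrite /qf -scalemxAr -scalemxAl mxE ReM_rC. Qed.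

Lemma qf_congr m p (A : 'M[C]_m) (W : 'M[C]_(m, p)) (v : 'cV[C]_p) :
  complex.Re ((ctr v *m (ctr W *m A *m W) *m v) 0 0) = qf A (W *m v).
Proof. by rewrite /qf ctrM !mulmxA. Qed.

Definition vnorm2 m (v : 'cV[C]_m) : R := qf 1%:M v.

Lemma vnorm2E m (v : 'cV[C]_m) :
  vnorm2 v = \sum_i (complex.Re (v i 0) ^+ 2 + complex.Im (v i 0) ^+ 2).
Proof.
rewrite /vnorm2 /qf mulmx1 mxE Re_sum; apply: eq_bigr => i _.
by rewrite !mxE; case: (v i 0) => a b /=; rewrite mulNr opprK -!expr2.
Qed.

Lemma vnorm2_gt0 m (v : 'cV[C]_m) : v != 0 -> 0 < vnorm2 v.
Proof.
move=> v0; rewrite vnorm2E lt_def; apply/andP; split.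
  apply: contra v0; rewrite psumr_eq0; last by move=> i _; rewrite addr_ge0 ?sqr_ge0.
  move=> /allP h; apply/eqP/colP => i; rewrite mxE.
  move: (h i (mem_index_enum i)) => /=; rewrite paddr_eq0 ?sqr_ge0 // !sqrf_eq0.
  by case: (v i 0) => a b /= /andP[/eqP-> /eqP->].
by apply: sumr_ge0 => i _; rewrite addr_ge0 ?sqr_ge0.
Qed.

Lemma vnorm2_ge0 m (v : 'cV[C]_m) : 0 <= vnorm2 v.
Proof. by rewrite vnorm2E; apply: sumr_ge0 => i _; rewrite addr_ge0 ?sqr_ge0. Qed.

Lemma qf_scalar m (r : R) (v : 'cV[C]_m) : qf (rC r)%:M v = r * vnorm2 v.
Proof. by rewrite -scalemx1 qfZ. Qed.

Lemma pd_scalar m (r : R) : 0 < r -> herm_pd ((rC r)%:M : 'M[C]_m).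
Proof.
move=> r0; apply/pdP; split; first exact: ctr_scalar.
by move=> v v0; rewrite qf_scalar mulr_gt0 // vnorm2_gt0.
Qed.

(** The eigenvalues are written as values of the form at the conjugated rows of [U], so that a sign
    condition on the form is at once one on the eigenvalues. *)
Lemma herm_spectral m (A : 'M[C]_m) : hermitian A ->
  exists U : 'M[C]_m, [/\ U *m ctr U = 1%:M, ctr U *m U = 1%:M &
    A = ctr U *m diag_mx (\row_i rC (qf A (ctr (row i U)))) *m U].
Proof.
move=> hA.
have hs : A \is hermsymmx by apply/is_hermitianmxP; rewrite expr0 scale1r -[LHS]hA.
have /orthomx_spectralP := hermitian_normalmx hs.
have := spectral_unitarymx A; move: (spectralmx A) (spectral_diag A) => U d.
move=> Uu; rewrite (invmx_unitary Uu) -[(_ ^t*)%sesqui]/(ctr U) => EA.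
have U1 : U *m ctr U = 1%:M by apply/eqP; move: Uu; rewrite qualifE.
have U2 : ctr U *m U = 1%:M by apply: mulmx1C.
exists U; split; [exact: U1|exact: U2|]; rewrite [LHS]EA; congr (_ *m diag_mx _ *m _).
apply/rowP => i; rewrite !mxE -qfE // ctrK.
have -> : (row i U *m A *m ctr (row i U)) 0 0 = (U *m A *m ctr U) i i.
  have -> : ctr (row i U) = col i (ctr U) by apply/colP => j; rewrite !mxE.
  by rewrite colE mulmxA -!row_mul -colE !mxE.
rewrite [A in U *m A]EA !mulmxA U1 mul1mx -mulmxA U1 mulmx1.
by rewrite mxE eqxx mulr1n.
Qed.

Lemma unitary_row_norm m (U : 'M[C]_m) i : U *m ctr U = 1%:M ->
  vnorm2 (ctr (row i U)) = 1.
Proof.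
move=> U1; rewrite /vnorm2 /qf mulmx1 ctrK.
have -> : (row i U *m ctr (row i U)) 0 0 = (U *m ctr U) i i.
  by rewrite !mxE; apply: eq_bigr => j _; rewrite !mxE.
by rewrite U1 mxE eqxx.
Qed.

Lemma unitary_row_neq0 m (U : 'M[C]_m) i : U *m ctr U = 1%:M -> ctr (row i U) != 0.
Proof.
move=> /(unitary_row_norm i) h; apply/eqP => h0; move: h.
rewrite h0 /vnorm2 /qf mulmx0 mxE /= => /eqP; by rewrite eq_sym oner_eq0.
Qed.

Lemma psd_gram m (A : 'M[C]_m) : herm_psd A -> exists Y : 'M[C]_m, A = ctr Y *m Y.
Proof.
move=> /psdP[hA pA]; have [U [U1 U2 EA]] := herm_spectral hA.
set d := fun i => qf A (ctr (row i U)).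
exists (diag_mx (\row_i rC (Num.sqrt (d i))) *m U).
rewrite {1}EA ctrM -!mulmxA; congr (_ *m _); rewrite !mulmxA; congr (_ *m _).
have -> : ctr (diag_mx (\row_i rC (Num.sqrt (d i)))) =
    diag_mx (\row_i rC (Num.sqrt (d i))).
  apply/matrixP => i j; rewrite !mxE eq_sym.
  case: (eqVneq i j) => [->|_]; first by rewrite !mulr1n; exact: conjc_rC.
  by rewrite !mulr0n; exact: conjc0.
rewrite mulmx_diag; congr diag_mx; apply/rowP => i; rewrite !mxE -rCM.
by rewrite -expr2 sqr_sqrtr // pA.
Qed.

Lemma pd_gram m (A : 'M[C]_m) : herm_pd A ->
  exists2 Y : 'M[C]_m, Y \in unitmx & A = ctr Y *m Y.
Proof.
move=> pA; have [Y EY] := psd_gram (pd_psd pA); exists Y => //.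
rewrite -unitmx_tr -row_free_unit -kermx_eq0; apply/negP => /negP kY.
have /rowV0Pn[w /sub_kermxP wY w0] := kY.
have /(proj2 (proj1 (pdP A) pA)) : w^T != 0.
  by apply: contra w0 => /eqP h; rewrite -[w]trmxK h trmx0.
rewrite /qf EY -!mulmxA; have -> : Y *m w^T = 0.
  by apply: trmx_inj; rewrite trmx_mul trmxK trmx0.
by rewrite !mulmx0 mxE ltxx.
Qed.

Lemma gram_det m (Y : 'M[C]_m) :
  rdet (ctr Y *m Y) = complex.Re (\det Y) ^+ 2 + complex.Im (\det Y) ^+ 2.
Proof.
rewrite /rdet det_mulmx det_ctr; case: (\det Y) => a b /=.
by rewrite mulNr opprK -!expr2.
Qed.

Lemma psd_rdet_ge0 m (A : 'M[C]_m) : herm_psd A -> 0 <= rdet A.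
Proof. by move=> /psd_gram[Y ->]; rewrite gram_det addr_ge0 // sqr_ge0. Qed.

Lemma pd_rdet_gt0 m (A : 'M[C]_m) : herm_pd A -> 0 < rdet A.
Proof.
move=> pA; have [Y uY EA] := pd_gram pA; rewrite lt_def psd_rdet_ge0 ?andbT; last exact: pd_psd.
rewrite EA gram_det; apply/eqP => /eqP; rewrite paddr_eq0 ?sqr_ge0 // !sqrf_eq0.
move: uY; rewrite unitmxE unitfE; case: (\det Y) => a b /= h /andP[/eqP a0 /eqP b0].
by move/eqP: h; rewrite a0 b0.
Qed.

Lemma pd_unit m (A : 'M[C]_m) : herm_pd A -> A \in unitmx.
Proof.
move=> pA; rewrite unitmxE unitfE; apply/eqP => h.
by move: (pd_rdet_gt0 pA); rewrite /rdet h ltxx.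
Qed.

(** A Gram factorization [A = Y^* Y] gives [qf A v = |Y v|^2], and [Y] is invertible when [det A] is
    nonzero. This makes a boundary polynomial positive definite away from the zeros of its
    determinant. *)
Lemma psd_det_pd m (A : 'M[C]_m) : herm_psd A -> \det A != 0 -> herm_pd A.
Proof.
move=> pA d0; have [Y EA] := psd_gram pA.
apply/pdP; split; first by have [] := pA.
move=> v v0.
have -> : qf A v = vnorm2 (Y *m v).
  by rewrite EA /vnorm2 -qf_congr mulmx1.
apply: vnorm2_gt0; apply: contra d0 => /eqP Yv0.
have uY : Y \notin unitmx.
  apply/negP => uY; move/eqP: v0; apply.
  by rewrite -[v]mul1mx -(mulVmx uY) -mulmxA Yv0 mulmx0.
by move: uY; rewrite unitmxE unitfE negbK EA det_mulmx => /eqP ->; rewrite mulr0.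
Qed.

Lemma rtr_congr m p (A : 'M[C]_m) (W : 'M[C]_(m, p)) :
  rtr (ctr W *m A *m W) = \sum_i qf A (col i W).
Proof.
rewrite /rtr /mxtrace Re_sum; apply: eq_bigr => i _; rewrite /qf; congr complex.Re.
have -> : ctr (col i W) = row i (ctr W) by apply/rowP => j; rewrite !mxE.
by rewrite colE mulmxA -!row_mul -colE !mxE.
Qed.

Lemma rtr_mulC m p (A : 'M[C]_(m, p)) (B : 'M[C]_(p, m)) : rtr (A *m B) = rtr (B *m A).
Proof. by rewrite /rtr mxtrace_mulC. Qed.

(** With [A = Y^* Y] the trace is that of [Y B Y^*], a sum of values of the form of [B]. *)
Lemma rtr_psd_mul_ge0 m (A B : 'M[C]_m) :
  herm_psd A -> herm_psd B -> 0 <= rtr (A *m B).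
Proof.
move=> /psd_gram[Y ->] /psdP[_ pB].
rewrite -mulmxA rtr_mulC -{1}[Y]ctrK rtr_congr.
exact: sumr_ge0.
Qed.

(** In the same sum every term vanishes, so each column of [Y^*] is a zero of a definite form. *)
Lemma rtr_psd_mul_eq0 m (A B : 'M[C]_m) :
  herm_psd A -> herm_pd B -> rtr (A *m B) = 0 -> A = 0.
Proof.
move=> /psd_gram[Y ->] pB.
rewrite -mulmxA rtr_mulC -{1}[Y]ctrK rtr_congr => /eqP.
have /psdP[_ qB] := pd_psd pB; have /pdP[_ qB'] := pB.
rewrite psumr_eq0 // => /allP h.
suff -> : Y = 0 by rewrite mulmx0.
suff E : ctr Y = 0 by rewrite -[Y]ctrK E /ctr trmx0 map_mx0.
apply/matrixP => i j; move: (h j (mem_index_enum j)) => /= hj.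
have [c0|/qB'] := eqVneq (col j (ctr Y)) 0; last by rewrite (eqP hj) ltxx.
by move/colP: c0 => /(_ i); rewrite !mxE.
Qed.

End Hermitian.

(** * The log-determinant *)

Section LogDet.
Variable R : realType.
Local Notation C := R[i].

Lemma ln_le_subr1 (x : R) : 0 < x -> ln x <= x - 1.
Proof. by move=> x0; rewrite -{1}[x](subrKC 1); apply: le_ln1Dx; lra. Qed.

(** Applying [ln y <= y - 1] to [y = sqrt x] and doubling gives [x - 1 <= 2 (sqrt x - 1)], that is
    [(sqrt x - 1)^2 <= 0]. *)
Lemma ln_eq_subr1 (x : R) : 0 < x -> ln x = x - 1 -> x = 1.
Proof.
move=> x0 h; have s0 : 0 < Num.sqrt x by rewrite sqrtr_gt0.
have xs : Num.sqrt x ^+ 2 = x by rewrite sqr_sqrtr // ltW.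
have := ln_le_subr1 s0; have : ln x = ln (Num.sqrt x) *+ 2 by rewrite -lnXn // xs.
rewrite h mulr2n => h1 h2.
have hy : (Num.sqrt x - 1) ^+ 2 <= 0 by rewrite sqrrB1 xs; lra.
suff s1 : Num.sqrt x = 1 by rewrite -xs s1 expr1n.
by apply: subr0_eq; apply/eqP; rewrite -sqrf_eq0 eq_le hy sqr_ge0.
Qed.

Lemma ln_prod (I : finType) (F : I -> R) : (forall i, 0 < F i) ->
  ln (\prod_i F i) = \sum_i ln (F i).
Proof.
move=> F0; pose K (x y : R) := 0 < x /\ ln x = y.
suff [] : K (\prod_i F i) (\sum_i ln (F i)) by [].
apply: (big_rec2 K); first by split; rewrite ?ln1.
by move=> i x y _ [x0 <-]; split; [exact: mulr_gt0|rewrite lnM ?posrE].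
Qed.

(** The scalar inequality [ln d <= d - 1] summed over the eigenvalues; equality forces each
    eigenvalue to be [1]. *)
Lemma pd_ln_rdet m (M : 'M[C]_m) : herm_pd M ->
  ln (rdet M) <= rtr M - m%:R /\ (ln (rdet M) = rtr M - m%:R -> M = 1%:M).
Proof.
move=> /pdP[hM pM]; have [U [U1 U2 EM]] := herm_spectral hM.
pose d i := qf M (ctr (row i U)).
have d0 i : 0 < d i by apply: pM; exact: unitary_row_neq0.
have Ed : (\row_i rC (qf M (ctr (row i U)))) = \row_i rC (d i) by [].
rewrite Ed in EM; clearbody d; clear Ed.
have Edet : rdet M = \prod_i d i.
  rewrite /rdet EM !det_mulmx mulrAC -det_mulmx U2 det1 mul1r det_diag.
  rewrite (_ : \prod_i _ = rC (\prod_i d i)) //.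
  by rewrite rC_prod; apply: eq_bigr => i _; rewrite mxE.
have Etr : rtr M - m%:R = \sum_i (d i - 1).
  rewrite sumrB sumr_const card_ord; congr (_ - _).
  rewrite EM -mulmxA rtr_mulC -mulmxA U1 mulmx1 /rtr mxtrace_diag.
  rewrite (_ : \sum_i _ = rC (\sum_i d i)) //.
  by rewrite rC_sum; apply: eq_bigr => i _; rewrite mxE.
rewrite Edet ln_prod // Etr; split.
  by apply: ler_sum => i _; apply: ln_le_subr1.
move=> h; have {h} h : \sum_i (d i - 1 - ln (d i)) == 0.
  by rewrite sumrB h subrr.
rewrite psumr_eq0 in h; last by move=> i _; rewrite subr_ge0 ln_le_subr1.
have d1 i : d i = 1.
  apply: ln_eq_subr1 => //; move/allP: h => /(_ i (mem_index_enum i)) /= /eqP h.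
  by move/subr0_eq: h.
rewrite EM (_ : diag_mx _ = 1%:M) ?mulmx1 //.
apply/matrixP => i j; rewrite !mxE d1.
by case: (i == j).
Qed.

Lemma gram_inv m (Y : 'M[C]_m) : Y \in unitmx ->
  invmx (ctr Y *m Y) = invmx Y *m ctr (invmx Y).
Proof.
move=> uY; have e : (ctr Y *m Y) *m (invmx Y *m ctr (invmx Y)) = 1%:M.
  rewrite mulmxA -[ctr Y *m Y *m _]mulmxA mulmxV // mulmx1 -ctrM mulVmx //.
  exact: ctr1.
have u : ctr Y *m Y \in unitmx by case/mulmx1_unit: e.
by rewrite -[RHS]mul1mx -(mulVmx u) -mulmxA e mulmx1.
Qed.

Lemma pd_inv m (B : 'M[C]_m) : herm_pd B -> herm_pd (invmx B).
Proof.
move=> pB; have [Y uY EB] := pd_gram pB; rewrite EB gram_inv //.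
apply: psd_det_pd; last first.
  by rewrite -gram_inv // -unitfE -unitmxE unitmx_inv -EB; exact: pd_unit.
apply/psdP; split; first by rewrite /hermitian ctrM ctrK.
move=> v; rewrite -[invmx Y *m _]mulmx1 -mulmxA.
have -> : qf (invmx Y *m (ctr (invmx Y) *m 1%:M)) v = vnorm2 (ctr (invmx Y) *m v).
  by rewrite /vnorm2 -qf_congr ctrK !mulmx1.
exact: vnorm2_ge0.
Qed.

Lemma pd_congr m (A W : 'M[C]_m) : herm_pd A -> W \in unitmx -> herm_pd (ctr W *m A *m W).
Proof.
move=> /pdP[hA pA] uW; apply/pdP; split; first by rewrite /hermitian !ctrM ctrK hA mulmxA.
move=> v v0; rewrite /qf qf_congr; apply: pA; apply: contra v0 => /eqP h.
by rewrite -[v]mul1mx -(mulVmx uW) -mulmxA h mulmx0.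
Qed.

(* The substitution M = Y^-* A Y^-1 with B = Y^* Y reduces this to B = 1. *)
Lemma ln_rdet_tangent m (A B : 'M[C]_m) : herm_pd A -> herm_pd B ->
  ln (rdet A) <= ln (rdet B) + rtr (invmx B *m A) - m%:R /\
  (ln (rdet A) = ln (rdet B) + rtr (invmx B *m A) - m%:R -> A = B).
Proof.
move=> pA pB; have [Y uY EB] := pd_gram pB.
set W := invmx Y; have uW : W \in unitmx by rewrite unitmx_inv.
have pM := pd_congr pA uW.
have Etr : rtr (ctr W *m A *m W) = rtr (invmx B *m A).
  by rewrite EB gram_inv // -/W rtr_mulC [in RHS]rtr_mulC mulmxA rtr_mulC !mulmxA rtr_mulC !mulmxA.
have Edet : ln (rdet A) = ln (rdet B) + ln (rdet (ctr W *m A *m W)).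
  rewrite -lnM ?posrE ?pd_rdet_gt0 //; congr ln; apply: (@complexI R).
  rewrite [LHS](_ : _ = \det A); last by rewrite (herm_det (proj1 pA)).
  rewrite [RHS](_ : _ = \det B * \det (ctr W *m A *m W)); last first.
    by rewrite (herm_det (proj1 pB)) (herm_det (proj1 pM)) -rCM.
  have e1 : \det (ctr Y) * \det (ctr W) = 1.
    by rewrite mulrC -det_mulmx -ctrM mulmxV // ctr1 det1.
  have e2 : \det Y * \det W = 1 by rewrite -det_mulmx mulmxV // det1.
  rewrite EB !det_mulmx.
  rewrite (_ : _ * _ * _ = (\det (ctr Y) * \det (ctr W)) * (\det Y * \det W) * \det A).
    by rewrite e1 e2 !mul1r.
  by ring.
have [h1 h2] := pd_ln_rdet pM; rewrite Edet -Etr; split; first by lra.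
move=> h; have hM : ctr W *m A *m W = 1%:M by apply: h2; lra.
rewrite EB -[in RHS](mulmx1 (ctr Y)) -hM !mulmxA -ctrM mulVmx // ctr1 mul1mx.
by rewrite -mulmxA mulVmx // mulmx1.
Qed.

Lemma rtrD m (A B : 'M[C]_m) : rtr (A + B) = rtr A + rtr B.
Proof. by rewrite /rtr mxtraceD ReD. Qed.

Lemma rtrN m (A : 'M[C]_m) : rtr (- A) = - rtr A.
Proof. by rewrite /rtr raddfN ReN. Qed.

Lemma rtrZ m (r : R) (A : 'M[C]_m) : rtr (rC r *: A) = r * rtr A.
Proof. by rewrite /rtr mxtraceZ ReM_rC. Qed.

Lemma rtr_scalar m (r : R) : rtr ((rC r)%:M : 'M[C]_m) = m%:R * r.
Proof.
rewrite /rtr /mxtrace Re_sum (eq_bigr (fun=> r)) => [|i _]; last by rewrite mxE eqxx.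
by rewrite sumr_const card_ord mulr_natl.
Qed.

Lemma rtr_inv_mul m (B : 'M[C]_m) : herm_pd B -> rtr (invmx B *m B) = m%:R.
Proof. by move=> pB; rewrite mulVmx ?pd_unit // -[1%:M]/((rC 1)%:M) rtr_scalar mulr1. Qed.

Lemma rtr_inv_psd_ge0 m (B D : 'M[C]_m) : herm_pd B -> herm_psd D ->
  0 <= rtr (invmx B *m D).
Proof. by move=> pB pD; apply: rtr_psd_mul_ge0 => //; apply/pd_psd/pd_inv. Qed.

Lemma ln_rdet_mono m (A B : 'M[C]_m) : herm_pd A -> herm_pd B -> herm_psd (B - A) ->
  ln (rdet A) <= ln (rdet B).
Proof.
move=> pA pB pBA; have [h _] := ln_rdet_tangent pA pB.
have := rtr_inv_psd_ge0 pB pBA; rewrite mulmxBr rtrD rtrN rtr_inv_mul //; lra.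
Qed.

Lemma pd_addr m (A B : 'M[C]_m) : herm_psd A -> herm_pd B -> herm_pd (A + B).
Proof.
move=> /psdP[hA pA] /pdP[hB pB]; apply/pdP; split; first by rewrite /hermitian ctrD hA hB.
by move=> v v0; rewrite qfD ltr_wpDl // pB.
Qed.

(* Trace of (I - t B v v^* )^* B^-1 (I - t B v v^* ) >= 0 at t = 1 / (v^* B v). *)
Lemma rtr_inv_ge m (B : 'M[C]_m) (v : 'cV[C]_m) : herm_pd B -> vnorm2 v = 1 ->
  (qf B v)^-1 <= rtr (invmx B).
Proof.
move=> pB v1; have [hB pB'] := proj1 (pdP B) pB.
have v0 : v != 0.
  by apply/eqP => h; move: v1; rewrite h /vnorm2 /qf mulmx0 mxE => /eqP; rewrite eq_sym oner_eq0.
have q0 := pB' v v0; set q := qf B v in q0 *; set t := q^-1.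
pose Z := 1%:M - rC t *: (B *m v *m ctr v).
have := rtr_congr (invmx B) Z.
have : 0 <= \sum_i qf (invmx B) (col i Z).
  by apply: sumr_ge0 => i _; case/psdP: (pd_psd (pd_inv pB)).
move=> + E; rewrite -E {E}.
have -> : ctr Z = 1%:M - rC t *: (v *m ctr v *m B).
  by rewrite /Z ctrD ctr1 ctrN ctrZ conjc_rC !ctrM ctrK hB mulmxA.
rewrite /Z mulmxBl mul1mx -scalemxAl mulmxK ?pd_unit // mulmxBr mulmx1.
rewrite mulmxBl -scalemxAr !mulmxA mulVmx ?pd_unit // mul1mx -scalemxAl -scalemxAr.
have -> : v *m ctr v *m (B *m v *m ctr v) = rC q *: (v *m ctr v).
  rewrite !mulmxA -[v *m ctr v *m B]mulmxA -[v *m _ *m v]mulmxA.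
  rewrite (_ : ctr v *m B *m v = (rC q)%:M) ?mul_mx_scalar -?scalemxAl //.
  by rewrite [LHS]mx11_scalar qfE.
have Ev : rtr (v *m ctr v) = 1 by rewrite rtr_mulC -v1 /vnorm2 /qf mulmx1 /rtr trace_mx11.
rewrite !rtrD !rtrN !rtrD rtrN !rtrZ Ev !mulr1. have tq : t * q = 1 by rewrite mulVf ?gt_eqF. rewrite tq; lra.
Qed.

(** The tangent at [B = Q + s I] bounds the gain below by [s tr B^-1], since
    [tr (B^-1 Q) = m - s tr B^-1]; then [rtr_inv_ge] applies with [qf B v = qf Q v + s]. *)
Lemma ln_rdet_gain m (Q : 'M[C]_m) (s : R) (v : 'cV[C]_m) :
  herm_pd Q -> 0 < s -> vnorm2 v = 1 ->
  s / (qf Q v + s) <= ln (rdet (Q + (rC s)%:M)) - ln (rdet Q).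
Proof.
move=> pQ s0 v1; have pB : herm_pd (Q + (rC s)%:M).
  by apply: pd_addr; [exact: pd_psd|exact: pd_scalar].
have [h _] := ln_rdet_tangent pQ pB.
have e := rtr_inv_mul pB; rewrite mulmxDr rtrD mul_mx_scalar rtrZ in e.
have := rtr_inv_ge pB v1; rewrite qfD qf_scalar v1 mulr1 => h3.
have : s * (qf Q v + s)^-1 <= s * rtr (invmx (Q + (rC s)%:M)) by rewrite ler_pM2l.
lra.
Qed.

End LogDet.

(** * The pointwise integrand: joint convexity and Lipschitz bounds *)

Section Integrand.
Variable R : realType.
Local Notation C := R[i].

Definition Fint m (p : R) (Q : 'M[C]_m) : R :=
  p * ln (complex.Re (\det (rC p *: invmx Q))) - m%:R * p.

Lemma rCX (x : R) k : rC x ^+ k = rC (x ^+ k).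
Proof. by rewrite (_ : rC x = real_complex R x) // -rmorphXn. Qed.

Lemma rCV (x : R) : (rC x)^-1 = rC x^-1.
Proof. by rewrite (_ : rC x = real_complex R x) // -fmorphV. Qed.

(** The case [p = 0] is covered because the factor [p] cancels the logarithm, whatever its
    conventional value. *)
Lemma FintE m (p : R) (Q : 'M[C]_m) : 0 <= p -> herm_pd Q ->
  Fint p Q = p * (m%:R * ln p - ln (rdet Q)) - m%:R * p.
Proof.
move=> p0 pQ; congr (_ - _); move: p0; rewrite le_eqVlt => /orP[/eqP<-|p0].
  by rewrite !mul0r.
congr (_ * _); rewrite detZ det_inv (herm_det (proj1 pQ)) rCX rCV -rCM /=.
have d0 := pd_rdet_gt0 pQ.
by rewrite lnM ?posrE ?exprn_gt0 ?invr_gt0 // lnV ?posrE // lnXn // mulr_natl.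
Qed.

Lemma rdetZ m (r : R) (Q : 'M[C]_m) : rdet (rC r *: Q) = r ^+ m * rdet Q.
Proof. by rewrite /rdet detZ rCX ReM_rC. Qed.

Lemma pdZ m (r : R) (Q : 'M[C]_m) : 0 < r -> herm_pd Q -> herm_pd (rC r *: Q).
Proof.
move=> r0 /pdP[hQ pQ]; apply/pdP; split; first by rewrite /hermitian ctrZ conjc_rC hQ.
by move=> v v0; rewrite qfZ mulr_gt0 // pQ.
Qed.

Lemma lnXnR (x : R) k : 0 < x -> ln (x ^+ k) = k%:R * ln x.
Proof. by move=> x0; rewrite lnXn // mulr_natl. Qed.

(** Tangent plane of [Fint] at [(p2, Q2)]. It has no constant term because [Fint] is positively
    homogeneous of degree one; the gradient is [m ln p2 - ln det Q2] in [p] and [- p2 Q2^-1] in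
    [Q]. *)
Definition Ftan m (p2 : R) (Q2 : 'M[C]_m) (p1 : R) (Q1 : 'M[C]_m) : R :=
  p1 * (m%:R * ln p2 - ln (rdet Q2)) - p2 * rtr (invmx Q2 *m Q1).

Lemma Ftan_refl m (p : R) (Q : 'M[C]_m) : 0 <= p -> herm_pd Q ->
  Ftan p Q p Q = Fint p Q.
Proof. by move=> p0 pQ; rewrite FintE // /Ftan rtr_inv_mul // [p * m%:R]mulrC. Qed.

(* The log-det tangent inequality applied to Q1 / p1 and Q2 / p2. *)
Lemma Fint_tangent m (p1 p2 : R) (Q1 Q2 : 'M[C]_m) :
  0 < p1 -> 0 < p2 -> herm_pd Q1 -> herm_pd Q2 ->
  Ftan p2 Q2 p1 Q1 <= Fint p1 Q1 /\
  (Ftan p2 Q2 p1 Q1 = Fint p1 Q1 -> rC p2 *: Q1 = rC p1 *: Q2).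
Proof.
move=> p10 p20 pQ1 pQ2.
have i1 : 0 < p1^-1 by rewrite invr_gt0. have i2 : 0 < p2^-1 by rewrite invr_gt0.
have [] := ln_rdet_tangent (pdZ i1 pQ1) (pdZ i2 pQ2).
rewrite !rdetZ !lnM ?posrE ?exprn_gt0 ?pd_rdet_gt0 // !lnXnR // !lnV ?posrE //.
have u2 : rC p2^-1 \is a GRing.unit.
  by rewrite unitfE -rCV invr_eq0; apply/eqP => -[] h; rewrite h ltxx in p20.
have u2' : rC p2^-1 *: Q2 \in unitmx by apply: pd_unit; exact: pdZ.
rewrite invmxZ // -rCV invrK -scalemxAl -scalemxAr rtrZ rCV rtrZ.
rewrite /Ftan (FintE (ltW p10) pQ1).
move: (rtr _) (ln p1) (ln p2) (ln (rdet Q1)) (ln (rdet Q2)) => t l1 l2 d1 d2 h1 h2.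
have pp : p1 * (p2 * (p1^-1 * t)) = p2 * t by field; rewrite gt_eqF.
split.
  rewrite -(ler_pM2l p10) !(mulrBr, mulrDr, mulrN) in h1; rewrite pp in h1; lra.
move=> h; have e : m%:R * - l1 + d1 = m%:R * - l2 + d2 + p2 * (p1^-1 * t) - m%:R.
  apply: (mulfI (lt0r_neq0 p10)); rewrite !(mulrBr, mulrDr) pp; lra.
have := h2 e; move=> /(congr1 (fun M => rC (p1 * p2) *: M)).
rewrite !scalerA -!rCM; congr (_ *: _ = _ *: _); congr rC; field; by rewrite gt_eqF.
Qed.

(** By homogeneity [Fint] is linear along rays, hence not strictly convex. Merging [mu / p] into the
    integrand lets one pointwise equality case settle uniqueness. *)
Definition Hint m (mu p : R) (Q : 'M[C]_m) : R := Fint p Q + mu * p^-1.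

Lemma inv_midpoint (p1 p2 : R) : 0 < p1 -> 0 < p2 ->
  2 * ((p1 + p2) / 2)^-1 <= p1^-1 + p2^-1 /\
  (2 * ((p1 + p2) / 2)^-1 = p1^-1 + p2^-1 -> p1 = p2).
Proof.
move=> h1 h2.
have e : p1^-1 + p2^-1 - 2 * ((p1 + p2) / 2)^-1 = (p1 - p2) ^+ 2 / (p1 * p2 * (p1 + p2)).
  by field; rewrite !gt_eqF // addr_gt0.
have d0 : 0 < p1 * p2 * (p1 + p2) by rewrite !mulr_gt0 ?addr_gt0.
split.
  by rewrite -subr_ge0 e divr_ge0 ?sqr_ge0 // ltW.
move/esym/eqP; rewrite -subr_eq0 e mulf_eq0 invr_eq0 (gt_eqF d0) orbF sqrf_eq0 subr_eq0.
by move/eqP.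
Qed.

(** The two tangent values at the midpoint add up to twice the value there. In the equality case the
    terms [1 / p] give [p1 = p2], and proportionality of each matrix to the midpoint one then gives
    [Q1 = Q2]. *)
Lemma Hint_midpoint m (mu p1 p2 : R) (Q1 Q2 : 'M[C]_m) : 0 < mu ->
  0 < p1 -> 0 < p2 -> herm_pd Q1 -> herm_pd Q2 ->
  let p := (p1 + p2) / 2 in let Q := rC 2^-1 *: (Q1 + Q2) in
  2 * Hint mu p Q <= Hint mu p1 Q1 + Hint mu p2 Q2 /\
  (2 * Hint mu p Q = Hint mu p1 Q1 + Hint mu p2 Q2 -> p1 = p2 /\ Q1 = Q2).
Proof.
move=> mu0 p10 p20 pQ1 pQ2 p Q.
have p0 : 0 < p by rewrite /p divr_gt0 ?addr_gt0.
have pQ : herm_pd Q by apply: pdZ; [lra|apply: pd_addr => //; exact: pd_psd].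
have [a1 b1] := Fint_tangent p10 p0 pQ1 pQ.
have [a2 b2] := Fint_tangent p20 p0 pQ2 pQ.
have e : Ftan p Q p1 Q1 + Ftan p Q p2 Q2 = 2 * Fint p Q.
  have eQ : rtr (invmx Q *m Q1) + rtr (invmx Q *m Q2) = 2 * m%:R.
    rewrite -rtrD -mulmxDr (_ : Q1 + Q2 = rC 2 *: Q) ?{2}/Q.
      by rewrite -scalemxAr rtrZ rtr_inv_mul.
    by rewrite scalerA -rCM mulfV // scale1r.
  rewrite FintE ?(ltW p0) // /Ftan.
  have ep : p1 + p2 = 2 * p by rewrite /p mulrC divfK.
  rewrite addrACA -opprD -mulrDr eQ -mulrDl ep.
  by ring.
have [a3 b3] := inv_midpoint p10 p20; rewrite -/p in a3 b3.
rewrite /Hint.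
have a3' : mu * (2 * p^-1) <= mu * (p1^-1 + p2^-1) by rewrite ler_pM2l.
have [c1 c2] : 2 * (Fint p Q + mu * p^-1) <= Fint p1 Q1 + mu * p1^-1 + (Fint p2 Q2 + mu * p2^-1) /\
  (2 * (Fint p Q + mu * p^-1) = Fint p1 Q1 + mu * p1^-1 + (Fint p2 Q2 + mu * p2^-1) ->
   [/\ mu * (2 * p^-1) = mu * (p1^-1 + p2^-1), Ftan p Q p1 Q1 = Fint p1 Q1 &
      Ftan p Q p2 Q2 = Fint p2 Q2]).
  move: a1 a2 e a3'; clear; move: (Ftan _ _ _ _) (Ftan _ _ _ _) (Fint _ _) (Fint _ _) (Fint _ _).
  move: p^-1 p1^-1 p2^-1 => i i1 i2 f1 f2 f3 f4 f5 h1 h2 h3 h4.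
  by split; [lra|move=> h; split; lra].
split=> // /c2[h3 /b1 h1 /b2 h2]; have e1 : p1 = p2.
  by apply: b3; apply: (mulfI (lt0r_neq0 mu0)).
split=> //.
have n0 : rC p != 0 by apply/eqP => -[] z; rewrite z ltxx in p0.
by apply: (scalerI n0); rewrite h1 h2 e1.
Qed.

(** The tangent at [(p2, Q2)] bounds the difference through the gradient there: its [p]-part is at
    most [Cl], and its [Q]-part is controlled by [tr Q2^-1 <= m / s], a consequence of
    [Q2 >= s I]. *)
Lemma Hint_lip m (mu d b s Cl e ep p1 p2 : R) (Q1 Q2 : 'M[C]_m) : 0 < mu ->
  0 < d -> 0 < s -> 0 <= e -> d <= p1 -> d <= p2 -> p2 <= b -> herm_pd Q1 -> herm_pd Q2 ->
  herm_psd (Q2 - (rC s)%:M) -> herm_psd ((rC e)%:M - (Q1 - Q2)) ->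
  `|m%:R * ln p2 - ln (rdet Q2)| <= Cl -> `|p1 - p2| <= ep ->
  Hint mu p2 Q2 - Hint mu p1 Q1 <= ep * Cl + b * (e * (m%:R / s)) + mu * (ep / d ^+ 2).
Proof.
move=> mu0 d0 s0 e0 dp1 dp2 p2b pQ1 pQ2 ps pe hC hp.
have p10 : 0 < p1 by lra. have p20 : 0 < p2 by lra.
have [a1 _] := Fint_tangent p10 p20 pQ1 pQ2.
have a2 := Ftan_refl (ltW p20) pQ2.
have a3 : p2^-1 - p1^-1 <= ep / d ^+ 2.
  have -> : p2^-1 - p1^-1 = (p1 - p2) / (p1 * p2) by field; rewrite !gt_eqF.
  apply: le_trans (ler_norm _) _; rewrite normrM normfV (gtr0_norm (mulr_gt0 p10 p20)).
  apply: ler_pM => //; first by rewrite invr_ge0 mulr_ge0 // ltW.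
  rewrite lef_pV2 ?posrE ?mulr_gt0 ?exprn_gt0 // expr2 ler_pM // ltW //.
have a4 : rtr (invmx Q2) <= m%:R / s.
  have := rtr_inv_psd_ge0 pQ2 ps; rewrite mulmxBr rtrD rtrN rtr_inv_mul // mul_mx_scalar rtrZ.
  by move: (rtr _) => t; rewrite ler_pdivlMr // mulrC; lra.
have a5 : rtr (invmx Q2 *m (Q1 - Q2)) <= e * (m%:R / s).
  have := rtr_inv_psd_ge0 pQ2 pe; rewrite mulmxBr rtrD rtrN mul_mx_scalar rtrZ.
  have : e * rtr (invmx Q2) <= e * (m%:R / s) by rewrite ler_wpM2l.
  by move: (rtr (invmx Q2)) (rtr (invmx Q2 *m _)) (e * (m%:R / s)) => t1 t2 t3; lra.
have a6 : (p2 - p1) * (m%:R * ln p2 - ln (rdet Q2)) <= ep * Cl.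
  apply: le_trans (ler_norm _) _; rewrite normrM distrC; apply: ler_pM => //.
have a7 : p2 * rtr (invmx Q2 *m (Q1 - Q2)) <= b * (e * (m%:R / s)).
  have h : 0 <= e * (m%:R / s) by rewrite !mulr_ge0 ?invr_ge0 // ltW.
  apply: (@le_trans _ _ (p2 * (e * (m%:R / s)))); first by rewrite ler_pM2l.
  by rewrite ler_wpM2r.
have a8 : mu * (p2^-1 - p1^-1) <= mu * (ep / d ^+ 2) by rewrite ler_pM2l.
rewrite /Hint; move: a1 a2 a6 a7 a8; rewrite /Ftan mulmxBr rtrD rtrN.
move: (rtr (_ *m Q1)) (rtr (_ *m Q2)) (Fint p1 Q1) (Fint p2 Q2) => t1 t2 f1 f2.
move: (e * (m%:R / s)) (m%:R * ln p2 - ln (rdet Q2)) (ep / d ^+ 2) p1^-1 p2^-1.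
by move=> e' l q i1 i2; lra.
Qed.

End Integrand.

(** * Trigonometric polynomials *)

Section Trig.
Variable R : realType.
Local Notation C := R[i].
Local Notation normc := (@Normc.normc R).
Local Open Scope classical_set_scope.

Lemma expiD (x y : R) : expi (x + y) = expi x * expi y.
Proof. by rewrite /expi cosD sinD /GRing.mul /= addrC [cos x * sin y + _]addrC. Qed.

Lemma expi0 : expi (0 : R) = 1.
Proof. by rewrite /expi cos0 sin0. Qed.

Lemma expiN (x : R) : expi (- x) = conjc (expi x).
Proof. by rewrite /expi cosN sinN. Qed.

Lemma expi_mulVr (x : R) : expi x * expi (- x) = 1.
Proof. by rewrite -expiD subrr expi0. Qed.

Lemma expi_neq0 (x : R) : expi x != 0.
Proof.
apply/eqP => h; move: (expi_mulVr x); rewrite h mul0r => /esym/eqP.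
by rewrite oner_eq0.
Qed.

Lemma expi_natM (x : R) k : expi (k%:R * x) = expi x ^+ k.
Proof.
elim: k => [|k IH]; first by rewrite mul0r expi0 expr0.
by rewrite -natr1 mulrDl mul1r addrC expiD IH exprS.
Qed.

Lemma expi2pi (k : nat) : expi (k%:R * (2 * pi) : R) = 1.
Proof.
by rewrite expi_natM mulr_natl /expi cos2pi sin2pi expr1n.
Qed.

Lemma normc_expi (x : R) : normc (expi x) = 1.
Proof. by rewrite /= cos2Dsin2 sqrtr1. Qed.

Lemma normc_rC (x : R) : normc (rC x) = `|x|.
Proof. by rewrite /= expr0n addr0 sqrtr_sqr. Qed.

Lemma normc_sum I (s : seq I) (P : pred I) (F : I -> C) :
  normc (\sum_(i <- s | P i) F i) <= \sum_(i <- s | P i) normc (F i).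
Proof.
elim/big_rec2: _ => [|i y x _ h]; first by rewrite Normc.normc0.
by apply: le_trans (le_normcD _ _) _; rewrite lerD2l.
Qed.

Lemma le_Re_normc (z : C) : `|complex.Re z| <= normc z.
Proof.
case: z => a b /=; rewrite -sqrtr_sqr ler_sqrt ?addr_ge0 ?sqr_ge0 //.
by rewrite lerDl sqr_ge0.
Qed.

Lemma normc_ge0 (z : C) : 0 <= normc z.
Proof. by case: z => a b; exact: sqrtr_ge0. Qed.

Lemma expi_eq1 (x : R) : 0 <= x < 2 * pi -> expi x = 1 -> x = 0.
Proof.
move=> /andP[x0 x2] [] c1 _; apply/eqP; apply: contraT => xn.
have xh : 0 < x / 2 < pi by have := lt_def 0 x; rewrite xn x0 /= => h; lra.
have := sin_gt0_pi xh.
have : cos ((x / 2) *+ 2) = 1 by rewrite -mulr_natr divfK.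
rewrite cos_mulr2n cos2sin2 => h hs; nra.
Qed.

Lemma expi_inj (x y : R) : Tset x -> Tset y -> expi x = expi y -> x = y.
Proof.
rewrite /Tset /= !in_itv /= => /andP[x0 x1] /andP[y0 y1].
wlog xy : x y x0 x1 y0 y1 / y <= x.
  move=> W h; have [|/ltW] := leP y x; first by move=> l; exact: W.
  by move=> l; apply/esym/W.
move=> h; apply/subr0_eq/expi_eq1; first by lra.
by rewrite expiD h expi_mulVr.
Qed.

(* Laurent polynomials in e^{it}, the negative powers being cleared by e^{iNt}. *)
Definition tp (f : R -> C) : Prop :=
  exists (N : nat) (P : {poly C}), forall t, expi (N%:R * t) * f t = P.[expi t].

Lemma tp_cst (c : C) : tp (fun=> c).
Proof. by exists 0%N, c%:P => t; rewrite mul0r expi0 mul1r hornerC. Qed.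

Lemma tpM f g : tp f -> tp g -> tp (fun t => f t * g t).
Proof.
move=> [N [P hP]] [M [Q hQ]]; exists (N + M)%N, (P * Q) => t.
by rewrite hornerM -hP -hQ natrD mulrDl expiD mulrACA.
Qed.

Lemma tpD f g : tp f -> tp g -> tp (fun t => f t + g t).
Proof.
move=> [N [P hP]] [M [Q hQ]]; exists (N + M)%N, ('X^M * P + 'X^N * Q) => t.
rewrite hornerD !hornerM -hP -hQ !hornerXn natrD mulrDl expiD !expi_natM.
by ring.
Qed.

Lemma tp_sum I (s : seq I) (P : pred I) (F : I -> R -> C) :
  (forall i, tp (F i)) -> tp (fun t => \sum_(i <- s | P i) F i t).
Proof.
move=> h; elim: s => [|i s IH].
  by under eq_fun do rewrite big_nil; exact: tp_cst.
under eq_fun do rewrite big_cons; case: (P i) => //; exact: tpD.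
Qed.

Lemma tp_prod I (s : seq I) (P : pred I) (F : I -> R -> C) :
  (forall i, tp (F i)) -> tp (fun t => \prod_(i <- s | P i) F i t).
Proof.
move=> h; elim: s => [|i s IH].
  by under eq_fun do rewrite big_nil; exact: tp_cst.
under eq_fun do rewrite big_cons; case: (P i) => //; exact: tpM.
Qed.

Lemma tp_expi (k : nat) : tp (fun t => expi (k%:R * t)).
Proof. by exists 0%N, 'X^k => t; rewrite mul0r expi0 mul1r hornerXn expi_natM. Qed.

Lemma tp_expiN (k : nat) : tp (fun t => expi (- (k%:R * t))).
Proof. by exists k, 1 => t; rewrite expi_mulVr hornerC. Qed.

Lemma tp_det m (F : R -> 'M[C]_m) : (forall i j, tp (fun t => F t i j)) ->
  tp (fun t => \det (F t)).
Proof.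
move=> h; apply: tp_sum => s; apply: tpM; first exact: tp_cst.
by apply: tp_prod.
Qed.

(** The zeros in one period inject, through [expi], into the roots of the polynomial obtained by
    clearing negative powers. *)
Lemma tp_zeros f : tp f ->
  (forall t, f t = 0) \/ finite_set [set t | Tset t /\ f t = 0].
Proof.
move=> [N [P hP]]; have [P0|P0] := eqVneq P 0.
  left=> t; move: (hP t); rewrite P0 horner0 => /eqP.
  by rewrite mulf_eq0 (negPf (expi_neq0 _)) => /eqP.
right; set Z := [set t | _].
have [r Er] := closed_field_poly_normal P.
have fi : finite_set (@expi R @` Z).
  apply: (@sub_finite_set _ _ [set` r]); last exact: finite_seq.
  move=> _ [t [Tt ft] <-] /=; have : root P (expi t) by rewrite /root -hP ft mulr0.
  by rewrite Er rootZ ?lead_coef_eq0 // root_prod_XsubC.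
have inj : {in Z &, injective (@expi R)}.
  by move=> x y /set_mem[Tx _] /set_mem[Ty _]; exact: expi_inj.
(* [xget] picks the only preimage in [Z], with default [0] off the image; this pulls finiteness back
   along [expi]. *)
have := finite_image (fun z => xget 0 [set t | Z t /\ expi t = z]) fi.
apply: sub_finite_set => t Zt; exists (expi t); first by exists t.
have [] := @xgetI _ 0 [set u | Z u /\ expi u = expi t] t (conj Zt erefl).
by move=> Zu; apply: inj; apply/mem_set.
Qed.

Lemma sin_le_norm (x : R) : `|sin x| <= `|x|.
Proof.
wlog x0 : x / 0 < x.
  move=> W; have [/W//|xn|<-] := ltrgtP 0 x; last by rewrite sin0 normr0.
  by rewrite -normrN -sinN -[leRHS]normrN W // oppr_gt0.
have [|c _] := @MVT R sin cos 0 x x0 (fun z _ => is_derive_sin z).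
  by apply: continuous_subspaceT => z; exact: continuous_sin.
rewrite sin0 !subr0 => ->; rewrite normrM ler_piMl ?cos_max //.
Qed.

Lemma cos_quad (x : R) : 0 <= 1 - cos x <= x ^+ 2.
Proof.
rewrite subr_ge0 cos_le1 /=.
have -> : cos x = 1 - 2 * sin (x / 2) ^+ 2.
  by rewrite -{1}(divfK (_ : 2 != 0) x) // mulr_natr cos_mulr2n cos2sin2; ring.
have h : sin (x / 2) ^+ 2 <= (x / 2) ^+ 2.
  by rewrite -[leLHS]real_normK ?num_real // -[leRHS]real_normK ?num_real // lerXn2r ?nnegrE // sin_le_norm.
have e : (x / 2) ^+ 2 = x ^+ 2 / 4 by field.
have := sqr_ge0 x; rewrite e in h; lra.
Qed.

End Trig.

(** * Scalar trigonometric sums: discrete Fourier inversion and second differences *)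

Section ScalarTrig.
Variable R : realType.
Local Notation C := R[i].
Local Notation normc := (@Normc.normc R).
Variable n : nat.
Implicit Types a b : 'I_n.+1 -> R.

(** Common model of [ptrig] and of the entries of [Qtrig]. The coefficients of [e^{-ikt}] and
    [e^{ikt}] are kept apart because entry [(i, j)] pairs [Q k i j] with [Q k j i]. *)
Definition strig a b (t : R) : C := rC (a ord0) + rC 2^-1 *
  \sum_(k < n.+1 | k != ord0)
     (expi (- (k%:R * t)) * rC (a k) + expi (k%:R * t) * rC (b k)).

(** These [2n + 1] equispaced nodes separate the frequencies [-n, ..., n], so coefficients are
    recovered from finite sums instead of integrals. *)
Definition dft_pt (j : nat) : R := j%:R * (2 * pi / (2 * n).+1%:R).

Lemma dft_sum0 k : (0 < k < (2 * n).+1)%N ->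
  \sum_(j < (2 * n).+1) expi (k%:R * dft_pt j) = 0.
Proof.
move=> /andP[k0 kL]; set L := (2 * n).+1 in kL *.
have L0 : (0 : R) < L%:R by rewrite ltr0n.
have pi0 := @pi_gt0 R.
pose z : C := expi (k%:R * (2 * pi / L%:R)).
have zL : z ^+ L = 1.
  rewrite /z -expi_natM (_ : _ * _ = k%:R * (2 * pi)) ?expi2pi //.
  by field; rewrite gt_eqF.
have z1 : z != 1.
  apply/eqP => /expi_eq1 h.
  have : k%:R * (2 * pi / L%:R) = 0 :> R.
    apply: h; apply/andP; split; first by rewrite !mulr_ge0 ?invr_ge0 // ltW.
    rewrite mulrA ltr_pdivrMr // mulrC ltr_pM2l ?ltr_nat //; lra.
  move/eqP; rewrite !mulf_eq0 invr_eq0 (gt_eqF L0) (gt_eqF pi0) !pnatr_eq0 /= !orbF.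
  by move=> /eqP k00; rewrite k00 in k0.
rewrite (eq_bigr (fun j : 'I_L => z ^+ j)); last first.
  by move=> j _; rewrite /z -expi_natM /dft_pt mulrCA.
have := subrX1 z L; rewrite zL subrr => /esym/eqP.
by rewrite mulf_eq0 subr_eq0 (negPf z1) => /eqP.
Qed.

Lemma rC_nat k : rC k%:R = k%:R :> C.
Proof. exact: (rmorph_nat (real_complex R)). Qed.

Lemma conjcM (x y : C) : conjc (x * y) = conjc x * conjc y.
Proof. exact: (rmorphM (@conjc R)). Qed.

Lemma conjcD (x y : C) : conjc (x + y) = conjc x + conjc y.
Proof. exact: (rmorphD (@conjc R)). Qed.

Lemma conjc_sum I (s : seq I) (P : pred I) (F : I -> C) :
  conjc (\sum_(i <- s | P i) F i) = \sum_(i <- s | P i) conjc (F i).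
Proof. exact: (rmorph_sum (@conjc R)). Qed.

Lemma dft_sum (k l : nat) : (k <= n)%N -> (l <= n)%N ->
  \sum_(j < (2 * n).+1) (expi (k%:R * dft_pt j) * expi (- (l%:R * dft_pt j)))
  = (if k == l then rC (2 * n).+1%:R else 0).
Proof.
wlog kl : k l / (l <= k)%N.
  move=> W kn ln; have [/W->//|/ltnW/W h] := leqP l k.
  move: (h ln kn) => /(congr1 (@conjc R)); rewrite conjc_sum eq_sym => e.
  transitivity (@conjc R (if k == l then rC (2 * n).+1%:R : C else 0)).
    by rewrite -e; apply: eq_bigr => j _; rewrite conjcM -!expiN opprK mulrC.
  by case: ifP => _; rewrite ?conjc_rC ?conjc0.
move=> kn ln; have [<-|kNl] := eqVneq k l.
  under eq_bigr do rewrite expi_mulVr.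
  by rewrite sumr_const card_ord rC_nat.
rewrite -[RHS](@dft_sum0 (k - l)); last first.
  by rewrite subn_gt0 ltn_neqAle eq_sym kNl kl /=; lia.
by apply: eq_bigr => j _; rewrite -expiD natrB // mulrBl.
Qed.

(** Frequency [-l] meets [k] only for [l = k], while frequency [l > 0] is moved to [l + k], strictly
    between [0] and [2n + 1], and sums to zero over the nodes. Hence [b] drops out. *)
Lemma dft_coef a b (k : 'I_n.+1) :
  \sum_(j < (2 * n).+1) (strig a b (dft_pt j) * expi (k%:R * dft_pt j))
  = rC ((2 * n).+1%:R * (if k == ord0 then a k else a k / 2)).
Proof.
set L := (2 * n).+1%:R.
have lt_n (i : 'I_n.+1) : (i <= n)%N by rewrite -ltnS.
rewrite /strig; under eq_bigr do rewrite mulrDl -mulrA mulr_suml.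
rewrite big_split /= -!mulr_sumr exchange_big /=.
have -> : \sum_(j < (2 * n).+1) expi (k%:R * dft_pt j) = if k == ord0 then rC L else 0.
  have := @dft_sum k 0 (lt_n k) isT.
  by under eq_bigr do rewrite mul0r oppr0 expi0 mulr1.
have E (l : 'I_n.+1) : l != ord0 -> \sum_(j < (2 * n).+1)
    (expi (- (l%:R * dft_pt j)) * rC (a l) + expi (l%:R * dft_pt j) * rC (b l)) *
      expi (k%:R * dft_pt j) = if l == k then rC (L * a k) else 0.
  move=> l0; under eq_bigr do rewrite mulrDl mulrAC [X in _ + X]mulrAC.
  rewrite big_split /= -!mulr_suml.
  rewrite [X in _ + X * _](_ : _ = 0) ?mul0r ?addr0; last first.
    rewrite -[RHS](@dft_sum0 (l + k)); last first.
      have : (0 < l)%N by rewrite lt0n; apply: contra l0 => /eqP h; apply/eqP/val_inj.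
      have := lt_n l; have := lt_n k; lia.
    by apply: eq_bigr => j _; rewrite -expiD -mulrDl -natrD.
  under eq_bigr do rewrite mulrC.
  rewrite dft_sum // -val_eqE eq_sym /=.
  by case: eqP => [/val_inj->|_]; rewrite ?mul0r // -rCM.
rewrite (eq_bigr _ E) -big_mkcondr /=; have [k0|k0] := eqVneq k ord0.
  rewrite big_pred0 ?mulr0 ?addr0 -?rCM ?k0 1?mulrC // => l.
  by case: eqVneq.
rewrite mulr0 add0r (big_pred1 k); last first.
  by move=> l /=; case: (l =P k) => [->|]; rewrite ?k0 ?andbF.
by rewrite -rCM; congr rC; ring.
Qed.

(** The factor [2] undoes the [1/2] carried by the coefficients of positive index in [dft_coef]. *)
Lemma strig_coef_le a b (k : 'I_n.+1) :
  `|a k| <= 2 / (2 * n).+1%:R * \sum_(j < (2 * n).+1) normc (strig a b (dft_pt j)).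
Proof.
have L0 : (0 : R) < (2 * n).+1%:R by rewrite ltr0n.
have : normc (rC ((2 * n).+1%:R * (if k == ord0 then a k else a k / 2)))
    <= \sum_(j < (2 * n).+1) normc (strig a b (dft_pt j)).
  rewrite -(dft_coef a b); apply: le_trans (normc_sum _ _ _) _.
  by apply: ler_sum => j _; rewrite Normc.normcM normc_expi mulr1.
rewrite normc_rC normrM gtr0_norm //; move: (\sum_(_ < _) _) => S h.
rewrite mulrAC ler_pdivlMr //; have := normr_ge0 (a k).
move: h; case: ifP => _; rewrite ?normrM ?normfV ?(gtr0_norm (_ : 0 < 2)) //; nra.
Qed.

Lemma strig_eq0 a b : (forall t, strig a b t = 0) -> forall k, a k = 0.
Proof.
move=> h k; have := strig_coef_le a b k; rewrite big1 ?mulr0; last first.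
  by move=> j _; rewrite h Normc.normc0.
by rewrite normr_le0 => /eqP.
Qed.

Lemma tp_strig a b : tp (strig a b).
Proof.
apply: tpD; first exact: tp_cst.
apply: tpM; first exact: tp_cst.
by apply: tp_sum => k; apply: tpD; apply: tpM;
  [exact: tp_expiN|exact: tp_cst|exact: tp_expi|exact: tp_cst].
Qed.

Definition nab a b : R := \sum_k (`|a k| + `|b k|).

Lemma nabE a b : nab a b = (`|a ord0| + `|b ord0|) +
  \sum_(k < n.+1 | k != ord0) (`|a k| + `|b k|).
Proof. by rewrite /nab (bigD1 ord0). Qed.

Lemma strig_bound a b t : normc (strig a b t) <= nab a b.
Proof.
apply: le_trans (le_normcD _ _) _; rewrite Normc.normcM !normc_rC nabE.
rewrite (gtr0_norm (_ : 0 < 2^-1)) ?invr_gt0 //.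
set S := \sum_(k < n.+1 | _) (`|_| + _).
have : normc (\sum_(k < n.+1 | k != ord0)
   (expi (- (k%:R * t)) * rC (a k) + expi (k%:R * t) * rC (b k))) <= S.
  apply: le_trans (normc_sum _ _ _) _; apply: ler_sum => k _.
  apply: le_trans (le_normcD _ _) _.
  by rewrite !Normc.normcM !normc_expi !mul1r !normc_rC.
have := normr_ge0 (b ord0); have : 0 <= S by apply: sumr_ge0 => k _; rewrite addr_ge0.
move: (normc _) => x; lra.
Qed.

Lemma expi_second_diff (x h : R) :
  expi (x + h) + expi (x - h) - 2 * expi x = rC (2 * cos h - 2) * expi x.
Proof.
apply/eqP; rewrite eq_complex /= /expi !(cosD, sinD, cosN, sinN) /=.
by apply/andP; split; apply/eqP; ring.
Qed.

(** Differencing multiplies frequency [k] by [2 cos (k h) - 2], of modulus at most [2 (n h)^2] by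
    [cos_quad]; the [1/2] in front of the sum absorbs the [2]. *)
Lemma strig_second_diff a b x h :
  normc (strig a b (x + h) + strig a b (x - h) - 2 * strig a b x)
    <= (n%:R * h) ^+ 2 * nab a b.
Proof.
have -> : strig a b (x + h) + strig a b (x - h) - 2 * strig a b x =
  rC 2^-1 * \sum_(k < n.+1 | k != ord0) rC (2 * cos (k%:R * h) - 2) *
    (expi (- (k%:R * x)) * rC (a k) + expi (k%:R * x) * rC (b k)).
  rewrite /strig.
  set c := rC _; set d := rC 2^-1; set S1 := \sum_(k | _) _; set S2 := \sum_(k | _) _.
  set S3 := \sum_(k | _) _; set S4 := \sum_(k | _) _.
  have -> : S4 = S1 + S2 - 2 * S3.
    rewrite /S4 /S1 /S2 /S3 mulr_sumr -sumrN -!big_split /=; apply: eq_bigr => k _.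
    have := expi_second_diff (k%:R * x) (k%:R * h).
    have := expi_second_diff (- (k%:R * x)) (k%:R * h).
    rewrite mulrDr !mulrA => <- <-; rewrite mulrDr mulrBr.
    have e1 : - (k%:R * x) + k%:R * h = - (k%:R * x - k%:R * h) by ring.
    have e2 : - (k%:R * x) - k%:R * h = - (k%:R * x + k%:R * h) by ring.
    rewrite e1 e2; move: (expi _) (expi _) (expi _) (expi _) (expi _) (expi _) => z1 z2 z3 z4 z5 z6.
    by ring.
  by ring.
rewrite Normc.normcM normc_rC gtr0_norm ?invr_gt0 //.
rewrite nabE; set S := \sum_(k < n.+1 | _) (`|_| + _).
have : normc (\sum_(k < n.+1 | k != ord0) rC (2 * cos (k%:R * h) - 2) *
    (expi (- (k%:R * x)) * rC (a k) + expi (k%:R * x) * rC (b k)))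
   <= 2 * (n%:R * h) ^+ 2 * S.
  apply: le_trans (normc_sum _ _ _) _; rewrite mulr_sumr; apply: ler_sum => k _.
  rewrite Normc.normcM normc_rC; apply: ler_pM => //; first exact: normc_ge0.
    have /andP[h1 h2] := cos_quad (k%:R * h).
    rewrite ler0_norm; last by lra.
    have : (k%:R * h) ^+ 2 <= (n%:R * h) ^+ 2.
      by rewrite !exprMn ler_wpM2r ?sqr_ge0 // lerXn2r ?nnegrE // ler_nat -ltnS.
    lra.
  apply: le_trans (le_normcD _ _) _.
  by rewrite !Normc.normcM !normc_expi !mul1r !normc_rC.
have := mulr_ge0 (sqr_ge0 (n%:R * h)) (addr_ge0 (normr_ge0 (a ord0)) (normr_ge0 (b ord0))).
move: (normc _) => y; rewrite -(mulrA 2) (mulrDr _ _ S).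
move: (_ ^+ 2 * S) => z; move: (_ ^+ 2 * _) => z'; lra.
Qed.

Lemma strigD a b a' b' t :
  strig (fun k => a k + a' k) (fun k => b k + b' k) t = strig a b t + strig a' b' t.
Proof.
rewrite /strig rCD addrACA -mulrDr -big_split /=; congr (_ + _ * _).
by apply: eq_bigr => k _; rewrite !rCD; ring.
Qed.

Lemma strigZ (c : R) a b t :
  strig (fun k => c * a k) (fun k => c * b k) t = rC c * strig a b t.
Proof.
rewrite /strig rCM [in RHS]mulrDr [in RHS]mulrCA [in RHS]mulr_sumr; congr (_ + _ * _).
by apply: eq_bigr => k _; rewrite !rCM; ring.
Qed.

Lemma strig_cst a b t : (forall k, k != ord0 -> a k = 0 /\ b k = 0) ->
  strig a b t = rC (a ord0).
Proof.
move=> h; rewrite /strig big1 ?mulr0 ?addr0 // => k /h[-> ->].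
by rewrite !mulr0 addr0.
Qed.

Lemma strig_conj a b t : a ord0 = b ord0 -> conjc (strig a b t) = strig b a t.
Proof.
move=> ab; rewrite /strig conjcD conjcM conjc_sum !conjc_rC ab.
congr (_ + _ * _); apply: eq_bigr => k _.
by rewrite conjcD !conjcM !conjc_rC -!expiN opprK addrC.
Qed.

Lemma expi_int (k : nat) (z : int) : expi (k%:R * (z%:~R * (2 * pi))) = 1 :> C.
Proof.
case: z => z; first by rewrite mulrA -natrM expi2pi.
rewrite NegzE mulrNz mulNr mulrN mulrA -[z.+1%:~R]/(z.+1%:R) -natrM.
by rewrite expiN expi2pi conjc1.
Qed.

(** Positivity is given on [[0, 2 pi)] only, while second differences leave that interval. The
    reduced angle does not depend on the coefficients, so all entries of a matrix are reduced at
    once. *)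
Lemma reduce_Tset (t : R) : exists2 t', Tset t' &
  forall a b, strig a b t = strig a b t'.
Proof.
set w : R := 2 * pi; have w0 : 0 < w by rewrite mulr_gt0 // pi_gt0.
pose z := Num.floor (t / w); exists (t - z%:~R * w).
  rewrite /Tset /= in_itv /= -/w.
  have /andP[] := Num.Theory.floor_itv (t / w).
  rewrite -/z intrD ltr_pdivrMr // ler_pdivlMr //; move: (z%:~R) => y h1 h2.
  by apply/andP; split; lra.
move=> a b; rewrite /strig; congr (_ + _ * _); apply: eq_bigr => k _.
have e : expi (k%:R * (t - z%:~R * w)) = expi (k%:R * t).
  rewrite -[LHS]mulr1 -[X in _ * X = _](expi_int k z) -expiD; congr expi; rewrite /w; ring.
by rewrite !expiN e.
Qed.

End ScalarTrig.

(* Locked copies: unification must not unfold these two functions. *)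
HB.lock Definition QT {R : realType} {m n} (Q : 'I_n.+1 -> 'M[R]_m) (t : R) : 'M[R[i]]_m :=
  Qtrig Q t.
HB.lock Definition pT {R : realType} {n} (p : 'I_n -> R) (t : R) : R := ptrig p t.

Lemma QTE (R : realType) m n (Q : 'I_n.+1 -> 'M[R]_m) t : QT Q t = Qtrig Q t.
Proof. by rewrite QT.unlock. Qed.

Lemma pTE (R : realType) n (p : 'I_n -> R) t : pT p t = ptrig p t.
Proof. by rewrite pT.unlock. Qed.

(** * Matrix trigonometric polynomials, closures and coefficient bounds *)

Section MatrixTrig.
Variable R : realType.
Local Notation C := R[i].
Local Notation normc := (@Normc.normc R).
Variables m n : nat.
Implicit Types (Q : 'I_n.+1 -> 'M[R]_m) (p : 'I_n -> R).

Lemma QtrigE Q t i j :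
  QT Q t i j = strig (fun k => Q k i j) (fun k => Q k j i) t.
Proof.
rewrite QT.unlock /Qtrig !mxE summxE; congr (_ + _ * _).
by apply: eq_bigr => k _; rewrite !mxE.
Qed.

(** Restores [p_0 = 1], which makes the scalar polynomial an instance of [strig] with two equal
    coefficient families. *)
Definition pco p (k : 'I_n.+1) : R := if unlift ord0 k is Some i then p i else 1.

Lemma ptrigE p t : rC (pT p t) = strig (pco p) (pco p) t.
Proof.
rewrite pT.unlock /ptrig /strig rCD {1}/pco unlift_none rCM; congr (_ + _ * _).
rewrite [in RHS]big_mkcond [in RHS]big_ord_recl /= add0r rC_sum; apply: eq_bigr => i _.
rewrite /pco liftK -mulrDl rCM mulrC; congr (_ * _).
by apply/eqP; rewrite eq_complex /= sinN addNr !eqxx.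
Qed.

Lemma ptrig_Re p t : pT p t = complex.Re (strig (pco p) (pco p) t).
Proof. by rewrite -ptrigE. Qed.

Definition nrm Q : R := \sum_k \sum_i \sum_j `|Q k i j|.

Lemma nrm_ge0 Q : 0 <= nrm Q.
Proof. by do 3! (apply: sumr_ge0 => ? _). Qed.

Lemma nab_entry Q i j : nab (fun k => Q k i j) (fun k => Q k j i) <= 2 * nrm Q.
Proof.
have h i' j' : \sum_k `|Q k i' j'| <= nrm Q.
  apply: ler_sum => k _; rewrite (bigD1 i') //= (bigD1 j') //= -addrA lerDl.
  by rewrite addr_ge0 //; do 2?(apply: sumr_ge0 => ? _).
by rewrite /nab big_split /= mulr2n mulrDl !mul1r lerD.
Qed.

Lemma normc_sqr (z : C) : normc z ^+ 2 = complex.Re z ^+ 2 + complex.Im z ^+ 2.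
Proof. by case: z => a b /=; rewrite sqr_sqrtr // addr_ge0 ?sqr_ge0. Qed.

(** The products of moduli [x i * x j] are split by [2 x y <= x^2 + y^2]; summing over both indices
    produces the factor [m]. *)
Lemma qf_entry_bound (E : 'M[C]_m) (e : R) v : 0 <= e ->
  (forall i j, normc (E i j) <= e) -> `|qf E v| <= e * m%:R * vnorm2 v.
Proof.
move=> e0 hE; pose x i := normc (v i 0).
have Ex : vnorm2 v = \sum_i x i ^+ 2.
  by rewrite vnorm2E; apply: eq_bigr => i _; rewrite normc_sqr.
have x0 i : 0 <= x i by exact: normc_ge0.
apply: le_trans (le_Re_normc _) _; rewrite mxE.
apply: le_trans (normc_sum _ _ _) _.
apply: (@le_trans _ _ (\sum_j \sum_i (e / 2 * (x i ^+ 2 + x j ^+ 2)))).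
  apply: ler_sum => j _; rewrite mxE mulr_suml.
  apply: le_trans (normc_sum _ _ _) _; apply: ler_sum => i _.
  rewrite !mxE !Normc.normcM (_ : normc (conjc _) = x i); last first.
    by rewrite /x; case: (v i 0) => a b /=; rewrite sqrrN.
  have : x i * normc (E i j) * x j <= x i * e * x j.
    by rewrite ler_wpM2r // ler_wpM2l.
  rewrite -/(x j); have := mulr_ge0 e0 (sqr_ge0 (x i - x j)).
  by rewrite sqrrB; move: (normc _) (x i) (x j) => y a b; lra.
rewrite exchange_big /=.
under eq_bigr do rewrite -mulr_sumr big_split /= sumr_const card_ord -Ex.
rewrite -mulr_sumr big_split /= sumr_const card_ord sumrMnl -Ex -[vnorm2 v *+ m]mulr_natr.
rewrite le_eqVlt; apply/orP; left; apply/eqP; by field.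
Qed.

Lemma addmxE (A B : 'M[C]_m) i j : (A + B) i j = A i j + B i j.
Proof. by rewrite mxE. Qed.

Lemma oppmxE (A : 'M[C]_m) i j : (- A) i j = - A i j.
Proof. by rewrite mxE. Qed.

Lemma scalemxE (c : C) (A : 'M[C]_m) i j : (c *: A) i j = c * A i j.
Proof. by rewrite mxE. Qed.

Lemma QtrigD Q Q' t : QT (fun k => Q k + Q' k) t = QT Q t + QT Q' t.
Proof.
apply/matrixP => i j; rewrite addmxE !QtrigE -strigD.
by congr strig; apply/funext => k; rewrite mxE.
Qed.

Lemma QtrigZ (c : R) Q t : QT (fun k => c *: Q k) t = rC c *: QT Q t.
Proof.
apply/matrixP => i j; rewrite scalemxE !QtrigE -strigZ.
by congr strig; apply/funext => k; rewrite mxE.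
Qed.

Lemma QtrigB Q Q' t : QT (fun k => Q k - Q' k) t = QT Q t - QT Q' t.
Proof.
have := QtrigD Q (fun k => (-1) *: Q' k) t; rewrite QtrigZ.
have -> : (fun k => Q k + -1 *: Q' k) = (fun k => Q k - Q' k).
  by apply/funext => k; rewrite scaleN1r.
move=> ->; congr (_ + _); rewrite (_ : rC (-1) = -1) ?scaleN1r //.
by apply/eqP; rewrite eq_complex /= oppr0 !eqxx.
Qed.

(** The constant polynomial [s I]: subtracted, it expresses a uniform lower bound on [Q]; added, it
    gives the competitor that beats a nearly singular [Q]. *)
Definition Qid (s : R) (k : 'I_n.+1) : 'M[R]_m := if k == ord0 then s%:M else 0.

Lemma Qtrig_id s t : QT (Qid s) t = (rC s)%:M.
Proof.
apply/matrixP => i j; rewrite QtrigE strig_cst.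
  by rewrite /Qid eqxx !mxE; case: (i == j); rewrite ?mulr1n ?mulr0n.
by move=> k k0; rewrite /Qid (negPf k0) !mxE.
Qed.

Definition Qsh (s : R) Q (k : 'I_n.+1) : 'M[R]_m := Q k + Qid s k.

Lemma Qtrig_sh s Q t : QT (Qsh s Q) t = QT Q t + (rC s)%:M.
Proof. by rewrite -(Qtrig_id s t) -QtrigD. Qed.

Lemma Qtrig_herm Q t : (Q ord0)^T = Q ord0 -> hermitian (QT Q t).
Proof.
move=> hQ; apply/matrixP => i j; rewrite !mxE !QtrigE strig_conj //.
by rewrite -{1}hQ mxE.
Qed.

Lemma qf_Qtrig_bound Q t v : `|qf (QT Q t) v| <= 2 * nrm Q * m%:R * vnorm2 v.
Proof.
apply: qf_entry_bound => [|i j]; first by rewrite mulr_ge0 // nrm_ge0.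
by rewrite QtrigE; apply: le_trans (strig_bound _ _ _) (nab_entry _ _ _).
Qed.

Lemma qf_second_diff Q v x h :
  qf (QT Q (x + h)) v + qf (QT Q (x - h)) v - 2 * qf (QT Q x) v
    <= (n%:R * h) ^+ 2 * (2 * nrm Q) * m%:R * vnorm2 v.
Proof.
rewrite -qfZ -qfN -!qfD; apply: le_trans (ler_norm _) _.
apply: qf_entry_bound => [|i j].
  by rewrite mulr_ge0 ?sqr_ge0 // mulr_ge0 // nrm_ge0.
rewrite !addmxE oppmxE scalemxE !QtrigE rC_nat; apply: le_trans (strig_second_diff _ _ _ _) _.
by rewrite ler_wpM2l ?sqr_ge0 // nab_entry.
Qed.

(** The closures are given by [e]-approximations, so inequalities pass to the limit through this
    Archimedean step. Dividing by [K + 1] rather than [K] in the proof allows [K = 0]. *)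
Lemma lim_ge0 (K x : R) : 0 <= K -> (forall e, 0 < e -> - (K * e) <= x) -> 0 <= x.
Proof.
move=> K0 h; rewrite leNgt; apply/negP => x0.
have e0 : 0 < - x / (2 * (K + 1)) by rewrite divr_gt0 ?oppr_gt0 // mulr_gt0 // ltr_wpDl.
have := h _ e0; apply/negP; rewrite -ltNge.
rewrite (_ : K * _ = - x / 2 * (K / (K + 1))); last by field; rewrite gt_eqF // ltr_wpDl.
have : K / (K + 1) <= 1 by rewrite ler_pdivrMr ?mul1r ?lerDl // ltr_wpDl.
nra.
Qed.

Lemma pT_diff p p' (e : R) t : 0 <= e -> (forall i, `|p i - p' i| <= e) ->
  `|pT p t - pT p' t| <= 2 * n.+1%:R * e.
Proof.
move=> e0 hpp; pose d k := pco p k - pco p' k.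
have -> : pT p t - pT p' t = complex.Re (strig d d t).
  apply/eqP; rewrite subr_eq; apply/eqP; rewrite !ptrig_Re -ReD -strigD.
  by congr (complex.Re (strig _ _ _)); apply/funext => k; rewrite /d subrK.
apply: le_trans (le_Re_normc _) _; apply: le_trans (strig_bound _ _ _) _.
rewrite (_ : 2 * n.+1%:R * e = \sum_(k < n.+1) 2 * e); last first.
  by rewrite sumr_const card_ord -mulr_natl; ring.
apply: ler_sum => k _; have : `|d k| <= e; last by move: (`|d k|) => y; lra.
by rewrite /d /pco; case: (unlift ord0 k) => [i|]; rewrite ?subrr ?normr0.
Qed.

Lemma Bo_bar_ge0 p : Bo_bar p -> forall t, 0 <= pT p t.
Proof.
move=> hp t; rewrite ptrig_Re; have [t' Tt ->] := reduce_Tset n t; rewrite -ptrig_Re.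
apply: (@lim_ge0 (2 * n.+1%:R)) => [|e e0]; first by rewrite mulr_ge0.
have [p' [Bp' hpp]] := hp _ e0; have := Bp' _ Tt; rewrite -pTE.
have := @pT_diff p p' e t' (ltW e0) (fun i => ltW (hpp i)).
by rewrite ler_norml => /andP[]; lra.
Qed.

(** Working form of membership in [Bm_clos]: a closed condition on values, at all real angles rather
    than on [Tset]. *)
Definition psdQ Q : Prop := (Q ord0)^T = Q ord0 /\ forall t, herm_psd (QT Q t).

Lemma Qtrig_reduce t : exists2 t', Tset t' & forall Q, QT Q t = QT Q t'.
Proof.
have [t' Tt h] := reduce_Tset n t; exists t' => // Q.
by apply/matrixP => i j; rewrite !QtrigE h.
Qed.

Lemma Bm_clos_psd Q : Bm_clos Q -> psdQ Q.
Proof.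
move=> hQ; have sQ : (Q ord0)^T = Q ord0.
  apply/matrixP => i j; rewrite mxE; apply/eqP; rewrite -subr_eq0 -normr_le0 -oppr_ge0.
  apply: (@lim_ge0 2) => // e e0; have [Q' [[sQ' _] hQ']] := hQ _ e0.
  have h1 := hQ' ord0 i j; have h2 := hQ' ord0 j i.
  have h3 : Q' ord0 j i = Q' ord0 i j by rewrite -{1}sQ' mxE.
  rewrite h3 in h2; rewrite lerN2.
  rewrite (_ : _ - _ = (Q ord0 j i - Q' ord0 i j) - (Q ord0 i j - Q' ord0 i j)).
    by apply: le_trans (ler_normB _ _) _; lra.
  by ring.
split=> // t; have [t' Tt ->] := Qtrig_reduce t.
apply/psdP; split; first exact: Qtrig_herm.
move=> v; set K := 2 * (n.+1%:R * (m%:R * m%:R)) * m%:R * vnorm2 v.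
apply: (@lim_ge0 K) => [|e e0]; first by rewrite !mulr_ge0 // vnorm2_ge0.
have [Q' [[_ pQ'] hQ']] := hQ _ e0.
have := pd_psd (pQ' _ Tt); rewrite -QTE => /psdP[_ /(_ v) h1].
have h2 := qf_Qtrig_bound (fun k => Q k - Q' k) t' v; rewrite QtrigB qfD qfN in h2.
have h3 : nrm (fun k => Q k - Q' k) <= n.+1%:R * (m%:R * m%:R) * e.
  rewrite (_ : _ * e = \sum_(k < n.+1) \sum_(i < m) \sum_(j < m) e); last first.
    by rewrite !sumr_const !card_ord -!mulrnA -[RHS]mulr_natl !natrM; ring.
  do 3![apply: ler_sum => ? _]; by rewrite !mxE ltW.
have h4 : 2 * nrm (fun k => Q k - Q' k) * m%:R * vnorm2 v <= K * e.
  rewrite /K -!mulrA ler_pM2l // [leRHS](_ : _ = n.+1%:R * (m%:R * m%:R) * e * (m%:R * vnorm2 v)).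
    by rewrite ler_wpM2r // mulr_ge0 // vnorm2_ge0.
  by ring.
move: h1 (le_trans h2 h4) => {h2 h3 h4}; move: (qf (QT Q t') v) (qf (QT Q' t') v) => x y.
by rewrite ler_norml => h /andP[]; lra.
Qed.

Lemma Bm_bar_psd Q : Bm_bar Q -> psdQ Q.
Proof. by case=> /Bm_clos_psd. Qed.

Lemma tp_QT Q i j : tp (fun t => QT Q t i j).
Proof. by under eq_fun do rewrite QtrigE; exact: tp_strig. Qed.

Lemma det_zeros Q : Bm_bar Q ->
  finite_set [set t | Tset t /\ \det (QT Q t) = 0]%classic.
Proof.
move=> [_ h]; have [h0|//] := tp_zeros (tp_det (fun i j => tp_QT Q i j)).
by exfalso; apply: h => t _; rewrite -QTE; exact: h0.
Qed.

Lemma Qtrig_inj Q : infinite_set [set t | Tset t /\ QT Q t = 0]%classic ->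
  forall k, Q k = 0.
Proof.
move=> inf k; apply/matrixP => i j; rewrite mxE.
have [h|h] := tp_zeros (tp_QT Q i j).
  apply: (@strig_eq0 R n (fun k => Q k i j) (fun k => Q k j i)) => t.
  by rewrite -QtrigE.
exfalso; apply: inf; apply: sub_finite_set h => t [Tt /= ->].
by rewrite mxE.
Qed.

Lemma ptrig_inj p p' : infinite_set [set t | Tset t /\ pT p t = pT p' t]%classic ->
  p = p'.
Proof.
move=> inf; pose d k := pco p k + -1 * pco p' k.
have dE t : strig d d t = rC (pT p t - pT p' t).
  rewrite strigD strigZ -!ptrigE -rCM -rCD; congr rC; ring.
have d0 : forall k, d k = 0.
  have [h|h] := tp_zeros (tp_strig d d); first exact: strig_eq0 h.
  exfalso; apply: inf; apply: sub_finite_set h => t [Tt /= e].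
  by rewrite dE e subrr.
apply/funext => i; move: (d0 (lift ord0 i)); rewrite /d /pco liftK mulN1r.
by move/subr0_eq.
Qed.

(** By [dft_coef] at index [0] the values of [p] at the [2n + 1] nodes sum to [2n + 1]. Since they
    are nonnegative, this is also the sum of their moduli in [strig_coef_le]. *)
Lemma pco_le p k : (forall t, 0 <= pT p t) -> `|pco p k| <= 2.
Proof.
move=> p0; apply: le_trans (strig_coef_le (pco p) (pco p) k) _.
have := dft_coef (pco p) (pco p) ord0; rewrite eqxx.
under eq_bigr do rewrite mul0r expi0 mulr1 -ptrigE.
rewrite -rC_sum /pco unlift_none mulr1 => -[E].
under eq_bigr do rewrite -/(pco p) -ptrigE normc_rC ger0_norm //.
by rewrite E divfK // pnatr_eq0.
Qed.

Lemma nab_pco p : (forall t, 0 <= pT p t) -> nab (pco p) (pco p) <= 4 * n.+1%:R.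
Proof.
move=> p0; rewrite (_ : 4 * _ = \sum_(k < n.+1) 4); last first.
  by rewrite sumr_const card_ord mulr_natr.
by apply: ler_sum => k _; have := pco_le k p0; lra.
Qed.

Lemma ptrig_le p t : (forall t, 0 <= pT p t) -> pT p t <= 4 * n.+1%:R.
Proof.
move=> p0; apply: le_trans (nab_pco p0); rewrite ptrig_Re.
apply: le_trans (ler_norm _) _; apply: le_trans (le_Re_normc _) _.
exact: strig_bound.
Qed.

Lemma ptrig_second_diff p x h : (forall t, 0 <= pT p t) ->
  pT p (x + h) + pT p (x - h) - 2 * pT p x <= (n%:R * h) ^+ 2 * (4 * n.+1%:R).
Proof.
move=> p0; apply: (@le_trans _ _ ((n%:R * h) ^+ 2 * nab (pco p) (pco p))); last first.
  by rewrite ler_wpM2l ?sqr_ge0 // nab_pco.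
apply: le_trans (strig_second_diff _ _ _ _); apply: le_trans (le_Re_normc _).
apply: le_trans (ler_norm _); rewrite -!ptrigE -(rC_nat _ 2) !(ReD, ReN, ReM_rC) /=.
exact: lexx.
Qed.

End MatrixTrig.

(** Since [f (x0 - h) >= 0], the second-difference bound gives [f (x0 + h) <= 2 f x0 + K h^2] on
    either side of [x0]. Both barriers rest on this, without derivatives. *)
Lemma dip (R : realType) (f : R -> R) (K r x0 : R) : 0 <= K -> 0 < r <= 1 ->
  (forall t, 0 <= f t) ->
  (forall x h, f (x + h) + f (x - h) - 2 * f x <= K * h ^+ 2) -> Tset x0 ->
  exists a, [/\ 0 <= a, a + r <= 2 * pi &
    forall x, a <= x <= a + r -> f x <= 2 * f x0 + K * r ^+ 2].
Proof.
move=> K0 /andP[r0 r1] f0 hf; rewrite /Tset /= in_itv /= => /andP[x00 x01].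
have pi2 := @pi_ge2 R.
have key h : `|h| <= r -> f (x0 + h) <= 2 * f x0 + K * r ^+ 2.
  move=> hr; have := hf x0 h; have := f0 (x0 - h).
  have : K * h ^+ 2 <= K * r ^+ 2.
    by rewrite ler_wpM2l // -[h ^+ 2]real_normK ?num_real // lerXn2r ?nnegrE // ltW.
  lra.
have [le|lt] := leP (x0 + r) (2 * pi).
  exists x0; split=> // x hx; rewrite -(subrKC x0 x); apply: key.
  by rewrite ler_norml; lra.
(* Here [x0 + r > 2 pi]; as [r <= 1] and [pi >= 2], the interval on the left of [x0] stays in the
   period. *)
exists (x0 - r); split; [lra|lra|] => x hx; rewrite -(subrKC x0 x); apply: key.
by rewrite ler_norml; lra.
Qed.

(** * Integration over the circle *)

Section IntegralOnCircle.
Variable R : realType.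
Local Open Scope classical_set_scope.
Local Notation mu := (@lebesgue_measure R).
Local Notation T := (@Tset R).
Local Notation tint f := (mu.-integrable T (EFin \o f)).
Implicit Types (f g : R -> R) (Z : set R).

Lemma pi2_gt0 : 0 < 2 * pi :> R.
Proof. by rewrite mulr_gt0 // pi_gt0. Qed.

Lemma measurable_Tset : measurable (T : set (measurableTypeR R)).
Proof. by apply: measurable_itv. Qed.
Local Hint Resolve measurable_Tset : core.

Lemma mu_Tset : mu T = (2 * pi)%:E.
Proof. by rewrite /Tset lebesgue_measure_itv /= lte_fin pi2_gt0 oppr0 adde0. Qed.

Lemma mu_Tset_lty : (mu T < +oo)%E.
Proof. by rewrite mu_Tset ltry. Qed.

Lemma fin_null Z : finite_set Z -> measurable (Z : set (measurableTypeR R)) /\ mu Z = 0%E.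
Proof.
move=> /finite_set_countable cZ; split; last exact: countable_lebesgue_measure0.
by apply: countable_measurable cZ => t; exact: measurable_set1.
Qed.

Lemma tint_cst c : tint (fun=> c).
Proof.
apply: measurable_bounded_integrable => //; first exact: mu_Tset_lty.
by exists `|c|; split; [exact: num_real|move=> x cx y _ /=; exact: ltW].
Qed.

Lemma tintD f g : tint f -> tint g -> tint (fun t => f t + g t).
Proof. by move=> hf hg; apply: eq_integrable (integrableD measurable_Tset hf hg). Qed.

Lemma tintZ c f : tint f -> tint (fun t => c * f t).
Proof. by move=> hf; apply: eq_integrable (integrableZl measurable_Tset c hf). Qed.

Lemma tintB f g : tint f -> tint g -> tint (fun t => f t - g t).
Proof. by move=> hf hg; apply: eq_integrable (integrableB measurable_Tset hf hg). Qed.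

Lemma tint_sum (I : Type) (s : seq I) (P : pred I) (F : I -> R -> R) :
  (forall i, tint (F i)) -> tint (fun t => \sum_(i <- s | P i) F i t).
Proof.
move=> h; elim: s => [|i s IH].
  by under eq_fun do rewrite big_nil; exact: tint_cst.
by under eq_fun do rewrite big_cons; case: (P i) => //; apply: tintD.
Qed.

Lemma TRint_cst c : TRint (fun=> c : R) = c.
Proof.
rewrite /TRint Rintegral_cst // (_ : fine _ = 2 * pi); last exact: (congr1 fine mu_Tset).
by rewrite mulrCA mulVf ?mulr1 // gt_eqF // pi2_gt0.
Qed.

Lemma TRintD f g : tint f -> tint g -> TRint (fun t => f t + g t) = TRint f + TRint g.
Proof. by move=> hf hg; rewrite /TRint RintegralD // mulrDr. Qed.

Lemma TRintB f g : tint f -> tint g -> TRint (fun t => f t - g t) = TRint f - TRint g.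
Proof. by move=> hf hg; rewrite /TRint RintegralB // mulrBr. Qed.

Lemma TRintZ c f : tint f -> TRint (fun t => c * f t) = c * TRint f.
Proof. by move=> hf; rewrite /TRint RintegralZl // mulrCA. Qed.

Lemma TRint_sum (I : Type) (s : seq I) (P : pred I) (F : I -> R -> R) :
  (forall i, tint (F i)) ->
  TRint (fun t => \sum_(i <- s | P i) F i t) = \sum_(i <- s | P i) TRint (F i).
Proof.
move=> h; elim: s => [|i s IH].
  by under eq_fun do rewrite big_nil; rewrite TRint_cst big_nil.
under eq_fun do rewrite big_cons; rewrite big_cons; case: (P i) => //.
by rewrite TRintD ?IH //; exact: tint_sum.
Qed.

Lemma tint_null f Z : finite_set Z -> tint f ->
  mu.-integrable (T `\` Z) (EFin \o f) /\
  TRint f = (2 * pi)^-1 * Rintegral mu (T `\` Z) f.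
Proof.
move=> /fin_null[mZ Z0] hf; split.
  apply: integrableS hf => //; first [exact: measurableD|exact: subDsetl].
by rewrite /TRint /Rintegral -(negligible_integral mZ measurable_Tset hf Z0).
Qed.

(** A finite set is null. In the applications to boundary points [Z] holds the angles where [Q] is
    singular and the integrand takes conventional values. *)
Lemma le_TRint f g Z : finite_set Z -> tint f -> tint g ->
  (forall t, T t -> ~ Z t -> f t <= g t) -> TRint f <= TRint g.
Proof.
move=> fZ hf hg h; have [hf' ->] := tint_null fZ hf; have [hg' ->] := tint_null fZ hg.
rewrite ler_pM2l ?invr_gt0 ?pi2_gt0 //; have [mZ _] := fin_null fZ.
by apply: le_Rintegral => //; [exact: measurableD|move=> t [Tt Zt]; exact: h].
Qed.

Lemma TRint_ge_itv f Z a r c : finite_set Z -> tint f -> 0 <= a -> 0 < r -> a + r <= 2 * pi ->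
  0 <= c -> (forall t, T t -> ~ Z t -> 0 <= f t) ->
  (forall t, T t -> ~ Z t -> a <= t <= a + r -> c <= f t) ->
  c * r / (2 * pi) <= TRint f.
Proof.
move=> fZ hf a0 r0 ar c0 f0 fc.
set A : set R := `[a, a + r[.
have mA : measurable (A : set (measurableTypeR R)) by apply: measurable_itv.
have AT : A `&` T = A.
  apply: setIidl => t; rewrite /A /Tset /= !in_itv /= => /andP[h1 h2].
  by rewrite (le_trans a0 h1) (lt_le_trans h2 ar).
have hi : tint (\1_A : R -> R).
  apply: measurable_bounded_integrable => //; first exact: mu_Tset_lty.
  exists 1; split; [exact: num_real|move=> x cx y _ /=].
  by rewrite indicE; case: (y \in A); rewrite ?normr1 ?normr0; lra.
have iA : TRint (\1_A : R -> R) = r / (2 * pi).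
  have mA' : mu A = r%:E.
    by rewrite /A lebesgue_measure_itv /= lte_fin ltrDl r0 -EFinB [a + r]addrC addrK.
  rewrite /TRint /Rintegral integral_indic // (_ : fine _ = r) 1?mulrC //.
  by rewrite AT; exact: (congr1 fine mA').
rewrite -mulrA -iA -TRintZ //; apply: (le_TRint fZ) => //; first exact: tintZ.
move=> t Tt Zt; rewrite indicE; have [/set_mem At|] := boolP (t \in A); last first.
  by rewrite mulr0 f0.
rewrite mulr1; apply: fc => //; move: At; rewrite /A /= in_itv /= => /andP[-> /ltW ->].
by [].
Qed.

(** [f] vanishes almost everywhere; were its zeros in the interval finite in number, the interval
    would be null. Infinitely many zeros is exactly what [Qtrig_inj] and [ptrig_inj] ask for. *)
Lemma TRint_eq0_infinite f a b : tint f -> (forall t, T t -> 0 <= f t) -> TRint f = 0 ->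
  0 <= a -> a < b -> b <= 2 * pi -> infinite_set [set t | a < t < b /\ f t = 0].
Proof.
move=> hf f0 i0 a0 ab b2; set S := [set t | _] => fin.
have mf : measurable_fun T f by move/integrableP: hf => [/measurable_EFinP].
have e0 : (\int[mu]_(x in T) `|(f x)%:E|)%E = 0%E.
  have -> : (\int[mu]_(x in T) `|(f x)%:E|)%E = (\int[mu]_(x in T) (f x)%:E)%E.
    by apply: eq_integral => x /set_mem Tx; rewrite gee0_abs // lee_fin f0.
  have fn := integrable_fin_num measurable_Tset hf.
  have : Rintegral mu T f = 0.
    move/eqP: i0; rewrite /TRint mulf_eq0 invr_eq0 gt_eqF ?pi2_gt0 //= => /eqP.
    by [].
  by rewrite /Rintegral => h; rewrite -(fineK fn) [fine _]h.
have /ae_eq_integral_abs : (\int[mu]_(x in T) `|(EFin \o f) x|)%E = 0%E by [].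
move=> /(_ measurable_Tset); case.
  by apply/measurable_EFinP.
move=> N [mN N0 sub].
have [mF F0] := fin_null fin.
have sI : `]a, b[ `<=` N `|` S.
  move=> t; rewrite /= in_itv /= => tab.
  have [ft|ft] := eqVneq (f t) 0; [by right|left].
  apply: sub => /=; apply/not_implyP; split.
    by rewrite /Tset /= in_itv /=; move/andP: tab => [h1 h2]; apply/andP; split; lra.
  by move=> [] /eqP; rewrite (negPf ft).
have : (mu `]a, b[ <= mu (N `|` S))%E.
  by apply: le_measure => //; rewrite inE; [exact: measurable_itv|exact: measurableU].
rewrite measureU0 // N0 lebesgue_measure_itv /= lte_fin ab -EFinB lee_fin; lra.
Qed.

Lemma Tint_fin f : tint f -> Tint f = (TRint f)%:E.
Proof.
move=> hf; rewrite /Tint /TRint /Rintegral EFinM fineK //.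
exact: integrable_fin_num.
Qed.

(** The lower bound makes the negative part integrable over a set of finite measure, so only the
    positive part can diverge. *)
Lemma tint_dichotomy f Z B : finite_set Z -> measurable_fun T f ->
  (forall t, T t -> ~ Z t -> - B <= f t) -> tint f \/ Tint f = +oo%E.
Proof.
move=> fZ mf hB; have [mZ Z0] := fin_null fZ.
have mfe : measurable_fun T (EFin \o f) by apply/measurable_EFinP.
have i20 : (0 < ((2 * pi)^-1)%:E :> \bar R)%E by rewrite lte_fin invr_gt0 pi2_gt0.
have neg : (\int[mu]_(x in T) ((EFin \o f)^\- x) < +oo)%E.
  rewrite (ge0_negligible_integral mZ) //; last exact: measurable_funeneg.
  apply: (@le_lt_trans _ _ (\int[mu]_(x in T `\` Z) (cst (`|B|)%:E x))%E).
    apply: ge0_le_integral => //; first exact: measurableD.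
    - by apply: measurable_funS (measurable_funeneg mfe) => //; exact: subDsetl.
    - move=> x [Tx Zx]; rewrite funenegE /= ge_max; apply/andP; split; last by rewrite lee_fin.
      rewrite lee_fin; apply: le_trans (ler_norm B); have := hB _ Tx Zx; lra.
  rewrite integral_cst; last exact: measurableD.
  rewrite [X in (_ * X)%E](_ : _ = (2 * pi)%:E) ?ltry //.
  have TZ0 : mu (T `&` Z) = 0%E.
    apply/eqP; rewrite eq_le measure_ge0 andbT -Z0; apply: le_measure; rewrite ?inE //.
    exact: measurableI.
  have := @measureD _ _ _ mu T Z measurable_Tset mZ mu_Tset_lty.
  by rewrite -[X in (_ - X)%E]/(mu (T `&` Z)) TZ0 sube0 => ->; exact: mu_Tset.
have [pos|pos] := boolP ((\int[mu]_(x in T) ((EFin \o f)^\+ x) < +oo)%E).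
  left; apply/integrableP; split=> //.
  rewrite (_ : (\int[mu]_(x in T) `|(EFin \o f) x|)%E =
    (\int[mu]_(x in T) ((EFin \o f)^\+ x) + \int[mu]_(x in T) ((EFin \o f)^\- x))%E).
    exact: lte_add_pinfty.
  rewrite -ge0_integralD //; [|exact: measurable_funepos|exact: measurable_funeneg].
  by apply: eq_integral => x _; rewrite -[LHS]/((abse \o (EFin \o f)) x) fune_abse.
right; rewrite /Tint integralE.
have -> : (\int[mu]_(x in T) ((EFin \o f)^\+ x))%E = +oo%E.
  by apply/eqP; rewrite -leye_eq leNgt.
have : (0 <= \int[mu]_(x in T) ((EFin \o f)^\- x))%E by apply: integral_ge0.
move: neg; case: (\int[mu]_(x in T) _)%E => // r _ _.
by rewrite addye // gt0_muley.
Qed.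

Lemma tint_bounded f B : measurable_fun T f -> (forall t, T t -> `|f t| <= B) -> tint f.
Proof.
move=> mf hB; apply: measurable_bounded_integrable => //; first exact: mu_Tset_lty.
exists B; split; [exact: num_real|move=> x cx y Ty /=].
by apply: le_trans (hB _ Ty) _; exact: ltW.
Qed.

End IntegralOnCircle.

#[global] Hint Resolve measurable_Tset : core.
Notation tint f := ((@lebesgue_measure _).-integrable (@Tset _) (EFin \o f)).

(** * Measurability and lower bounds of the integrand *)

Section Measurability.
Variable R : realType.
Local Notation C := R[i].
Local Open Scope classical_set_scope.

Definition cmeas (f : R -> C) : Prop :=
  measurable_fun setT (fun t => complex.Re (f t)) /\
  measurable_fun setT (fun t => complex.Im (f t)).

Lemma cmeas_cst (c : C) : cmeas (fun=> c).
Proof. by split; exact: measurable_cst. Qed.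

Lemma cmeasD f g : cmeas f -> cmeas g -> cmeas (fun t => f t + g t).
Proof.
move=> [f1 f2] [g1 g2]; split.
  by under eq_fun do rewrite ReD; exact: measurable_funD.
rewrite (_ : (fun t => _) = (fun t => complex.Im (f t) + complex.Im (g t))).
  exact: measurable_funD.
by apply/funext => t; case: (f t); case: (g t).
Qed.

Lemma cmeasM f g : cmeas f -> cmeas g -> cmeas (fun t => f t * g t).
Proof.
move=> [f1 f2] [g1 g2]; split.
  rewrite (_ : (fun t => _) = (fun t => complex.Re (f t) * complex.Re (g t)
     - complex.Im (f t) * complex.Im (g t))).
    by apply: measurable_funB; exact: measurable_funM.
  by apply/funext => t; case: (f t); case: (g t).
rewrite (_ : (fun t => _) = (fun t => complex.Re (f t) * complex.Im (g t)
     + complex.Im (f t) * complex.Re (g t))).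
  by apply: measurable_funD; exact: measurable_funM.
by apply/funext => t; case: (f t); case: (g t).
Qed.

Lemma cmeas_sum I (s : seq I) (P : pred I) (F : I -> R -> C) :
  (forall i, cmeas (F i)) -> cmeas (fun t => \sum_(i <- s | P i) F i t).
Proof.
move=> h; elim: s => [|i s IH].
  by under eq_fun do rewrite big_nil; exact: cmeas_cst.
by under eq_fun do rewrite big_cons; case: (P i) => //; exact: cmeasD.
Qed.

Lemma cmeas_prod I (s : seq I) (P : pred I) (F : I -> R -> C) :
  (forall i, cmeas (F i)) -> cmeas (fun t => \prod_(i <- s | P i) F i t).
Proof.
move=> h; elim: s => [|i s IH].
  by under eq_fun do rewrite big_nil; exact: cmeas_cst.
by under eq_fun do rewrite big_cons; case: (P i) => //; exact: cmeasM.
Qed.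

Lemma cmeas_expi (a : R) : cmeas (fun t => expi (a * t)).
Proof.
have ma : measurable_fun setT (fun t : R => a * t) by exact: measurable_funM.
split; apply: measurableT_comp ma.
  by apply: continuous_measurable_fun; exact: continuous_cos.
by apply: continuous_measurable_fun; exact: continuous_sin.
Qed.

Lemma cmeas_strig n (a b : 'I_n.+1 -> R) : cmeas (strig a b).
Proof.
apply: cmeasD; first exact: cmeas_cst.
apply: cmeasM; first exact: cmeas_cst.
apply: cmeas_sum => k; apply: cmeasD; apply: cmeasM; try exact: cmeas_cst.
  by under eq_fun do rewrite -mulNr; exact: cmeas_expi.
exact: cmeas_expi.
Qed.

Variables m n : nat.
Implicit Types (Q : 'I_n.+1 -> 'M[R]_m) (p : 'I_n -> R).

Lemma measurable_rdet Q : measurable_fun setT (fun t => rdet (QT Q t)).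
Proof.
suff [] : cmeas (fun t => \det (QT Q t)) by [].
apply: cmeas_sum => s; apply: cmeasM; first exact: cmeas_cst.
by apply: cmeas_prod => i; under eq_fun do rewrite QtrigE; exact: cmeas_strig.
Qed.

Lemma measurable_pT p : measurable_fun setT (pT p).
Proof.
rewrite (_ : pT p = fun t => complex.Re (strig (pco p) (pco p) t)).
  by have [] := cmeas_strig (pco p) (pco p).
by apply/funext => t; exact: ptrig_Re.
Qed.

Lemma measurable_inv_ge0 (f : R -> R) : (forall t, 0 <= f t) ->
  measurable_fun setT f -> measurable_fun setT (fun t => (f t)^-1).
Proof.
move=> f0 mf; rewrite (_ : (fun t => _) = (@powR R ^~ (-1)) \o f).
  by apply: measurableT_comp => //; exact: measurable_powR.
by apply/funext => t /=; rewrite powR_inv1.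
Qed.

(** The conventions [invmx Q = Q] for singular [Q] and [0^-1 = 0] agree here, so the formula holds
    without positivity and yields measurability at all angles, the singular ones included. *)
Lemma Fint_hermE (x : R) (Q : 'M[C]_m) : hermitian Q ->
  Fint x Q = x * ln (x ^+ m * (rdet Q)^-1) - m%:R * x.
Proof.
by move=> hQ; rewrite /Fint detZ det_inv (herm_det hQ) rCX rCV -rCM.
Qed.

Lemma measurable_Fint p Q : (forall t, 0 <= pT p t) -> psdQ Q ->
  measurable_fun setT (fun t => Fint (pT p t) (QT Q t)).
Proof.
move=> p0 [sQ pQ]; have mp := measurable_pT p.
rewrite (_ : (fun t => _) = fun t => pT p t * ln (pT p t ^+ m * (rdet (QT Q t))^-1)
    - m%:R * pT p t); last by apply/funext => t; exact: Fint_hermE (proj1 (pQ t)).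
apply: measurable_funB; last by apply: measurable_funM => //; exact: measurable_cst.
apply: measurable_funM => //; apply: (measurableT_comp (@measurable_ln R)).
apply: measurable_funM; first exact: measurable_funX.
by apply: measurable_inv_ge0 (measurable_rdet Q) => t; exact: psd_rdet_ge0.
Qed.

(** At [p1 = 0] the right side is [0], and the left side is [- p2] times the trace of a product of
    semidefinite matrices. *)
Lemma Fint_tangent_ge0 (p1 p2 : R) (Q1 Q2 : 'M[C]_m) :
  0 <= p1 -> 0 < p2 -> herm_pd Q1 -> herm_pd Q2 ->
  Ftan p2 Q2 p1 Q1 <= Fint p1 Q1.
Proof.
rewrite le_eqVlt => /orP[/eqP<-|p10] p20 pQ1 pQ2; last by case: (Fint_tangent p10 p20 pQ1 pQ2).
rewrite /Ftan /Fint !mul0r mulr0 subr0 sub0r oppr_le0.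
by apply: mulr_ge0; [exact: ltW|exact: rtr_inv_psd_ge0 pQ2 (pd_psd pQ1)].
Qed.

(** The tangent at [(1, tau I)]. The parameter trades the two terms against each other: a large
    [tau] makes the loss in [Q] small at a logarithmic price in [p]. *)
Lemma Fint_lower (tau x : R) (Q : 'M[C]_m) : 0 < tau -> 0 <= x -> herm_pd Q ->
  - (m%:R * ln tau) * x - tau^-1 * rtr Q <= Fint x Q.
Proof.
move=> t0 x0 pQ; apply: le_trans (Fint_tangent_ge0 x0 ltr01 pQ (pd_scalar m t0)).
rewrite /Ftan; have -> : rdet ((rC tau)%:M : 'M[C]_m) = tau ^+ m.
  by rewrite -scalemx1 rdetZ /rdet det1 mulr1.
rewrite ln1 mulr0 mul1r sub0r lnXnR //.
have -> : invmx ((rC tau)%:M : 'M[C]_m) *m Q = rC tau^-1 *: Q.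
  by rewrite invmx_scalar rCV mul_scalar_mx.
by rewrite rtrZ mulrC.
Qed.

Lemma rtr_QT_le Q t : rtr (QT Q t) <= m%:R * (2 * nrm Q).
Proof.
rewrite /rtr /mxtrace Re_sum (_ : m%:R * _ = \sum_(i < m) 2 * nrm Q).
  apply: ler_sum => i _; apply: le_trans (ler_norm _) _; apply: le_trans (le_Re_normc _) _.
  by rewrite QtrigE; apply: le_trans (strig_bound _ _ _) (nab_entry _ _ _).
by rewrite sumr_const card_ord mulr_natl.
Qed.

End Measurability.

(** * The sparsity penalty and the linear functional *)

Section Penalty.
Variables (R : realType) (m n : nat).
Implicit Types (Q : 'I_n.+1 -> 'M[R]_m).

Lemma qjh_ub Q j h k : `|Q k j h| <= qjh Q j h /\ (k != ord0 -> `|Q k h j| <= qjh Q j h).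
Proof.
have e k' : k' != ord0 -> Num.max `|Q k' j h| `|Q k' h j| <= qjh Q j h.
  move=> k0; rewrite /qjh le_max; apply/orP; right.
  by rewrite (bigD1 k') //= le_max lexx.
split; last by move=> /e; rewrite ge_max => /andP[].
have [->|/e] := eqVneq k ord0; first by rewrite /qjh le_max lexx.
by rewrite ge_max => /andP[].
Qed.

Lemma qjh_lub Q j h x : 0 <= x -> (forall k, `|Q k j h| <= x) ->
  (forall k, `|Q k h j| <= x) -> qjh Q j h <= x.
Proof.
move=> x0 h1 h2; rewrite /qjh ge_max h1 /=; apply: (big_ind (fun y => y <= x)) => // [y z hy hz|k _].
  by rewrite ge_max hy hz.
by rewrite ge_max h1 h2.
Qed.

Lemma qjh_ge0 Q j h : 0 <= qjh Q j h.
Proof. exact: le_trans (normr_ge0 _) (proj1 (qjh_ub Q j h ord0)). Qed.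

Variable gamma : 'I_m -> 'I_m -> R.
Hypothesis hgamma : forall j h : 'I_m, (h <= j)%N -> 0 <= gamma j h.

Lemma hW_ge0 Q : 0 <= hW gamma Q.
Proof.
by apply: sumr_ge0 => j _; apply: sumr_ge0 => h hj; rewrite mulr_ge0 ?hgamma ?qjh_ge0.
Qed.

Lemma qjh_sub_sym Q j h k : (Q ord0)^T = Q ord0 -> `|Q k h j| <= qjh Q j h.
Proof.
move=> sQ; have [a b] := qjh_ub Q j h k; have [k0|/b//] := eqVneq k ord0.
by rewrite k0 -sQ mxE -k0.
Qed.

(** Convexity of a maximum of moduli, weighted by nonnegative [gamma]. Symmetry of [Q ord0] supplies
    the transposed entry of index [0] that [qjh_lub] asks for. *)
Lemma hW_comb (a b : R) Q Q' : 0 <= a -> 0 <= b ->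
  (Q ord0)^T = Q ord0 -> (Q' ord0)^T = Q' ord0 ->
  hW gamma (fun k => a *: Q k + b *: Q' k) <= a * hW gamma Q + b * hW gamma Q'.
Proof.
move=> a0 b0 sQ sQ'; rewrite /hW !mulr_sumr -big_split /=; apply: ler_sum => j _.
rewrite !mulr_sumr -big_split /=; apply: ler_sum => h hj.
rewrite mulrCA [b * _]mulrCA -mulrDr; apply: ler_wpM2l; first exact: hgamma.
have key k i l x y : `|Q k i l| <= x -> `|Q' k i l| <= y ->
    `|(a *: Q k + b *: Q' k) i l| <= a * x + b * y.
  move=> h1 h2; rewrite !mxE; apply: le_trans (ler_normD _ _) _.
  by rewrite !normrM (ger0_norm a0) (ger0_norm b0) lerD // ler_wpM2l.
apply: qjh_lub => [|k|k]; first by rewrite addr_ge0 // mulr_ge0 ?qjh_ge0.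
  by apply: key; [exact: (proj1 (qjh_ub Q j h k))|exact: (proj1 (qjh_ub Q' j h k))].
by apply: key; exact: qjh_sub_sym.
Qed.

Definition gsum : R := \sum_(j < m) \sum_(h < m | (h <= j)%N) gamma j h.

Lemma gsum_ge0 : 0 <= gsum.
Proof. by apply: sumr_ge0 => j _; apply: sumr_ge0 => h hj; exact: hgamma. Qed.

Lemma entry_le_nrm Q k i j : `|Q k i j| <= nrm Q.
Proof.
rewrite /nrm (bigD1 k) //= (bigD1 i) //= (bigD1 j) //= -!addrA lerDl.
by rewrite !addr_ge0 //; do 3?(apply: sumr_ge0 => ? _).
Qed.

Lemma hW_sub_le Q Q' x : 0 <= x -> (Q' ord0)^T = Q' ord0 ->
  (forall k i j, `|Q k i j - Q' k i j| <= x) -> hW gamma Q <= hW gamma Q' + gsum * x.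
Proof.
move=> x0 sQ' h; rewrite /hW /gsum mulr_suml -big_split /=; apply: ler_sum => j _.
rewrite mulr_suml -big_split /=; apply: ler_sum => i hi.
rewrite -mulrDr; apply: ler_wpM2l; first exact: hgamma.
have key k a b : `|Q' k a b| <= qjh Q' j i -> `|Q k a b| <= qjh Q' j i + x.
  move=> h1; have := h k a b; have := ler_normD (Q k a b - Q' k a b) (Q' k a b).
  by rewrite subrK; move: (`|_|) (`|_|) (`|_|) h1 => u v w; lra.
apply: qjh_lub => [|k|k]; first by rewrite addr_ge0 ?qjh_ge0.
  by apply: key; exact: (proj1 (qjh_ub Q' j i k)).
by apply: key; exact: qjh_sub_sym.
Qed.

Variable Rk : 'I_n.+1 -> 'M[R]_m.

Definition Lf Q : R := \sum_(k < n.+1) \tr ((Q k)^T *m Rk k).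

Lemma LfE Q : Lf Q = \sum_k \sum_i \sum_j Q k i j * Rk k i j.
Proof.
apply: eq_bigr => k _; rewrite /mxtrace exchange_big /=; apply: eq_bigr => j _.
by rewrite mxE; apply: eq_bigr => i _; rewrite mxE.
Qed.

Lemma LfD Q Q' : Lf (fun k => Q k + Q' k) = Lf Q + Lf Q'.
Proof.
rewrite /Lf -big_split /=; apply: eq_bigr => k _.
by rewrite linearD /= mulmxDl mxtraceD.
Qed.

Lemma LfZ a Q : Lf (fun k => a *: Q k) = a * Lf Q.
Proof.
rewrite /Lf mulr_sumr; apply: eq_bigr => k _.
by rewrite linearZ /= -scalemxAl mxtraceZ.
Qed.

Lemma Lf_le Q x : 0 <= x -> (forall k i j, `|Q k i j| <= x) -> `|Lf Q| <= x * nrm Rk.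
Proof.
move=> x0 h; rewrite LfE /nrm mulr_sumr; apply: le_trans (ler_norm_sum _ _ _) _.
apply: ler_sum => k _; rewrite mulr_sumr; apply: le_trans (ler_norm_sum _ _ _) _.
apply: ler_sum => i _; rewrite mulr_sumr; apply: le_trans (ler_norm_sum _ _ _) _.
by apply: ler_sum => j _; rewrite normrM ler_wpM2r.
Qed.

End Penalty.

(** * Minima of Lipschitz functions on compact sets of coefficients *)

Section LipschitzMin.
Import ArrowAsProduct.
Local Open Scope classical_set_scope.

(** The hypotheses are coordinatewise estimates, so that no topology appears in the two uses: the
    coercivity constant and the minimizer. Compactness is Tychonoff for a box, and exchanging [x]
    and [y] makes the Lipschitz bound two-sided. *)
Lemma lipschitz_min (R : realType) (I : finType) (K : set (I -> R)) (F : (I -> R) -> R)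
    (M Cl : R) : K !=set0 -> 0 < Cl ->
  (forall x, K x -> forall i, `|x i| <= M) ->
  (forall x, (forall e, 0 < e -> exists2 y, K y & forall i, `|x i - y i| < e) -> K x) ->
  (forall x y e, K x -> K y -> 0 <= e -> (forall i, `|x i - y i| <= e) ->
     F x - F y <= Cl * e) ->
  exists2 x, K x & forall y, K y -> F x <= F y.
Proof.
move=> K0 C0 bK cK lF.
have near_ball (x : I -> R) (e : R) : 0 < e ->
    nbhs x [set y : I -> R | forall i, `|x i - y i| < e].
  move=> e0; have h i : nbhs x [set y : I -> R | `|x i - y i| < e].
    have : nbhs (x i) (ball (x i) e) by exact: nbhsx_ballx.
    by move/(@proj_continuous I (fun=> R) i x).
  exact: (@filter_forall (I -> R) I (fun i y => `|x i - y i| < e) (nbhs x) (nbhs_filter x) h).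
have cB : compact [set f : I -> R | forall i, (`[- M, M]%classic : set R) (f i)].
  exact: (@tychonoff I (fun=> R) (fun=> `[- M, M]%classic) (fun i => @segment_compact R (- M) M)).
have cpK : compact K.
  apply: (subclosed_compact _ cB); last first.
    by move=> x Kx i /=; rewrite in_itv /= -ler_norml; exact: bK.
  move=> x clx; apply: cK => e e0.
  by have [y [Ky hy]] := clx _ (near_ball x e e0); exists y.
have [//|x /set_mem Kx h] := @compact_EVT_min (I -> R) R F K K0 cpK.
  apply/subspace_continuousP => x Kx; apply/cvgrPdist_le => e e0.
  have d0 : 0 < e / Cl by rewrite divr_gt0.
  rewrite near_withinE; apply: (@filterS _ _ (nbhs_filter x) _ _ _ (near_ball x _ d0)).
  move=> y /= hy Ky.
  have h1 : F x - F y <= Cl * (e / Cl) by apply: lF => //; [exact: ltW|move=> i; exact: ltW].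
  have h2 : F y - F x <= Cl * (e / Cl).
    by apply: lF => //; [exact: ltW|move=> i; rewrite distrC; exact: ltW].
  rewrite mulrC divfK ?gt_eqF // in h1 h2.
  by rewrite ler_norml h1 andbT lerNl opprB.
by exists x => // y Ky; apply: h; exact/mem_set.
Qed.

End LipschitzMin.

(** * The moment functional and its coercivity *)

Section Moments.
Variables (R : realType) (m n : nat).
Local Notation C := R[i].
Implicit Types (Q : 'I_n.+1 -> 'M[R]_m).

Lemma ReM (x y : C) :
  complex.Re (x * y) = complex.Re x * complex.Re y - complex.Im x * complex.Im y.
Proof. by case: x; case: y. Qed.

Lemma nrm_le Q (e : R) : (forall k i j, `|Q k i j| <= e) ->
  nrm Q <= n.+1%:R * (m%:R * m%:R) * e.
Proof.
move=> h; rewrite (_ : _ * e = \sum_(k < n.+1) \sum_(i < m) \sum_(j < m) e); last first.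
  by rewrite !sumr_const !card_ord -!mulrnA -[RHS]mulr_natl !natrM; ring.
by do 3![apply: ler_sum => ? _].
Qed.

Lemma nrmB_le Q Q' (e : R) : (forall k i j, `|Q k i j - Q' k i j| <= e) ->
  nrm Q <= nrm Q' + n.+1%:R * (m%:R * m%:R) * e.
Proof.
move=> h; rewrite -lerBlDl; apply: (@le_trans _ _ (nrm (fun k => Q k - Q' k))); last first.
  by apply: nrm_le => k i j; rewrite !mxE.
rewrite lerBlDl /nrm -big_split /=; apply: ler_sum => k _.
rewrite -big_split /=; apply: ler_sum => i _.
rewrite -big_split /=; apply: ler_sum => j _.
by rewrite !mxE -[leLHS](congr1 Num.norm (subrKC (Q' k i j) _)) ler_normD.
Qed.

Lemma nrm_gt0 Q : ~ (forall k, Q k = 0) -> 0 < nrm Q.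
Proof.
move=> h; rewrite lt_def nrm_ge0 andbT; apply/eqP => n0; apply: h => k.
apply/matrixP => i j; rewrite mxE; apply/eqP; rewrite -normr_le0 -n0.
exact: entry_le_nrm.
Qed.

Lemma nrmZ (a : R) Q : nrm (fun k => a *: Q k) = `|a| * nrm Q.
Proof.
rewrite /nrm mulr_sumr; apply: eq_bigr => k _; rewrite mulr_sumr; apply: eq_bigr => i _.
by rewrite mulr_sumr; apply: eq_bigr => j _; rewrite mxE normrM.
Qed.

Lemma psdQ_Z (a : R) Q : 0 <= a -> psdQ Q -> psdQ (fun k => a *: Q k).
Proof.
move=> a0 [sQ pQ]; have s : (a *: Q ord0)^T = a *: Q ord0 by rewrite linearZ /= sQ.
split; [exact: s|move=> t]; apply/psdP; split; first exact: Qtrig_herm s.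
by move=> v; rewrite QtrigZ qfZ mulr_ge0 //; case/psdP: (pQ t).
Qed.

Lemma psdQ_D Q Q' : psdQ Q -> psdQ Q' -> psdQ (fun k => Q k + Q' k).
Proof.
move=> [sQ pQ] [sQ' pQ']; have s : (Q ord0 + Q' ord0)^T = Q ord0 + Q' ord0.
  by rewrite linearD /= sQ sQ'.
split; [exact: s|move=> t]; apply/psdP; split; first exact: Qtrig_herm s.
by move=> v; rewrite QtrigD qfD addr_ge0 //; [case/psdP: (pQ t)|case/psdP: (pQ' t)].
Qed.

Lemma Qsh_sym (s : R) Q : (Q ord0)^T = Q ord0 -> (Qsh s Q ord0)^T = Qsh s Q ord0.
Proof. by move=> sQ; rewrite /Qsh /Qid eqxx linearD /= sQ tr_scalar_mx. Qed.

Lemma Qsh_pd (s : R) Q t : 0 < s -> psdQ Q -> herm_pd (QT (Qsh s Q) t).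
Proof. by move=> s0 [_ pQ]; rewrite Qtrig_sh; apply: pd_addr => //; exact: pd_scalar. Qed.

Lemma Qsh_Bm (s : R) Q : 0 < s -> psdQ Q -> Bm (Qsh s Q).
Proof.
by move=> s0 pQ; split; [exact: Qsh_sym (proj1 pQ)|move=> t _; rewrite -QTE; exact: Qsh_pd].
Qed.

Lemma Qsh_entry (s : R) Q k i j : 0 <= s -> `|Qsh s Q k i j - Q k i j| <= s.
Proof.
move=> s0; rewrite /Qsh /Qid mxE [_ + _ - _]addrC addKr.
case: (k == ord0); rewrite !mxE ?normr0 //.
by case: (i == j); rewrite ?mulr1n ?mulr0n ?normr0 // ger0_norm.
Qed.

(** Shifting a semidefinite approximant by [e / 2] times the identity makes it definite, which
    reduces the claim to [Bm_clos_psd]. *)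
Lemma psdQ_lim Q :
  (forall e, 0 < e -> exists2 Q', psdQ Q' & forall k i j, `|Q k i j - Q' k i j| < e) -> psdQ Q.
Proof.
move=> h; apply: Bm_clos_psd => e e0.
have e2 : 0 < e / 2 by lra.
have [Q' pQ' hQ'] := h _ e2; exists (Qsh (e / 2) Q'); split; first exact: Qsh_Bm.
move=> k i j; have := hQ' k i j; have := Qsh_entry Q' k i j (ltW e2); rewrite distrC.
have := ler_normD (Q k i j - Q' k i j) (Q' k i j - Qsh (e / 2) Q' k i j).
by rewrite addrA subrK; move: (`|_|) (`|_|) (`|_|) => x y z; lra.
Qed.

Variable Phi : R -> 'M[C]_m.
Hypothesis dPhi : psd_density Phi.
Variable Rk : 'I_n.+1 -> 'M[R]_m.
Hypothesis mPhi : moments Phi Rk.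

Let g (k : 'I_n.+1) (i j : 'I_m) (t : R) := complex.Re (Phi t i j * expi (k%:R * t)).

Lemma tint_moment k i j : tint (g k i j).
Proof.
have [h _] := dPhi; have [hr hi] := h i j.
have [c1 c2] := cmeas_expi (k%:R : R).
have bd (f : R -> R) : (forall t, `|f t| <= 1) -> [bounded f x | x in (@Tset R)]%classic.
  by move=> hf; exists 1; split; [exact: num_real|move=> x cx y _ /=; apply: le_trans (hf y) (ltW cx)].
have i1 : tint (fun t => complex.Re (expi (k%:R * t)) * complex.Re (Phi t i j)).
  have := integrableMr (@measurable_Tset R) (measurable_funTS c1) (bd _ (fun t => cos_max (k%:R * t))) hr.
  by apply: eq_integrable.
have i2 : tint (fun t => complex.Im (expi (k%:R * t)) * complex.Im (Phi t i j)).
  have := integrableMr (@measurable_Tset R) (measurable_funTS c2) (bd _ (fun t => sin_max (k%:R * t))) hi.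
  by apply: eq_integrable.
apply: eq_integrable (tintB i1 i2) => // t _ /=; congr (_%:E).
by rewrite /g ReM [complex.Re (Phi t i j) * _]mulrC [complex.Im (Phi t i j) * _]mulrC.
Qed.

Lemma conj_moment (k : 'I_n.+1) i j t : hermitian (Phi t) ->
  complex.Re (expi (- (k%:R * t)) * Phi t j i) = g k i j t.
Proof.
move=> hP; have -> : Phi t j i = conjc (Phi t i j) by rewrite -{1}hP !mxE.
rewrite /g expiN -conjcM mulrC; by case: (_ * _).
Qed.

(* Hermitian symmetry of Phi identifies the e^{-ikt} terms with the e^{ikt} ones. *)
Lemma rtr_moment Q t : (Q ord0)^T = Q ord0 -> hermitian (Phi t) ->
  rtr (QT Q t *m Phi t) = \sum_k \sum_i \sum_j Q k i j * g k i j t.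
Proof.
move=> sQ hP.
have E : rtr (QT Q t *m Phi t) = \sum_i \sum_j (Q ord0 i j * g ord0 i j t +
   2^-1 * \sum_(k < n.+1 | k != ord0) (Q k i j * g k i j t + Q k j i * g k j i t)).
  rewrite /rtr /mxtrace Re_sum; apply: eq_bigr => i _.
  rewrite mxE Re_sum; apply: eq_bigr => j _.
  rewrite QtrigE /strig mulrDl ReD ReM_rC; congr (_ + _).
    by rewrite -(conj_moment ord0) // mul0r oppr0 expi0 mul1r.
  rewrite -mulrA ReM_rC; congr (_ * _); rewrite mulr_suml Re_sum.
  apply: eq_bigr => k _; rewrite mulrDl ReD; congr (_ + _).
    by rewrite mulrAC mulrC ReM_rC conj_moment.
  by rewrite mulrAC mulrC ReM_rC /g [expi _ * _]mulrC.
rewrite E; under eq_bigr do rewrite big_split /=.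
rewrite big_split /= [RHS](bigD1 ord0) //=; congr (_ + _).
under eq_bigr do rewrite -mulr_sumr exchange_big /=.
rewrite -mulr_sumr exchange_big /= mulr_sumr; apply: eq_bigr => k _.
under eq_bigr do rewrite big_split /=.
rewrite big_split /= [X in _ + X]exchange_big /=.
by field.
Qed.

Lemma Lf_TRint Q : (Q ord0)^T = Q ord0 ->
  tint (fun t => rtr (QT Q t *m Phi t)) /\
  Lf Rk Q = TRint (fun t => rtr (QT Q t *m Phi t)).
Proof.
move=> sQ; have [_ pP] := dPhi.
have ti : tint (fun t => \sum_k \sum_i \sum_j Q k i j * g k i j t).
  do 3![apply: tint_sum => ?]; apply: tintZ; exact: tint_moment.
have e t : Tset t -> rtr (QT Q t *m Phi t) = \sum_k \sum_i \sum_j Q k i j * g k i j t.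
  by move=> Tt; apply: rtr_moment => //; case: (pP _ Tt).
split; first by apply: eq_integrable ti => // t /set_mem Tt /=; rewrite e.
rewrite (_ : TRint _ = TRint (fun t => \sum_k \sum_i \sum_j Q k i j * g k i j t)).
  rewrite LfE TRint_sum; last first.
    by move=> k; do 2![apply: tint_sum => ?]; apply: tintZ; exact: tint_moment.
  apply: eq_bigr => k _; rewrite TRint_sum; last first.
    by move=> i; apply: tint_sum => ?; apply: tintZ; exact: tint_moment.
  apply: eq_bigr => i _; rewrite TRint_sum; last first.
    by move=> j; apply: tintZ; exact: tint_moment.
  apply: eq_bigr => j _; rewrite TRintZ; last exact: tint_moment.
  by have [<- _] := mPhi k i j.
by congr (_ * _); apply: eq_Rintegral => t /set_mem Tt; exact: e.
Qed.

Lemma Lf_ge0 Q : psdQ Q -> 0 <= Lf Rk Q.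
Proof.
move=> [sQ pQ]; have [ti ->] := Lf_TRint sQ.
rewrite -(TRint_cst 0); apply: (le_TRint (@finite_set0 R)) => //; first exact: tint_cst.
by move=> t Tt _; apply: rtr_psd_mul_ge0 => //; case: dPhi => _; apply.
Qed.

Hypothesis oPhi : pd_on_open_interval Phi.

(** If the integral of the nonnegative [tr (Q Phi)] were zero, the trace would vanish at infinitely
    many angles where [Phi] is definite; there [Q] itself vanishes, hence all its coefficients
    do. *)
Lemma Lf_gt0 Q : psdQ Q -> ~ (forall k, Q k = 0) -> 0 < Lf Rk Q.
Proof.
move=> pQ nQ; rewrite lt_def Lf_ge0 // andbT; apply/eqP => L0; apply: nQ.
have [ti E] := Lf_TRint (proj1 pQ); have [a [b [a0 [ab [b2 pP]]]]] := oPhi.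
have inf := @TRint_eq0_infinite R (fun t => rtr (QT Q t *m Phi t)) a b ti _ _ a0 ab b2.
apply: Qtrig_inj => fin; apply: inf => [t Tt||].
- by apply: rtr_psd_mul_ge0; [exact: (proj2 pQ)|case: dPhi => _; apply].
- by rewrite -E.
apply: sub_finite_set fin => t [/= tab rt0]; split.
  by rewrite /Tset /= in_itv /=; move/andP: tab => [h1 h2]; apply/andP; split; lra.
by apply: rtr_psd_mul_eq0 rt0; [exact: (proj2 pQ)|exact: pP].
Qed.

(** The constant is the minimum of the functional on the compact slice [nrm = 1] of the cone,
    positive by [Lf_gt0]; homogeneity does the rest. *)
Lemma Lf_coercive : exists2 eps : R, 0 < eps & forall Q, psdQ Q -> eps * nrm Q <= Lf Rk Q.
Proof.
pose dec (x : 'I_n.+1 * 'I_m * 'I_m -> R) (k : 'I_n.+1) : 'M[R]_m :=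
  \matrix_(i, j) x (k, i, j).
pose K := [set x | psdQ (dec x) /\ nrm (dec x) = 1]%classic.
have decE Q : dec (fun kij => ((nrm Q)^-1 *: Q kij.1.1) kij.1.2 kij.2) =
    fun k => (nrm Q)^-1 *: Q k.
  by apply/funext => k; apply/matrixP => i j; rewrite mxE.
have scale Q : psdQ Q -> ~ (forall k, Q k = 0) ->
    K (fun kij => ((nrm Q)^-1 *: Q kij.1.1) kij.1.2 kij.2).
  move=> pQ nQ; have n0 := nrm_gt0 nQ.
  rewrite /K /mkset decE nrmZ; split; first by apply: psdQ_Z => //; rewrite invr_ge0 ltW.
  by rewrite gtr0_norm ?invr_gt0 // mulVf // gt_eqF.
(* An empty slice means that the cone contains only [0], and then any positive constant serves. *)
have [[x0 Kx0]|K0] := pselect (K !=set0)%classic; last first.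
  exists 1 => // Q pQ; have [Q0|Q0] := pselect (forall k, Q k = 0).
    have -> : nrm Q = 0 by rewrite /nrm big1 // => k _; rewrite big1 // => i _; rewrite big1 // => j _; rewrite Q0 mxE normr0.
    by rewrite mulr0 Lf_ge0.
  by exfalso; apply: K0; eexists; exact: scale Q0.
have N0 : 0 <= (n.+1%:R * (m%:R * m%:R) : R) by rewrite !mulr_ge0.
have [|||x Kx h] := @lipschitz_min R _ K (fun x => Lf Rk (dec x)) 1 (nrm Rk + 1)
  (ex_intro _ x0 Kx0) (ltr_wpDl (nrm_ge0 _) ltr01).
- move=> x [_ <-] [[k i] j]; have := entry_le_nrm (dec x) k i j.
  by rewrite mxE.
- move=> x hx; have lim e : 0 < e -> exists2 Q', psdQ Q' /\ nrm Q' = 1 &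
      forall k i j, `|dec x k i j - Q' k i j| < e.
    move=> /hx[y Ky hy]; exists (dec y) => // k i j; rewrite !mxE; exact: hy.
  split; first by apply: psdQ_lim => e /lim[Q' [pQ' _] hQ']; exists Q'.
  apply/eqP; rewrite eq_le; apply/andP; split.
    rewrite -subr_ge0; apply: (lim_ge0 N0) => e /lim[Q' [_ nQ'] hQ'].
    have := @nrmB_le (dec x) Q' e (fun k i j => ltW (hQ' k i j)); rewrite nQ'; lra.
  rewrite -subr_ge0; apply: (lim_ge0 N0) => e /lim[Q' [_ nQ'] hQ'].
  have := @nrmB_le Q' (dec x) e; rewrite nQ' => h'; suff : 1 <= nrm (dec x) + n.+1%:R * (m%:R * m%:R) * e by lra.
  by apply: h' => k i j; rewrite distrC ltW.
- move=> x y e _ _ e0 hxy.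
  have -> : Lf Rk (dec x) - Lf Rk (dec y) = Lf Rk (fun k => dec x k + (-1) *: dec y k).
    by rewrite LfD LfZ mulN1r.
  apply: le_trans (ler_norm _) _.
  apply: (@le_trans _ _ (e * nrm Rk)); last by rewrite mulrDl mul1r mulrC lerDl.
  by apply: Lf_le => // k i j; rewrite !mxE mulN1r; exact: hxy.
have Lx : 0 < Lf Rk (dec x).
  apply: Lf_gt0; first by case: Kx.
  move=> d0; case: Kx => _ /eqP; rewrite /nrm big1 1?eq_sym ?oner_eq0 // => k _.
  by rewrite big1 // => i _; rewrite big1 // => j _; rewrite d0 mxE normr0.
exists (Lf Rk (dec x)) => // Q pQ; have [Q0|Q0] := pselect (forall k, Q k = 0).
  have -> : nrm Q = 0 by rewrite /nrm big1 // => k _; rewrite big1 // => i _; rewrite big1 // => j _; rewrite Q0 mxE normr0.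
  by rewrite mulr0 Lf_ge0.
have n0 := nrm_gt0 Q0; have := h _ (scale _ pQ Q0).
by rewrite decE LfZ mulrC ler_pdivlMr.
Qed.

End Moments.

(** * The objective and its barriers *)

Lemma qf_second_diff_le (R : realType) m n (Q : 'I_n.+1 -> 'M[R]_m) v (B x h : R) :
  nrm Q <= B -> vnorm2 v = 1 ->
  qf (QT Q (x + h)) v + qf (QT Q (x - h)) v - 2 * qf (QT Q x) v
    <= n%:R ^+ 2 * (2 * B) * m%:R * h ^+ 2.
Proof.
move=> nB v1; apply: le_trans (qf_second_diff Q v x h) _; rewrite v1 mulr1 exprMn.
move: (nrm Q) nB => N nB.
have e2 : n%:R ^+ 2 * h ^+ 2 * m%:R * (2 * N) <= n%:R ^+ 2 * h ^+ 2 * m%:R * (2 * B).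
  apply: ler_wpM2l; last by rewrite ler_pM2l.
  by apply: mulr_ge0 => //; apply: mulr_ge0; exact: sqr_ge0.
by apply: le_trans (le_trans _ e2) _; rewrite le_eqVlt; apply/orP; left; apply/eqP; ring.
Qed.

Section Problem.
Variables (R : realType) (m n N : nat) (alpha lam : R).
Hypotheses (hN : (0 < N)%N) (halpha : 0 < alpha) (hlam : 0 < lam).
Variable gamma : 'I_m -> 'I_m -> R.
Hypothesis hgamma : forall j h : 'I_m, (h <= j)%N -> 0 <= gamma j h.
Variables (Rk : 'I_n.+1 -> 'M[R]_m) (c : 'I_n.+1 -> R) (eps : R).
Hypothesis eps0 : 0 < eps.
Hypothesis Lcoer : forall Q, psdQ Q -> eps * nrm Q <= Lf Rk Q.
Implicit Types (p : 'I_n -> R) (Q : 'I_n.+1 -> 'M[R]_m).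

Local Notation obj p Q := (objective N alpha lam gamma Rk c p Q).

Definition kap : R := 2 * alpha / N%:R.
Definition kmu : R := kap * lam.

Lemma kap_gt0 : 0 < kap.
Proof. by rewrite /kap divr_gt0 ?ltr0n // mulr_gt0. Qed.

Lemma kmu_gt0 : 0 < kmu.
Proof. by rewrite mulr_gt0 // kap_gt0. Qed.

Definition cl p : R := c ord0 + \sum_(i < n) p i * c (lift ord0 i).
Definition lin p Q : R := Lf Rk Q - cl p + kap * hW gamma Q.
(** Real-valued twin of the objective, with the penalty on [p] merged into the integrand; the two
    agree once both integrands are integrable ([objective_fin]). *)
Definition robj p Q : R := TRint (fun t => Hint kmu (pT p t) (QT Q t)) + lin p Q.

Let Fi p Q t := Fint (pT p t) (QT Q t).
Let Ip p t := (pT p t)^-1.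

Lemma TRint_Hint p Q : tint (Fi p Q) -> tint (Ip p) ->
  tint (fun t => Hint kmu (pT p t) (QT Q t)) /\
  TRint (fun t => Hint kmu (pT p t) (QT Q t)) = TRint (Fi p Q) + kmu * TRint (Ip p).
Proof.
move=> hF hI; have hI' := tintZ kmu hI; split; first exact: tintD hF hI'.
by rewrite [LHS](TRintD hF hI') TRintZ.
Qed.

Lemma robjE p Q : tint (Fi p Q) -> tint (Ip p) ->
  robj p Q = TRint (Fi p Q) + kmu * TRint (Ip p) + lin p Q.
Proof. by move=> hF hI; rewrite /robj; have [_ ->] := TRint_Hint hF hI. Qed.

Lemma objectiveE p Q : obj p Q =
  (Tint (Fi p Q) + (Lf Rk Q - cl p)%:E
   + kap%:E * (lam%:E * Tint (Ip p) + (hW gamma Q)%:E))%E.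
Proof.
rewrite /objective /Jfun /glam; congr (Tint _ + _ + _ * (_ * Tint _ + _))%E.
  by apply/funext => t; rewrite /Fi pTE QTE.
by apply/funext => t; rewrite /Ip pTE.
Qed.

Lemma objective_fin p Q : tint (Fi p Q) -> tint (Ip p) -> obj p Q = (robj p Q)%:E.
Proof.
move=> hF hI; rewrite objectiveE !Tint_fin // -!(EFinM, EFinD) /robj.
have [_ ->] := TRint_Hint hF hI; congr EFin; rewrite /lin /kmu.
by move: (TRint _) (TRint _) => x y; ring.
Qed.

(** Pointwise form of the two constraints, at all real angles; by [adm_pd] the matrix is positive
    definite at every other angle of [Tset]. *)
Definition adm p Q : Prop := [/\ forall t, 0 <= pT p t, psdQ Q &
  finite_set [set t | Tset t /\ \det (QT Q t) = 0]%classic].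

Lemma adm_pd p Q t : adm p Q -> Tset t ->
  ~ [set t | Tset t /\ \det (QT Q t) = 0]%classic t -> herm_pd (QT Q t).
Proof.
move=> [_ [_ pQ] _] Tt nZ; apply: psd_det_pd => //; apply/eqP => d0; exact: nZ.
Qed.

(** Both integrands are bounded below off a finite set, so each integral is finite or [+oo], and no
    difference of infinities arises. *)
Lemma objective_cases p Q : adm p Q ->
  obj p Q = +oo%E \/ [/\ tint (Fi p Q), tint (Ip p) & obj p Q = (robj p Q)%:E].
Proof.
move=> aQ; have [p0 pQ fZ] := aQ.
have mF : measurable_fun (@Tset R) (Fi p Q) by apply: measurable_funTS; exact: measurable_Fint.
have mI : measurable_fun (@Tset R) (Ip p).
  by apply: measurable_funTS; apply: measurable_inv_ge0 => //; exact: measurable_pT.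
have cF : tint (Fi p Q) \/ Tint (Fi p Q) = +oo%E.
  apply: (@tint_dichotomy R (Fi p Q) _ (m%:R * (2 * nrm Q)) fZ mF) => t Tt nZ.
  have := Fint_lower ltr01 (p0 t) (adm_pd aQ Tt nZ); have := rtr_QT_le Q t.
  rewrite ln1 mulr0 oppr0 mul0r invr1 mul1r sub0r /Fi.
  by move: (rtr _) (Fint _ _) (m%:R * _) => x y z; lra.
have [hI|hI] : tint (Ip p) \/ Tint (Ip p) = +oo%E.
- apply: (@tint_dichotomy R (Ip p) set0 0) => // t _ _.
  by rewrite oppr0 invr_ge0.
- have [hF|hF] := cF; first by right; split=> //; exact: objective_fin.
  left; rewrite objectiveE hF (Tint_fin hI) -!(EFinM, EFinD) /=.
  by rewrite !addye.
left; rewrite objectiveE hI gt0_muley ?lte_fin // addye // gt0_muley ?lte_fin ?kap_gt0 //.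
by rewrite addey //; have [hF|->] := cF; rewrite ?addye // (Tint_fin hF) -EFinD.
Qed.

Definition Pmax : R := 4 * n.+1%:R.
(** [tr Q] is at most [2 m nrm Q] and [eps / 2 * tau0 = eps / 2 + 2 m], so the trace term of
    [Fint_lower] costs at most half of the coercivity of [Lf]. The summand [1] keeps [ln tau0]
    nonnegative. *)
Definition tau0 : R := 1 + 4 * m%:R / eps.
(** Bounds the terms in [p] alone, by [p <= Pmax] and [|p_i| <= 2]. *)
Definition C1 : R := m%:R * ln tau0 * Pmax + (`|c ord0| + 2 * \sum_(i < n) `|c (lift ord0 i)|).

Lemma pT_le p t : (forall t, 0 <= pT p t) -> pT p t <= Pmax.
Proof. exact: ptrig_le. Qed.

Lemma p_coef_le p i : (forall t, 0 <= pT p t) -> `|p i| <= 2.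
Proof. by move=> /(pco_le (lift ord0 i)); rewrite /pco liftK. Qed.

Lemma tau0_ge1 : 1 <= tau0.
Proof. by rewrite /tau0 lerDl mulr_ge0 ?invr_ge0 ?mulr_ge0 // ltW. Qed.

Lemma robj_lower p Q : adm p Q -> tint (Fi p Q) -> tint (Ip p) ->
  eps / 2 * nrm Q + kmu * TRint (Ip p) - C1 <= robj p Q.
Proof.
move=> aQ hF hI; have [p0 pQ fZ] := aQ; have [_ E] := TRint_Hint hF hI.
have t1 := tau0_ge1; have t0 : 0 < tau0 by lra.
have l0 : 0 <= m%:R * ln tau0 by rewrite mulr_ge0 // ln_ge0.
have h1 : - (m%:R * ln tau0 * Pmax + eps / 2 * nrm Q) <= TRint (Fi p Q).
  rewrite -(TRint_cst (- _)); apply: (le_TRint fZ) => //; first exact: tint_cst.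
  move=> t Tt nZ; have := Fint_lower t0 (p0 t) (adm_pd aQ Tt nZ).
  have h2 : m%:R * ln tau0 * pT p t <= m%:R * ln tau0 * Pmax by rewrite ler_wpM2l // pT_le.
  have h3 : tau0^-1 * rtr (QT Q t) <= eps / 2 * nrm Q.
    rewrite mulrC ler_pdivrMr //; apply: le_trans (rtr_QT_le Q t) _.
    rewrite /tau0 (_ : eps / 2 * nrm Q * _ = eps / 2 * nrm Q + m%:R * (2 * nrm Q)).
      by rewrite lerDr mulr_ge0 ?nrm_ge0 // divr_ge0 // ltW.
    by field; rewrite gt_eqF.
  rewrite mulNr /Fi; move: h2 h3; move: (_ * pT p t) (_ * Pmax) (_ * rtr _) (_ * nrm Q) (Fint _ _).
  by move=> x1 x2 x3 x4 x5; lra.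
have h4 : cl p <= `|c ord0| + 2 * \sum_(i < n) `|c (lift ord0 i)|.
  apply: lerD; first exact: ler_norm.
  rewrite mulr_sumr; apply: ler_sum => i _; apply: le_trans (ler_norm _) _.
  by rewrite normrM ler_wpM2r // p_coef_le.
have h5 := Lcoer pQ; have h6 := mulr_ge0 (ltW kap_gt0) (hW_ge0 hgamma Q).
have h7 : eps * nrm Q = eps / 2 * nrm Q + eps / 2 * nrm Q by field.
rewrite /robj E /lin /C1; move: h1 h4 h5 h6; rewrite h7.
move: (eps / 2 * nrm Q) (kmu * _) (TRint _) (Lf _ _) (kap * _) (cl p) (_ * Pmax) => a1 a2 a3 a4 a5 a6 a7.
by move: (`|_| + _) => a8; lra.
Qed.

Definition Kp : R := n%:R ^+ 2 * Pmax.

Lemma Pmax_gt0 : 0 < Pmax.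
Proof. by rewrite mulr_gt0 // ltr0n. Qed.

Lemma Kp_ge0 : 0 <= Kp.
Proof. by rewrite mulr_ge0 ?sqr_ge0 // ltW // Pmax_gt0. Qed.

Lemma pT_zeros p : finite_set [set t | Tset t /\ pT p t = 0]%classic.
Proof.
have [h|h] := tp_zeros (tp_strig (pco p) (pco p)).
  have := @strig_eq0 R n (pco p) (pco p) h ord0; rewrite /pco unlift_none => /eqP.
  by rewrite oner_eq0.
apply: sub_finite_set h => t [Tt /= h0]; split=> //.
by rewrite -ptrigE h0.
Qed.

(* If p dips to r^2 then p <= (Kp + 2) r^2 on an interval of length r, where 1/p is large. *)
Lemma p_barrier (M : R) : exists2 d : R, 0 < d <= 1 &
  forall p, (forall t, 0 <= pT p t) -> tint (Ip p) -> TRint (Ip p) <= M ->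
    forall t, d <= pT p t.
Proof.
have K0 := Kp_ge0; have w0 := @pi2_gt0 R.
(* Scaled so that, for [r = 1 / (1 + A)], the bound [1 / p >= 1 / ((Kp + 2) r^2)] on an interval of
   length [r] contributes [(|M| + 1) (1 + A) / A > M] to the normalized integral. *)
set A : R := (Kp + 2) * (2 * pi) * (`|M| + 1).
have k2 : 0 < Kp + 2 by lra.
have m1 : 0 < `|M| + 1 by rewrite ltr_wpDl.
have A0 : 0 < A by rewrite /A mulr_gt0 // mulr_gt0.
pose r : R := (1 + A)^-1.
have r0 : 0 < r by rewrite invr_gt0; lra.
have r1 : r <= 1 by rewrite invf_le1; lra.
exists (r ^+ 2); first by rewrite exprn_gt0 // exprn_ile1 // ltW.
move=> p p0 hI hM t0; have [t [Tt ->]] : exists t, Tset t /\ pT p t0 = pT p t.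
  have [t Tt e] := reduce_Tset n t0; exists t; split=> //.
  by rewrite !ptrig_Re e.
rewrite leNgt; apply/negP => dip0.
have r01 : 0 < r <= 1 by rewrite r0.
have sd x h : pT p (x + h) + pT p (x - h) - 2 * pT p x <= Kp * h ^+ 2.
  by apply: le_trans (ptrig_second_diff x h p0) _; rewrite exprMn /Kp mulrAC.
have [a [a0 ar hx]] := dip K0 r01 p0 sd Tt.
have k0 : 0 < (Kp + 2) * r ^+ 2 by rewrite mulr_gt0 ?exprn_gt0.
have := @TRint_ge_itv R (Ip p) _ a r ((Kp + 2) * r ^+ 2)^-1 (pT_zeros p) hI a0 r0 ar.
have -> : ((Kp + 2) * r ^+ 2)^-1 * r / (2 * pi) = (`|M| + 1) * (1 + A) / A.
  have -> : 1 + A = r^-1 by rewrite invrK.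
  have p0' := @pi_gt0 R; rewrite /A; clearbody r.
  by move: (@pi R) p0' => q q0; field; rewrite !gt_eqF.
move=> h; have {h} : (`|M| + 1) * (1 + A) / A <= TRint (Ip p).
  apply: h => [|s _ _|s Ts nZ hs]; [by rewrite invr_ge0 ltW|by rewrite invr_ge0|].
  have ps : 0 < pT p s.
    by rewrite lt_def p0 andbT; apply/eqP => e; apply: nZ.
  rewrite /Ip lef_pV2 ?posrE //; apply: le_trans (hx s hs) _; nra.
have : `|M| + 1 <= (`|M| + 1) * (1 + A) / A.
  rewrite ler_pdivlMr // ler_wpM2l ?addr_ge0 //; lra.
have := ler_norm M; move: (_ / A) (TRint _) hM => y z; lra.
Qed.

(* For fixed d, s, B these uniformly interior points form a compact convex set. *)
Definition inK (d s B : R) p Q : Prop :=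
  [/\ forall t, d <= pT p t, psdQ (fun k => Q k - Qid m s k) & nrm Q <= B].

Lemma inK_psd d s B p Q t : inK d s B p Q -> herm_psd (QT Q t - (rC s)%:M).
Proof. by move=> [_ [_ h] _]; have := h t; rewrite QtrigB Qtrig_id. Qed.

Lemma inK_pd d s B p Q t : 0 < s -> inK d s B p Q -> herm_pd (QT Q t).
Proof.
move=> s0 /(inK_psd t) h; rewrite -(subrK (rC s)%:M (QT Q t)).
by apply: pd_addr => //; exact: pd_scalar.
Qed.

Lemma inK_sym d s B p Q : inK d s B p Q -> (Q ord0)^T = Q ord0.
Proof.
move=> [_ [h _] _]; move: h; rewrite /Qid eqxx linearB /= tr_scalar_mx.
exact: addIr.
Qed.

Lemma inK_psdQ d s B p Q : 0 < s -> inK d s B p Q -> psdQ Q.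
Proof.
move=> s0 hK; split; first exact: inK_sym hK.
by move=> t; apply/pd_psd/(inK_pd t s0 hK).
Qed.

Lemma inK_adm d s B p Q : 0 < d -> 0 < s -> inK d s B p Q -> adm p Q.
Proof.
move=> d0 s0 hK; split; [|exact: inK_psdQ hK|].
  by move=> t; case: hK => h _ _; apply: le_trans (ltW d0) (h t).
rewrite (_ : [set t | _]%classic = set0) //; apply/seteqP; split=> // t [_ /= e].
by move: (pd_unit (inK_pd t s0 hK)); rewrite unitmxE unitfE e eqxx.
Qed.

Lemma inK_Bo d s B p Q : 0 < d -> inK d s B p Q -> Bo p /\ Bo_bar p.
Proof.
move=> d0 [h _ _]; have b : Bo p by move=> t _; rewrite -pTE; exact: lt_le_trans d0 (h t).
by split=> // e e0; exists p; split=> // i; rewrite subrr normr0.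
Qed.

Lemma inK_Bm d s B p Q : 0 < s -> inK d s B p Q -> Bm Q /\ Bm_bar Q.
Proof.
move=> s0 hK; have b : Bm Q.
  by split; [exact: inK_sym hK|move=> t _; rewrite -QTE; exact: inK_pd hK].
split=> //; split.
  by move=> e e0; exists Q; split=> // k i j; rewrite subrr normr0.
move=> /(_ 0) h; have T0 : Tset (0 : R) by rewrite /Tset /= in_itv /= lexx pi2_gt0.
have := pd_unit (inK_pd 0 s0 hK); rewrite unitmxE unitfE QTE h // eqxx.
by [].
Qed.

(** Bounds the [p]-gradient [m ln p - ln det Q] of the integrand on [inK]: there [d <= p <= Pmax],
    [ln det Q >= m ln s] by monotonicity, and [ln det Q <= tr Q - m]. *)
Definition Cln (d s B : R) : R :=
  m%:R * (`|ln d| + `|ln Pmax|) + (m%:R * `|ln s| + m%:R * (2 * B) + m%:R).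

Lemma inK_ln d s B p Q t : 0 < d -> 0 < s -> inK d s B p Q ->
  `|m%:R * ln (pT p t) - ln (rdet (QT Q t))| <= Cln d s B.
Proof.
move=> d0 s0 hK; have pQ := inK_pd t s0 hK; have [hd _ hB] := hK.
have [p0 _ _] := inK_adm d0 s0 hK.
have dp : d <= pT p t := hd t; have pp : 0 < pT p t := lt_le_trans d0 dp.
have a1 : ln d <= ln (pT p t) by rewrite ler_ln ?posrE.
have a2 : ln (pT p t) <= ln Pmax by rewrite ler_ln ?posrE ?Pmax_gt0 ?pT_le.
have a3 : `|ln (pT p t)| <= `|ln d| + `|ln Pmax|.
  have := ler_norm (ln Pmax); have := ler_normr (- ln d) (ln d).
  rewrite ler_norml; have := normr_ge0 (ln d); have := normr_ge0 (ln Pmax).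
  have : - ln d <= `|ln d| by rewrite -normrN ler_norm.
  move: (`|ln d|) (`|ln Pmax|) a1 a2 => u v a1 a2 h1 h2 h3 _ h4.
  by apply/andP; split; lra.
have b1 : m%:R * ln s <= ln (rdet (QT Q t)).
  have := ln_rdet_mono (pd_scalar m s0) pQ (inK_psd t hK).
  by rewrite -scalemx1 rdetZ /rdet det1 mulr1 lnXnR.
have b2 : ln (rdet (QT Q t)) <= m%:R * (2 * B).
  have [h _] := pd_ln_rdet pQ; apply: le_trans h _.
  have := rtr_QT_le Q t; have : m%:R * (2 * nrm Q) <= m%:R * (2 * B).
    by rewrite ler_wpM2l // ler_pM2l.
  by have : 0 <= (m%:R : R) by []; move: (rtr _) (_ * (2 * nrm Q)) => u v; lra.
have b3 : `|m%:R * ln s| = m%:R * `|ln s| by rewrite normrM normr_nat.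
have b4 : 0 <= m%:R * (2 * B) by rewrite mulr_ge0 // mulr_ge0 // (le_trans (nrm_ge0 Q)).
apply: le_trans (ler_normB _ _) _; apply: lerD.
  by rewrite normrM normr_nat ler_wpM2l.
rewrite ler_norml; have := ler_norm (- (m%:R * ln s)); rewrite normrN b3.
have := mulr_ge0 (ler0n R m) (normr_ge0 (ln s)).
move: (m%:R * `|ln s|) (m%:R * (2 * B)) b1 b2 b4 (ler0n R m) => u v; move: (m%:R * ln s) (ln (rdet _)).
by move=> x y *; apply/andP; split; lra.
Qed.

Lemma inK_tint d s B p Q : 0 < d -> 0 < s -> inK d s B p Q ->
  tint (Fi p Q) /\ tint (Ip p).
Proof.
move=> d0 s0 hK; have [p0 pQ _] := inK_adm d0 s0 hK; split.
  apply: (@tint_bounded R _ (Pmax * Cln d s B + m%:R * Pmax)).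
    by apply: measurable_funTS; exact: measurable_Fint.
  move=> t _; rewrite /Fi FintE //; last exact: inK_pd hK.
  apply: le_trans (ler_normB _ _) _; apply: lerD; rewrite normrM.
    by apply: ler_pM => //; [rewrite ger0_norm // pT_le|exact: inK_ln hK].
  by rewrite normr_nat ler_wpM2l // ger0_norm // pT_le.
apply: (@tint_bounded R _ d^-1).
  by apply: measurable_funTS; apply: measurable_inv_ge0 => //; exact: measurable_pT.
move=> t _; have [hd _ _] := hK; have pp := lt_le_trans d0 (hd t).
by rewrite ger0_norm ?invr_ge0 // lef_pV2 ?posrE.
Qed.

Lemma inK_obj d s B p Q : 0 < d -> 0 < s -> inK d s B p Q -> obj p Q = (robj p Q)%:E.
Proof. by move=> d0 s0 /(inK_tint d0 s0)[hF hI]; exact: objective_fin. Qed.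

(** Cost per unit of [s] of passing from [Q] to [Q + s I] in the linear term and the penalty: no
    entry moves by more than [s]. *)
Definition Lam : R := nrm Rk + kap * gsum gamma.

Lemma Lam_ge0 : 0 <= Lam.
Proof. by rewrite addr_ge0 ?nrm_ge0 // mulr_ge0 ?gsum_ge0 // ltW // kap_gt0. Qed.

Lemma lin_Qsh s p Q : 0 <= s -> psdQ Q -> lin p (Qsh s Q) <= lin p Q + s * Lam.
Proof.
move=> s0 [sQ _]; rewrite /lin /Lam.
have h1 : Lf Rk (Qsh s Q) <= Lf Rk Q + s * nrm Rk.
  rewrite -lerBlDl [X in X - _](_ : _ = Lf Rk Q + Lf Rk (@Qid R m n s)); last exact: LfD.
  rewrite addrC addKr; apply: le_trans (ler_norm _) _; apply: Lf_le => // k i j.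
  by have := Qsh_entry Q k i j s0; rewrite /Qsh mxE [_ + _ - _]addrC addKr.
have h2 : kap * hW gamma (Qsh s Q) <= kap * (hW gamma Q + gsum gamma * s).
  rewrite ler_pM2l ?kap_gt0 //; apply: hW_sub_le => // k i j.
  exact: Qsh_entry.
move: h1 h2; rewrite !mulrDr; move: (Lf _ _) (Lf _ _) (hW _ _) (hW _ _) (gsum _) => a1 a2 a3 a4 a5.
by move: (s * nrm Rk) (cl p) => a6 a7; lra.
Qed.

(* Where Q is nearly singular, the gain in log det Q of order r beats the loss of order r^2. *)
Lemma Q_barrier (d B : R) : 0 < d -> 0 <= B -> exists2 r : R, 0 < r <= 1 &
  forall p Q, adm p Q -> (forall t, d <= pT p t) -> nrm Q <= B ->
    tint (Fi p Q) -> tint (Fi p (Qsh (r ^+ 2) Q)) -> tint (Ip p) ->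
    ~ psdQ (fun k => Q k - Qid m (r ^+ 2) k) ->
    robj p (Qsh (r ^+ 2) Q) < robj p Q.
Proof.
move=> d0 B0; have w0 := @pi2_gt0 R; have L0 := Lam_ge0.
set K : R := n%:R ^+ 2 * (2 * B) * m%:R.
have K0 : 0 <= K by rewrite !mulr_ge0 // sqr_ge0.
have K3 : 0 < K + 3 by lra.
(* On the interval given by [dip] the form is at most [(K + 2) r^2], so
   [r^2 / (qf + r^2) >= 1 / (K + 3)]. With [r = 1 / (1 + A)] the integrated gain
   [d / (K + 3) * r / (2 pi)] equals [r (Lam + 1) / A] and exceeds the loss [r^2 Lam]. *)
set A : R := (K + 3) * (2 * pi) * (Lam + 1) / d.
have L1 : 0 < Lam + 1 by lra.
have A0 : 0 < A by rewrite divr_gt0 // mulr_gt0 // mulr_gt0.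
pose r : R := (1 + A)^-1.
have r0 : 0 < r by rewrite invr_gt0; lra.
have r1 : r <= 1 by rewrite invf_le1; lra.
have rA : r * A <= 1 by rewrite mulrC ler_pdivrMr; lra.
have loss : r ^+ 2 * Lam < d / (K + 3) * r / (2 * pi).
  have -> : d / (K + 3) * r / (2 * pi) = r * ((Lam + 1) / A).
    have p0' := @pi_gt0 R; rewrite /A; clearbody r K.
    by move: (@pi R) p0' => q q0'; field; rewrite !gt_eqF.
  rewrite expr2 -mulrA ltr_pM2l // ltr_pdivlMr //; nra.
have g1 : 0 <= d / (K + 3) by rewrite divr_ge0 // ltW.
have step x y z : 0 <= x -> x <= 2 * y + K * z -> y < z -> 0 < z ->
    d / (K + 3) <= d * (z / (x + z)).
  move=> x0 hq q0 z0; rewrite (ler_pM2l d0) ler_pdivlMr ?ltr_wpDl // mulrC ler_pdivrMr //.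
  nra.
have KE : K = n%:R ^+ 2 * (2 * B) * m%:R by [].
have concl (vA vB TD F1 F2 I l1 l2 g L : R) : vA = F1 + I + l1 -> vB = F2 + I + l2 ->
    TD = F1 - F2 -> g <= TD -> L < g -> l2 <= l1 + L -> vB < vA.
  by move=> *; lra.
clearbody r A K.
exists r; first by rewrite r0.
move=> p Q aQ dp nB hF hF' hI nK; have [p0 pQ fZ] := aQ.
have s0 : 0 < r ^+ 2 by rewrite exprn_gt0.
(* Otherwise, after scaling any vector to unit length by [a], the form of [Q - r^2 I] would be
   nonnegative everywhere, against [nK]. *)
have [t0 [v [Tt0 v1 q0]]] : exists t v, [/\ Tset t, vnorm2 v = 1 & qf (QT Q t) v < r ^+ 2].
  apply: contrapT => nex; apply: nK.
  have sQ : (Q ord0 - @Qid R m n (r ^+ 2) ord0)^T = Q ord0 - @Qid R m n (r ^+ 2) ord0.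
    by rewrite /Qid eqxx linearB /= tr_scalar_mx (proj1 pQ).
  split; [exact: sQ|move=> t1]; have [t Tt ->] := Qtrig_reduce m n t1.
  apply/psdP; split; [exact: Qtrig_herm sQ|move=> v].
  have [->|vn] := eqVneq v 0; first by rewrite /qf mulmx0 mxE.
  have w := vnorm2_gt0 vn; have ws : 0 < Num.sqrt (vnorm2 v) by rewrite sqrtr_gt0.
  rewrite leNgt; apply/negP; rewrite QtrigB Qtrig_id qfD qfN qf_scalar => neg; apply: nex.
  set a := (Num.sqrt (vnorm2 v))^-1.
  have a2 : a ^+ 2 = (vnorm2 v)^-1 by rewrite exprVn sqr_sqrtr // ltW.
  have qs (M : 'M[R[i]]_m) : qf M (rC a *: v) = a ^+ 2 * qf M v.
    by rewrite /qf ctrZ conjc_rC -!scalemxAl -scalemxAr scalerA -rCM mxE ReM_rC.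
  exists t, (rC a *: v); split=> //.
    by rewrite /vnorm2 qs a2 mulVf // gt_eqF.
  by rewrite qs a2 mulrC ltr_pdivrMr //; lra.
have r01 : 0 < r <= 1 by rewrite r0.
have f0 t : 0 <= qf (QT Q t) v by case/psdP: (proj2 pQ t).
have sd x h : qf (QT Q (x + h)) v + qf (QT Q (x - h)) v - 2 * qf (QT Q x) v <= K * h ^+ 2.
  by rewrite KE; exact: qf_second_diff_le.
clear nB.
have [a [a0 ar hx]] := dip K0 r01 f0 sd Tt0.
(* The terms in [ln p] cancel in this difference and leave [p] times the gain in [ln det]. *)
pose D t := Fi p Q t - Fi p (Qsh (r ^+ 2) Q) t.
have hD : tint D by exact: tintB.
have DE t : Tset t -> ~ [set t | Tset t /\ \det (QT Q t) = 0]%classic t ->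
    D t = pT p t * (ln (rdet (QT Q t + (rC (r ^+ 2))%:M)) - ln (rdet (QT Q t))).
  move=> Tt nZ; rewrite /D /Fi (FintE (p0 t) (adm_pd aQ Tt nZ)) (FintE (p0 t) (Qsh_pd t s0 pQ)).
  rewrite Qtrig_sh; move: (ln (pT p t)) (ln (rdet (QT Q t))) (ln (rdet (QT Q t + _))) (pT p t).
  by move=> x y z w; ring.
have DI t : Tset t -> ~ [set t | Tset t /\ \det (QT Q t) = 0]%classic t ->
    d * (r ^+ 2 / (qf (QT Q t) v + r ^+ 2)) <= D t.
  move=> Tt nZ; rewrite (DE t Tt nZ).
  apply: (ler_pM (ltW d0) _ (dp t) (ln_rdet_gain (adm_pd aQ Tt nZ) s0 v1)).
  by apply: divr_ge0; [exact: ltW|apply: addr_ge0; [exact: f0|exact: ltW]].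
have gain : d / (K + 3) * r / (2 * pi) <= TRint D.
  apply: (TRint_ge_itv fZ hD a0 r0 ar).
  - exact: g1.
  - move=> t Tt nZ; apply: le_trans (DI t Tt nZ).
    apply: mulr_ge0; first exact: ltW.
    by apply: divr_ge0; [exact: ltW|apply: addr_ge0; [exact: f0|exact: ltW]].
  by move=> t Tt nZ /hx hq; apply: le_trans (DI t Tt nZ); exact: step (f0 t) hq q0 s0.
have E3 : TRint D = TRint (Fi p Q) - TRint (Fi p (Qsh (r ^+ 2) Q)) := TRintB hF hF'.
exact: (concl _ _ _ _ _ _ _ _ _ _ (robjE hF hI) (robjE hF' hI) E3 gain loss (lin_Qsh p (ltW s0) pQ)).
Qed.

End Problem.

(** * The minimizer *)

Section Solution.
Variables (R : realType) (m n N : nat) (alpha lam : R).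
Hypotheses (hN : (0 < N)%N) (halpha : 0 < alpha) (hlam : 0 < lam).
Variable gamma : 'I_m -> 'I_m -> R.
Hypothesis hgamma : forall j h : 'I_m, (h <= j)%N -> 0 <= gamma j h.
Variables (Rk : 'I_n.+1 -> 'M[R]_m) (c : 'I_n.+1 -> R).
Implicit Types (p : 'I_n -> R) (Q : 'I_n.+1 -> 'M[R]_m).

Local Notation rob p Q := (robj N alpha lam gamma Rk c p Q).
Local Notation ln' p Q := (lin N alpha gamma Rk c p Q).
Local Notation mu := (kmu N alpha lam).
Local Notation kp := (kap N alpha).

Lemma lin_lip p1 Q1 p2 Q2 (e : R) : 0 <= e -> (Q1 ord0)^T = Q1 ord0 ->
  (forall i, `|p1 i - p2 i| <= e) -> (forall k i j, `|Q1 k i j - Q2 k i j| <= e) ->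
  ln' p2 Q2 - ln' p1 Q1
    <= (nrm Rk + \sum_(i < n) `|c (lift ord0 i)| + kp * gsum gamma) * e.
Proof.
move=> e0 sQ hp hQ.
have h1 : Lf Rk Q2 - Lf Rk Q1 <= nrm Rk * e.
  rewrite (_ : _ - _ = Lf Rk (fun k => Q2 k + (-1) *: Q1 k)); last by rewrite LfD LfZ mulN1r.
  rewrite mulrC; apply: le_trans (ler_norm _) _; apply: Lf_le => // k i j.
  by rewrite !mxE mulN1r distrC.
have h2 : cl c p1 - cl c p2 <= (\sum_(i < n) `|c (lift ord0 i)|) * e.
  rewrite /cl opprD addrACA subrr add0r -sumrB mulr_suml; apply: ler_sum => i _.
  rewrite -mulrBl mulrC; apply: le_trans (ler_norm _) _.
  by rewrite normrM ler_wpM2l.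
have h3 : kp * hW gamma Q2 <= kp * (hW gamma Q1 + gsum gamma * e).
  rewrite (ler_pM2l (kap_gt0 hN halpha)); apply: hW_sub_le => // k i j.
  by rewrite distrC.
move: h1 h2 h3; rewrite /lin mulrDr !mulrDl mulrA.
move: (Lf _ _) (Lf _ _) (cl _ _) (cl _ _) (kp * hW _ _) (kp * hW _ _) => a1 a2 a3 a4 a5 a6.
by move: (nrm _ * e) => a7; move: (kp * _ * e) => a8; move: (_ * e) => a9; lra.
Qed.

Lemma robj_lip (d s B : R) : 0 < d -> 0 < s -> exists2 Cl : R, 0 < Cl &
  forall p1 Q1 p2 Q2 e, inK d s B p1 Q1 -> inK d s B p2 Q2 -> 0 <= e ->
    (forall i, `|p1 i - p2 i| <= e) -> (forall k i j, `|Q1 k i j - Q2 k i j| <= e) ->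
    rob p2 Q2 - rob p1 Q1 <= Cl * e.
Proof.
move=> d0 s0; pose Nn : R := n.+1%:R * (m%:R * m%:R).
have N0 : 0 <= Nn by rewrite !mulr_ge0.
(* Coefficients at distance [e] move [p] by at most [2 (n + 1) e] and the form of [Q] by at most
   [2 Nn e m]; [A1] is the resulting rate in [Hint_lip], [A2] that of [lin_lip]. *)
pose A1 : R := 2 * n.+1%:R * Cln m n d s B + Pmax R n * (2 * Nn * m%:R * (m%:R / s))
  + mu * (2 * n.+1%:R / d ^+ 2).
pose A2 : R := nrm Rk + \sum_(i < n) `|c (lift ord0 i)| + kp * gsum gamma.
exists (`|A1 + A2| + 1); first by rewrite ltr_wpDl.
move=> p1 Q1 p2 Q2 e k1 k2 e0 hp hQ.
have [f1 i1] := inK_tint d0 s0 k1; have [f2 i2] := inK_tint d0 s0 k2.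
have [t1 _] := TRint_Hint N alpha lam f1 i1; have [t2 _] := TRint_Hint N alpha lam f2 i2.
have hT : TRint (fun t => Hint mu (pT p2 t) (QT Q2 t))
        - TRint (fun t => Hint mu (pT p1 t) (QT Q1 t)) <= A1 * e.
  rewrite -(TRintB t2 t1) -[leRHS]TRint_cst.
  apply: (le_TRint (@finite_set0 R)); [exact: tintB t2 t1|exact: tint_cst|].
  move=> t _ _; pose e' : R := 2 * (Nn * e) * m%:R.
  have e0' : 0 <= e' by rewrite /e' !mulr_ge0.
  have pe : herm_psd ((rC e')%:M - (QT Q1 t - QT Q2 t)).
    apply/psdP; split.
      rewrite /hermitian !(ctrD, ctrN) ctr_scalar.
      by rewrite (Qtrig_herm t (inK_sym k1)) (Qtrig_herm t (inK_sym k2)).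
    move=> v; rewrite qfD qfN qf_scalar subr_ge0 -QtrigB.
    apply: le_trans (ler_norm _) _; apply: le_trans (qf_Qtrig_bound _ _ _) _.
    apply: ler_wpM2r; first exact: vnorm2_ge0.
    apply: ler_wpM2r => //; rewrite ler_pM2l //.
    by apply: nrm_le => k i j; rewrite !mxE.
  have [hd1 _ _] := k1; have [hd2 _ _] := k2; have [p0 _ _] := inK_adm d0 s0 k2.
  apply: le_trans (Hint_lip (kmu_gt0 hN halpha hlam) d0 s0 e0' (hd1 t) (hd2 t) (pT_le t p0)
    (inK_pd t s0 k1) (inK_pd t s0 k2) (inK_psd t k2) pe (inK_ln t d0 s0 k2)
    (pT_diff t e0 hp)) _.
  rewrite /e' /A1; move: (Cln _ _ _ _ _) (Pmax _ _) mu (m%:R / s) (d ^+ 2)^-1 => u1 u2 u3 u5 u6.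
  by rewrite le_eqVlt; apply/orP; left; apply/eqP; ring.
have hl := lin_lip e0 (inK_sym k1) hp hQ.
have hA : (A1 + A2) * e <= (`|A1 + A2| + 1) * e.
  by rewrite ler_wpM2r //; have := ler_norm (A1 + A2); lra.
rewrite -/A2 in hl; rewrite /robj; move: hT hl hA; rewrite !mulrDl.
move: (TRint _) (TRint _) (ln' _ _) (ln' _ _) (A1 * e) (A2 * e) (`|_| * e) (1 * e).
by move=> a1 a2 a3 a4 a5 a6 a7 a8 h1 h2 h3; lra.
Qed.

Lemma inK_lim (d s B : R) p Q :
  (forall e, 0 < e -> exists p' Q', [/\ inK d s B p' Q', forall i, `|p i - p' i| < e &
     forall k i j, `|Q k i j - Q' k i j| < e]) -> inK d s B p Q.
Proof.
move=> h; split.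
- move=> t; rewrite -subr_ge0; apply: (@lim_ge0 R (2 * n.+1%:R)) => [|e e0].
    by rewrite mulr_ge0.
  have [p' [Q' [[hd _ _] hp _]]] := h _ e0; have := hd t.
  have := @pT_diff R n p p' e t (ltW e0) (fun i => ltW (hp i)).
  by rewrite ler_norml => /andP[]; move: (pT _ _) (pT _ _) (_ * e) => x y z; lra.
- apply: psdQ_lim => e e0; have [p' [Q' [[_ hq _] _ hQ]]] := h _ e0.
  exists (fun k => Q' k - Qid m s k) => // k i j; have := hQ k i j.
  by rewrite !mxE; congr (`|_| < _); ring.
rewrite -subr_ge0; apply: (@lim_ge0 R (n.+1%:R * (m%:R * m%:R))) => [|e e0].
  by rewrite !mulr_ge0.
have [p' [Q' [[_ _ hB] _ hQ]]] := h _ e0.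
have := @nrmB_le R m n Q Q' e (fun k i j => ltW (hQ k i j)).
by move: (nrm _) (nrm _) (_ * e) hB => x y z; lra.
Qed.

Lemma inK_min (d s B : R) p0 Q0 : 0 < d -> 0 < s -> inK d s B p0 Q0 ->
  exists p Q, inK d s B p Q /\ forall p' Q', inK d s B p' Q' -> rob p Q <= rob p' Q'.
Proof.
move=> d0 s0 k0; have [Cl C0 lip] := robj_lip B d0 s0.
(* A pair of coefficient families is stored as one function on a finite type, as [lipschitz_min]
   expects. Coordinates of [p] are bounded by [2] and entries of [Q] by [B], whence the box size
   [2 + B]. *)
pose I : finType := ('I_n + 'I_n.+1 * 'I_m * 'I_m)%type.
pose dp (x : I -> R) (i : 'I_n) : R := x (inl i).
pose dQ (x : I -> R) (k : 'I_n.+1) : 'M[R]_m := \matrix_(i, j) x (inr (k, i, j)).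
pose en p Q (z : I) : R := match z with inl i => p i | inr (k, i, j) => Q k i j end.
have dpK p Q : dp (en p Q) = p by apply/funext.
have dQK p Q : dQ (en p Q) = Q by apply/funext => k; apply/matrixP => i j; rewrite mxE.
pose K := [set x | inK d s B (dp x) (dQ x)]%classic.
have [||||x Kx hx] := @lipschitz_min R I K (fun x => rob (dp x) (dQ x)) (2 + B) Cl _ C0.
- by exists (en p0 Q0); rewrite /K /mkset dpK dQK.
- move=> x Kx [i|[[k i] j]]; have [_ _ nB] := Kx; have B0 := le_trans (nrm_ge0 _) nB.
    have [pp _ _] := inK_adm d0 s0 Kx; have := p_coef_le i pp.
    by rewrite /dp; move: (`|_|) => y; lra.
  have := entry_le_nrm (dQ x) k i j; rewrite mxE.
  by move: (`|_|) (nrm _) nB => y z; lra.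
- move=> x hx; apply: inK_lim => e /hx[y Ky hy]; exists (dp y), (dQ y); split=> //.
    by move=> i; exact: hy.
  by move=> k i j; rewrite !mxE; exact: hy.
- move=> x y e Kx Ky e0 hxy; apply: lip => // [i|k i j]; first by rewrite distrC; exact: hxy.
  by rewrite !mxE distrC; exact: hxy.
exists (dp x), (dQ x); split=> // p' Q' k'.
by have := hx (en p' Q'); rewrite /K /mkset dpK dQK; apply.
Qed.

Lemma pT_midpoint p1 p2 t :
  pT (fun i => 2^-1 * (p1 i + p2 i)) t = (pT p1 t + pT p2 t) / 2.
Proof.
rewrite !ptrig_Re -ReD -strigD mulrC -ReM_rC -strigZ.
by congr complex.Re; congr strig; apply/funext => k; rewrite /pco; case: (unlift _ _) => [//|];
  field.
Qed.

Lemma Qtrig_midpoint Q1 Q2 t :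
  QT (fun k => 2^-1 *: Q1 k + 2^-1 *: Q2 k) t = rC 2^-1 *: (QT Q1 t + QT Q2 t).
Proof. by rewrite QtrigD !QtrigZ scalerDr. Qed.

Lemma nrm_midpoint Q1 Q2 :
  2 * nrm (fun k => 2^-1 *: Q1 k + 2^-1 *: Q2 k) <= nrm Q1 + nrm Q2.
Proof.
rewrite /nrm mulr_sumr -big_split; apply: ler_sum => k _.
rewrite mulr_sumr -big_split; apply: ler_sum => i _.
rewrite mulr_sumr -big_split; apply: ler_sum => j _ /=.
rewrite !mxE -mulrDr normrM gtr0_norm ?invr_gt0 // mulrA mulfV // mul1r.
exact: ler_normD.
Qed.

Lemma inK_midpoint (d s B : R) p1 Q1 p2 Q2 : inK d s B p1 Q1 -> inK d s B p2 Q2 ->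
  inK d s B (fun i => 2^-1 * (p1 i + p2 i)) (fun k => 2^-1 *: Q1 k + 2^-1 *: Q2 k).
Proof.
move=> [a1 b1 c1] [a2 b2 c2]; split.
- by move=> t; rewrite pT_midpoint; have := a1 t; have := a2 t; move: (pT _ _) (pT _ _) => x y; lra.
- have h : 0 <= 2^-1 :> R by rewrite invr_ge0.
  have := psdQ_D (psdQ_Z h b1) (psdQ_Z h b2).
  congr psdQ; apply/funext => k; by apply/matrixP => i j; rewrite !mxE; field.
have := nrm_midpoint Q1 Q2; by move: (nrm _) (nrm _) (nrm _) c1 c2 => x y z; lra.
Qed.

Lemma lin_midpoint p1 Q1 p2 Q2 : (Q1 ord0)^T = Q1 ord0 -> (Q2 ord0)^T = Q2 ord0 ->
  2 * ln' (fun i => 2^-1 * (p1 i + p2 i)) (fun k => 2^-1 *: Q1 k + 2^-1 *: Q2 k)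
    <= ln' p1 Q1 + ln' p2 Q2.
Proof.
move=> s1 s2; have h : 0 <= 2^-1 :> R by rewrite invr_ge0.
have e1 : cl c (fun i => 2^-1 * (p1 i + p2 i)) = 2^-1 * (cl c p1 + cl c p2).
  rewrite /cl addrACA -big_split /= mulrDr mulr_sumr; congr (_ + _); first by field.
  by apply: eq_bigr => i _; ring.
have := ler_wpM2l (ltW (kap_gt0 hN halpha)) (hW_comb hgamma h h s1 s2).
rewrite /lin LfD !LfZ e1 mulrDr [kp * (_ * _)]mulrCA [kp * (_ * hW _ Q2)]mulrCA.
move: (Lf _ _) (Lf _ _) (cl _ _) (cl _ _) (kp * hW _ Q1) (kp * hW _ Q2) (kp * hW _ _).
by move=> x1 x2 x3 x4 x5 x6 x7; lra.
Qed.

(** The convexity defect [E] at the midpoint is pointwise nonnegative, and optimality makes its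
    integral nonpositive. So it vanishes at infinitely many angles, where the equality case
    identifies the values; polynomials agreeing at infinitely many angles of a period coincide. *)
Lemma inK_min_unique (d s B : R) p1 Q1 p2 Q2 : 0 < d -> 0 < s ->
  inK d s B p1 Q1 -> inK d s B p2 Q2 ->
  (forall p' Q', inK d s B p' Q' -> rob p1 Q1 <= rob p' Q') -> rob p2 Q2 <= rob p1 Q1 ->
  p2 = p1 /\ Q2 = Q1.
Proof.
move=> d0 s0 k1 k2 hmin h21; have km := inK_midpoint k1 k2.
set pm := (fun _ => _) in km; set Qm := (fun _ => _ + _) in km.
have [f1 i1] := inK_tint d0 s0 k1; have [f2 i2] := inK_tint d0 s0 k2.
have [fm im] := inK_tint d0 s0 km.
have [t1 _] := TRint_Hint N alpha lam f1 i1; have [t2 _] := TRint_Hint N alpha lam f2 i2.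
have [tm _] := TRint_Hint N alpha lam fm im.
pose E t := Hint mu (pT p1 t) (QT Q1 t) + Hint mu (pT p2 t) (QT Q2 t)
  - 2 * Hint mu (pT pm t) (QT Qm t).
have tE : tint E := tintB (tintD t1 t2) (tintZ 2 tm).
have key t : 0 <= E t /\ (E t = 0 -> pT p1 t = pT p2 t /\ QT Q1 t = QT Q2 t).
  have [hd1 _ _] := k1; have [hd2 _ _] := k2.
  have [g1 g2] := Hint_midpoint (kmu_gt0 hN halpha hlam) (lt_le_trans d0 (hd1 t))
    (lt_le_trans d0 (hd2 t)) (inK_pd t s0 k1) (inK_pd t s0 k2).
  rewrite /E pT_midpoint Qtrig_midpoint; split; first by rewrite subr_ge0.
  by move=> e; apply: g2; apply/esym/subr0_eq.
have iE : TRint E = TRint (fun t => Hint mu (pT p1 t) (QT Q1 t))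
    + TRint (fun t => Hint mu (pT p2 t) (QT Q2 t)) - 2 * TRint (fun t => Hint mu (pT pm t) (QT Qm t)).
  by rewrite (TRintB (tintD t1 t2) (tintZ 2 tm)) (TRintD t1 t2) (TRintZ 2 tm).
have E0 : TRint E = 0.
  apply/eqP; rewrite eq_le; apply/andP; split.
    have := hmin _ _ km; have := lin_midpoint p1 p2 (inK_sym k1) (inK_sym k2).
    move: h21; rewrite iE /robj -/pm -/Qm.
    move: (TRint _) (TRint _) (TRint _) (ln' p1 Q1) (ln' p2 Q2) (ln' pm Qm).
    by move=> x1 x2 x3 x4 x5 x6; lra.
  rewrite -(TRint_cst 0); apply: (le_TRint (@finite_set0 R)) => //; first exact: tint_cst.
  by move=> t _ _; case: (key t).
have inf := TRint_eq0_infinite tE (fun t _ => proj1 (key t)) E0 (lexx 0) (@pi2_gt0 R) (lexx _).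
have sub t : (0 < t < 2 * pi /\ E t = 0) -> [/\ Tset t, pT p2 t = pT p1 t & QT Q2 t = QT Q1 t].
  move=> [/andP[ta tb] /(proj2 (key t))[-> ->]]; split=> //.
  by rewrite /Tset /= in_itv /= (ltW ta).
split.
  apply: ptrig_inj => fin; apply: inf; apply: sub_finite_set fin => t /sub[Tt e _].
  by split=> //; rewrite -!pTE.
have z : forall k, Q2 k - Q1 k = 0.
  apply: (@Qtrig_inj R m n (fun k => Q2 k - Q1 k)) => fin; apply: inf.
  apply: sub_finite_set fin => t /sub[Tt _ e]; split=> //=.
  by rewrite QtrigB e subrr.
by apply/funext => k; apply: subr0_eq.
Qed.

End Solution.

Lemma TRint_ge0 (R : realType) (f : R -> R) : tint f -> (forall t, Tset t -> 0 <= f t) ->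
  0 <= TRint f.
Proof.
move=> hf f0; rewrite -(TRint_cst 0); apply: (le_TRint (@finite_set0 R)) => //.
  exact: tint_cst.
by move=> t Tt _; exact: f0.
Qed.

Lemma bars_adm (R : realType) m n (p : 'I_n -> R) (Q : 'I_n.+1 -> 'M[R]_m) :
  Bo_bar p -> Bm_bar Q -> adm p Q.
Proof.
by move=> hp hQ; split; [exact: Bo_bar_ge0|exact: Bm_bar_psd|exact: det_zeros].
Qed.

Lemma pT_cst1 (R : realType) n t : pT (fun _ : 'I_n => 0 : R) t = 1.
Proof. by rewrite pT.unlock /ptrig big1 ?mulr0 ?addr0 // => i _; rewrite mul0r. Qed.

Lemma psdQ_Qid (R : realType) m n (s : R) : 0 <= s -> psdQ (@Qid R m n s).
Proof.
move=> s0; have h : (@Qid R m n s ord0)^T = @Qid R m n s ord0.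
  by rewrite /Qid eqxx tr_scalar_mx.
split; [exact: h|move=> t]; apply/psdP; split; first exact: Qtrig_herm h.
by move=> v; rewrite Qtrig_id qf_scalar mulr_ge0 // vnorm2_ge0.
Qed.

Lemma QidB (R : realType) m n (s s' : R) :
  (fun k => @Qid R m n s k - @Qid R m n s' k) = Qid m (s - s').
Proof.
apply/funext => k; apply/matrixP => i j; rewrite /Qid; case: (k == ord0); rewrite !mxE.
  by case: (i == j); rewrite ?mulr1n ?mulr0n ?subrr.
by rewrite subrr.
Qed.


Theorem theorem3 (R : realType) (m n N : nat)
  (hm : (0 < m)%N) (hn : (0 < n)%N) (hN : (0 < N)%N)
  (alpha lam : R) (halpha : 0 < alpha) (hlam : 0 < lam)
  (gamma : 'I_m -> 'I_m -> R)
  (hgamma : forall j h : 'I_m, (h <= j)%N -> 0 <= gamma j h)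
  (Rk : 'I_n.+1 -> 'M[R]_m) (hR0 : (Rk ord0)^T = Rk ord0)
  (c : 'I_n.+1 -> R)
  (hPhi : exists Phi : R -> 'M[R[i]]_m,
      psd_density Phi /\ pd_on_open_interval Phi /\ moments Phi Rk) :
  exists (p : 'I_n -> R) (Q : 'I_n.+1 -> 'M[R]_m),
    [/\ Bo_bar p /\ Bm_bar Q,
        (forall (p' : 'I_n -> R) (Q' : 'I_n.+1 -> 'M[R]_m),
            Bo_bar p' -> Bm_bar Q' ->
            (objective N alpha lam gamma Rk c p Q
               <= objective N alpha lam gamma Rk c p' Q')%E),
        (forall (p' : 'I_n -> R) (Q' : 'I_n.+1 -> 'M[R]_m),
            Bo_bar p' -> Bm_bar Q' ->
            (forall (p'' : 'I_n -> R) (Q'' : 'I_n.+1 -> 'M[R]_m),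
                Bo_bar p'' -> Bm_bar Q'' ->
                (objective N alpha lam gamma Rk c p' Q'
                   <= objective N alpha lam gamma Rk c p'' Q'')%E) ->
            p' = p /\ Q' = Q)
      & Bo p /\ Bm Q].
Proof.
have [Phi [dP [oP mP]]] := hPhi.
have [eps eps0 Lc] := Lf_coercive dP mP oP.
have k0 := kap_gt0 hN halpha; have mu0 := kmu_gt0 hN halpha hlam.
set mu := kmu N alpha lam in mu0.
pose ob (p : 'I_n -> R) (Q : 'I_n.+1 -> 'M[R]_m) := objective N alpha lam gamma Rk c p Q.
pose ro (p : 'I_n -> R) (Q : 'I_n.+1 -> 'M[R]_m) := robj N alpha lam gamma Rk c p Q.
(* The reference point [p = 1], [Q = I], in [inK d s B] as soon as [d] and [s] are at most [1] and
   [B] bounds its norm. *)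
pose p0 : 'I_n -> R := fun=> 0; pose Q0 : 'I_n.+1 -> 'M[R]_m := Qid m 1.
have inK0 (d s B : R) : d <= 1 -> s <= 1 -> nrm Q0 <= B -> inK d s B p0 Q0.
  move=> d1 s1 hB; split; [by move=> t; rewrite pT_cst1| |exact: hB].
  by rewrite /Q0 QidB; apply: psdQ_Qid; rewrite subr_ge0.
have [f0 i0] := inK_tint ltr01 ltr01 (inK0 1 1 _ (lexx _) (lexx _) (lexx _)).
have a0 := inK_adm ltr01 ltr01 (inK0 1 1 _ (lexx _) (lexx _) (lexx _)).
have e0 : ob p0 Q0 = (ro p0 Q0)%:E := objective_fin N alpha lam gamma Rk c f0 i0.
set v0 := ro p0 Q0 in e0.
(* On the sublevel set of [v0], each of the two nonnegative terms of [robj_lower] is at most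
   [v0 + C1]. *)
pose B : R := 2 * (v0 + C1 m c eps) / eps.
pose M : R := (v0 + C1 m c eps) / mu.
have bnd (p : 'I_n -> R) (Q : 'I_n.+1 -> 'M[R]_m) : adm p Q ->
    tint (fun t => Fint (pT p t) (QT Q t)) -> tint (fun t => (pT p t)^-1) ->
    ro p Q <= v0 -> nrm Q <= B /\ TRint (fun t => (pT p t)^-1) <= M.
  move=> aQ hF hI hv; have h := robj_lower lam hN halpha hgamma c eps0 Lc aQ hF hI.
  have h1 : 0 <= eps / 2 * nrm Q by rewrite mulr_ge0 ?nrm_ge0 // divr_ge0 // ltW.
  have h2 : 0 <= mu * TRint (fun t => (pT p t)^-1).
    rewrite mulr_ge0 ?(ltW mu0) //; apply: TRint_ge0 => // t _; rewrite invr_ge0.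
    by case: aQ.
  have h3 : eps / 2 * nrm Q + mu * TRint (fun t => (pT p t)^-1) - C1 m c eps <= v0.
    exact: le_trans h hv.
  rewrite /B /M !ler_pdivlMr //; move: h1 h2 h3; rewrite [_ * mu]mulrC [nrm Q * eps]mulrC.
  have -> : eps / 2 * nrm Q = eps * nrm Q / 2 by rewrite mulrAC.
  by move: (eps * _) (mu * _) (C1 _ _ _) => x y z h1 h2 h3; split; lra.
have [nB0 _] := bnd p0 Q0 a0 f0 i0 (lexx _).
have B0 : 0 <= B := le_trans (nrm_ge0 Q0) nB0.
have [d /andP[d0 d1] hd] := p_barrier n M.
have [r /andP[r0 r1] hr] := Q_barrier lam hN halpha hgamma Rk c d0 B0.
have s0 : 0 < r ^+ 2 by rewrite exprn_gt0.
have s1 : r ^+ 2 <= 1 by rewrite exprn_ile1 // ltW.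
set s := r ^+ 2 in hr s0 s1.
have K0 := inK0 d s B d1 s1 nB0.
have oK p Q : inK d s B p Q -> ob p Q = (ro p Q)%:E.
  exact: (inK_obj N alpha lam gamma Rk c d0 s0).
have dicho p Q : adm p Q -> (ob p Q <= v0%:E)%E ->
    inK d s B p Q \/ exists p' Q', inK d s B p' Q' /\ (ob p' Q' < ob p Q)%E.
  move=> aQ; rewrite {1}/ob.
  have [->|[hF hI oE]] := objective_cases hN halpha hlam gamma Rk c aQ.
    by rewrite leye_eq.
  rewrite oE lee_fin -/(ro p Q) => hv.
  have [nB hM] := bnd p Q aQ hF hI hv; have [pp pQ _] := aQ.
  have dp := hd p pp hI hM.
  have [hps|hps] := pselect (psdQ (fun k => Q k - Qid m s k)); first by left.
  (* The shifted polynomial minus [s I] is [Q] itself, so the lower bound of [inK] holds by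
     construction. Its own norm serves as a provisional bound, enough for integrability. *)
  have shK : (fun k => Qsh s Q k - Qid m s k) = Q.
    by apply/funext => k; rewrite /Qsh addrK.
  have k1 : inK d s (nrm (Qsh s Q)) p (Qsh s Q) by split; rewrite ?shK.
  have [hF' _] := inK_tint d0 s0 k1.
  have lt := hr p Q aQ dp nB hF hF' hI hps.
  (* The shift has lowered the value, which is still at most [v0]; hence the norm bound improves to
     the [B] fixed before. *)
  have [nB' _] := bnd p (Qsh s Q) (inK_adm d0 s0 k1) hF' hI (ltW (lt_le_trans lt hv)).
  have k2 : inK d s B p (Qsh s Q) by split; rewrite ?shK.
  right; exists p, (Qsh s Q); split=> //.
  by rewrite (oK _ _ k2) /ob oE lte_fin.
have [p [Q [kpQ hmin]]] := inK_min hN halpha hlam hgamma Rk c d0 s0 K0.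
have [bp bp'] := inK_Bo d0 kpQ; have [bQ bQ'] := inK_Bm s0 kpQ.
have best p' Q' : adm p' Q' -> (ob p Q <= ob p' Q')%E.
  move=> aQ; have le0 : (ob p Q <= v0%:E)%E by rewrite oK // lee_fin; exact: hmin.
  (* Values above [v0], [+oo] included, already exceed the minimum on the compact set. *)
  have [hle|/ltW] := leP (ob p' Q') v0%:E; last exact: le_trans.
  have [k1|[p1 [Q1 [k1 lt1]]]] := dicho p' Q' aQ hle.
    by rewrite !oK // lee_fin; exact: hmin.
  by apply: le_trans (ltW lt1); rewrite !oK // lee_fin; exact: hmin.
exists p, Q; split=> //.
  by move=> p' Q' hp' hQ'; apply: best; exact: bars_adm.
move=> p' Q' hp' hQ' opt.
have hle : (ob p' Q' <= ob p Q)%E by exact: opt.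
have hv : (ob p' Q' <= v0%:E)%E.
  by apply: le_trans hle _; rewrite oK // lee_fin; exact: hmin.
(* A minimizer outside [inK] would be strictly improved by a feasible point, so uniqueness on [inK]
   suffices. *)
have [k1|[p1 [Q1 [k1 lt1]]]] := dicho p' Q' (bars_adm hp' hQ') hv.
  apply: (inK_min_unique hN halpha hlam hgamma d0 s0 kpQ k1 hmin).
  by move: hle; rewrite !oK // lee_fin.
have [_ c1] := inK_Bo d0 k1; have [_ c2] := inK_Bm s0 k1.
by have := opt _ _ c1 c2; rewrite leNgt -/(ob p1 Q1) -/(ob p' Q') lt1.
Qed.
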